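(* Let $\Bbbk$ be a field of characteristic $0$. For all integers $d,d'\ge 0$, $$\operatorname{Ext}^1_{\mathbf{A}\textbf{-}\mathrm{Mod}}(T(S^{d}\circ\mathfrak{a}^{\#}),T(S^{d'}\circ\mathfrak{a}^{\#}))\cong\begin{cases}\Bbbk & \text{if } d'=d+2,\\ 0 & \text{otherwise.}\end{cases}$$
   Context: $\Bbbk$ is a field of characteristic $0$. A $\Bbbk$-linear PROP is a $\Bbbk$-linear strict symmetric monoidal category whose objects are the non-negative integers with tensor product given on objects by addition; $P_{1,1}:2\to 2$ denotes its symmetry. For a $\Bbbk$-linear category $\mathcal{C}$, a $\mathcal{C}$-module is a $\Bbbk$-linear functor from $\mathcal{C}$ to the category of $\Bbbk$-vector spaces; $\mathcal{C}\textbf{-}\mathrm{Mod}$ is the abelian category of $\mathcal{C}$-modules, in which Ext-groups are taken. $\mathbf{A}$ is the category of Jacobi diagrams in handlebodies (Habiro–Massuyeau). As a $\Bbbk$-linear PROP it is freely generated by a Casimir Hopf algebra $(H=1,\mu,\eta,\Delta,\varepsilon,S,\tilde c)$, that is, a cocommutative Hopf algebra object $(1,\mu,\eta,\Delta,\varepsilon,S)$ together with a morphism $\tilde c:0\to 2$ (Casimir $2$-tensor) satisfying (i) $(\Delta\otimes\mathrm{id}_1)\tilde c=(\mathrm{id}_1\otimes\eta\otimes\mathrm{id}_1)\tilde c+\eta\otimes\tilde c$, (ii) $P_{1,1}\tilde c=\tilde c$, (iii) $(ad\otimes ad)(\mathrm{id}_1\otimes P_{1,1}\otimes\mathrm{id}_1)(\Delta\otimes\tilde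 c)=\tilde c\,\varepsilon$, where $ad=\mu(\mu\otimes\mathrm{id}_1)(\mathrm{id}_2\otimes S)(\mathrm{id}_1\otimes P_{1,1})(\Delta\otimes\mathrm{id}_1):2\to 1$. $\mathbf{A}$ is $\mathbb{N}$-graded with $\mu,\eta,\Delta,\varepsilon,S$ in degree $0$ and $\tilde c$ in degree $1$. Its degree $0$ part $\mathbf{A}_0$ (the $\Bbbk$-linear PROP freely generated by a cocommutative Hopf algebra) is identified with $\Bbbk\mathbf{gr}^{\mathrm{op}}$, the $\Bbbk$-linearization of the opposite of the category $\mathbf{gr}$ of finitely generated free groups; the object $n$ corresponds to the free group $F_n$, and the generators $\mu,\eta,\Delta,\varepsilon,S$ correspond, respectively, to the group homomorphisms $F_1\to F_2,\ x\mapsto x_1x_2$; $F_1\to F_0$; $F_2\to F_1,\ x_1,x_2\mapsto x$; $F_0\to F_1$; $F_1\to F_1,\ x\mapsto x^{-1}$. The functor $T:\Bbbk\mathbf{gr}^{\mathrm{op}}\textbf{-}\mathrm{Mod}\to\mathbf{A}\textbf{-}\mathrm{Mod}$ is precomposition with the projection $\mathbf{A}\to\mathbf{A}_0\cong\Bbbk\mathbf{gr}^{\mathrm{op}}$ onto the degree $0$ part (killing all morphisms of positive degree). $\mathfrak{a}^{\#}:\Bbbk\mathbf{gr}^{\mathrm{op}}\to\Bbbk\textbf{-}\mathrm{Mod}$ is the dual of the abelianization functor, $\mathfrak{a}^{\#}(F)=\operatorname{Hom}(F^{\mathrm{ab}},\Bbbk)$ (extended $\Bbbk$-linearly), and $S^d$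 denotes the $d$-th symmetric power functor on $\Bbbk$-vector spaces, so that $(S^d\circ\mathfrak{a}^{\#})(m)=\operatorname{Sym}^d(\operatorname{Hom}(\mathbb{Z}^m,\Bbbk))$ (formed on $\mathbf{gr}^{\mathrm{op}}$ and then extended $\Bbbk$-linearly). *)

(* Defs.v *)
From HB Require Import structures.
From mathcomp Require Import all_boot all_algebra.
From mathcomp Require Import perm finmap monalg.
From mathcomp Require Import boolp functions.

Set Implicit Arguments.
Unset Strict Implicit.
Unset Printing Implicit Defensive.

Import GRing.Theory.
Local Open Scope ring_scope.
Local Open Scope quotient_scope.

Section Subspaces.
Variables (k : fieldType) (V : lmodType k).

Record subspace := Subspace {
  in_subspace :> V -> Prop;
  subspace0 : in_subspace 0;
  subspaceP : forall a u v, in_subspace u -> in_subspace v ->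
    in_subspace (a *: u + v)
}.

Variable P : subspace.

Definition subspace_pred : {pred V} := fun v => `[< P v >].

Fact subspace_pred_closed : submod_closed subspace_pred.
Proof.
split=> [|a u v /asboolP Pu /asboolP Pv]; apply/asboolP; first exact: subspace0.
exact: subspaceP.
Qed.

HB.instance Definition _ :=
  GRing.isSubmodClosed.Build k V subspace_pred subspace_pred_closed.

Definition subspace_type := {v : V | subspace_pred v}.
HB.instance Definition _ := SubChoice.on subspace_type.
HB.instance Definition _ := [SubChoice_isSubLmodule of subspace_type by <:].

Definition quotient_space := Quotient.quot subspace_pred.
HB.instance Definition _ := GRing.Zmodule.on quotient_space.

Definition qspace_pi (v : V) : quotient_space := \pi v.

Lemma qspace_piP u v : qspace_pi u = qspace_pi v <-> P (u - v).
Proof.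
rewrite /qspace_pi; split=> [/eqP|Puv].
  by rewrite -Quotient.idealrBE => /asboolP.
by apply/eqP; rewrite -Quotient.idealrBE; apply/asboolP.
Qed.

Lemma qspace_reprK (v : quotient_space) : qspace_pi (repr v) = v.
Proof. exact: reprK. Qed.

Fact qspace_pi_additive : zmod_morphism qspace_pi.
Proof. by move=> u v; rewrite /qspace_pi !piE. Qed.

Definition qspace_scale a (v : quotient_space) := qspace_pi (a *: repr v).

Lemma qspace_scaleE a v : qspace_scale a (qspace_pi v) = qspace_pi (a *: v).
Proof.
apply/qspace_piP; rewrite -scalerBr -[_ *: _]addr0; apply: subspaceP; last first.
  exact: subspace0.
by apply/qspace_piP; rewrite qspace_reprK.
Qed.

Let piB := qspace_pi_additive.
Let piD u v : qspace_pi (u + v) = qspace_pi u + qspace_pi v.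
Proof. by rewrite /qspace_pi !piE. Qed.

Fact qspace_scaleA a b v :
  qspace_scale a (qspace_scale b v) = qspace_scale (a * b) v.
Proof. by rewrite -[v]qspace_reprK !qspace_scaleE scalerA. Qed.
Fact qspace_scale1 : left_id 1 qspace_scale.
Proof. by move=> v; rewrite -[v]qspace_reprK qspace_scaleE scale1r. Qed.
Fact qspace_scaleDr : right_distributive qspace_scale +%R.
Proof.
move=> a u v; rewrite -[u]qspace_reprK -[v]qspace_reprK -piD !qspace_scaleE.
by rewrite -piD scalerDr.
Qed.
Fact qspace_scaleDl v : {morph qspace_scale^~ v : a b / a + b}.
Proof.
by move=> a b; rewrite -[v]qspace_reprK !qspace_scaleE -piD scalerDl.
Qed.

HB.instance Definition _ := GRing.Zmodule_isLmodule.Build k quotient_space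
  qspace_scaleA qspace_scale1 qspace_scaleDr qspace_scaleDl.

Fact qspace_pi_scalable : scalable qspace_pi.
Proof. by move=> a v; rewrite -qspace_scaleE. Qed.

HB.instance Definition _ :=
  GRing.isZmodMorphism.Build V quotient_space qspace_pi qspace_pi_additive.
HB.instance Definition _ :=
  GRing.isScalable.Build k V quotient_space *:%R qspace_pi qspace_pi_scalable.

End Subspaces.

Section Induced.
Variables (k : fieldType) (V W : lmodType k).
Variables (P : subspace V) (Q : subspace W) (f : {linear V -> W}).
Hypothesis fPQ : forall v, P v -> Q (f v).

Fact subspace_map_subproof (v : subspace_type P) : subspace_pred Q (f (val v)).
Proof. by case: v => v /= /asboolP Pv; apply/asboolP/fPQ. Qed.

Definition subspace_map (v : subspace_type P) : subspace_type Q :=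
  exist _ (f (val v)) (subspace_map_subproof v).

Fact subspace_map_linear : linear subspace_map.
Proof. by move=> a u v; apply: val_inj; rewrite /= !linearP. Qed.

HB.instance Definition _ := GRing.isLinear.Build k
  (subspace_type P) (subspace_type Q) *:%R subspace_map subspace_map_linear.

Definition quotient_map & (forall v, P v -> Q (f v)) := fun (v : quotient_space P) =>
  qspace_pi Q (f (repr v)).

Lemma quotient_mapE v : quotient_map fPQ (qspace_pi P v) = qspace_pi Q (f v).
Proof.
apply/qspace_piP; rewrite -linearB; apply: fPQ.
by apply/qspace_piP; rewrite qspace_reprK.
Qed.

Fact quotient_map_linear : linear (quotient_map fPQ).
Proof.
move=> a u v; rewrite -[u]qspace_reprK -[v]qspace_reprK.
by rewrite -linearP !quotient_mapE !linearP.
Qed.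

HB.instance Definition _ := GRing.isLinear.Build k
  (quotient_space P) (quotient_space Q) *:%R (quotient_map fPQ) quotient_map_linear.

End Induced.
Arguments subspace_map {k V W} P Q f fPQ.
Arguments quotient_map {k V W} P Q f fPQ.

Section LinearExtension.
Variables (k : fieldType) (V : lmodType k).

Section Linear.
Variable T : choiceType.

Definition lin_ext (h : T -> V) (f : {malg k[T]}) : V :=
  \sum_(t <- msupp f) f@_t *: h t.

Lemma lin_extEw h (d : {fset T}) f : (msupp f `<=` d)%fset ->
  lin_ext h f = \sum_(t <- d) f@_t *: h t.
Proof.
move=> le; rewrite /lin_ext (big_fset_incl _ le) //= => t _ /mcoeff_outdom ->.
by rewrite scale0r.
Qed.

Fact lin_ext_linear h : linear (lin_ext h).
Proof.
move=> a f g; pose d := (msupp f `|` msupp g)%fset.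
rewrite (@lin_extEw _ d (a *: f + g)); last first.
  apply: fsubset_trans (msuppD_le _ _) _.
  by apply: fsetSU; apply: msuppZ_le.
rewrite (@lin_extEw _ d f) ?fsubsetUl // (@lin_extEw _ d g) ?fsubsetUr //.
rewrite scaler_sumr -big_split /=; apply: eq_bigr => t _.
by rewrite mcoeffD mcoeffZ scalerDl scalerA.
Qed.

HB.instance Definition _ h := GRing.isLinear.Build k {malg k[T]} V *:%R
  (lin_ext h) (lin_ext_linear h).

Lemma lin_extU h t : lin_ext h << t >> = h t.
Proof.
rewrite (@lin_extEw h [fset t]%fset) ?msuppU_le // big_seq_fset1.
by rewrite mcoeffUU scale1r.
Qed.

Lemma linear_malg_eq (f g : {malg k[T]} -> V) : linear f -> linear g ->
  (forall t, f << t >> = g << t >>) -> f =1 g.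
Proof.
move=> lf lg fg v.
pose F : {linear {malg k[T]} -> V} := HB.pack f (GRing.isLinear.Build _ _ _ _ f lf).
pose G : {linear {malg k[T]} -> V} := HB.pack g (GRing.isLinear.Build _ _ _ _ g lg).
rewrite -[LHS]/(F v) -[RHS]/(G v) [v]monalgE !linear_sum; apply: eq_bigr => t _.
have -> : << v@_t *g t >> = v@_t *: << t >> :> {malg k[T]}.
  by apply/malgP => s; rewrite mcoeffZ !mcoeffU mulrnAr mulr1.
by rewrite !linearZ /= fg.
Qed.

End Linear.

Section Bilinear.
Variables T U : choiceType.

Definition bilin_ext (h : T -> U -> V) (f : {malg k[T]}) (g : {malg k[U]}) : V :=
  lin_ext (fun t => lin_ext (h t) g) f.

Fact bilin_ext_linearl h g : linear (fun f => bilin_ext h f g).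
Proof. by move=> a f f'; exact: lin_ext_linear. Qed.

Fact bilin_ext_linearr h f : linear (bilin_ext h f).
Proof.
have E g0 : bilin_ext h f g0 = \sum_(t <- msupp f) f@_t *: lin_ext (h t) g0.
  by [].
move=> a g g'; rewrite !E.
rewrite scaler_sumr -big_split; apply: eq_bigr => t _ /=.
by rewrite linearP scalerDr !scalerA mulrC.
Qed.

Lemma bilin_extU h t u : bilin_ext h << t >> << u >> = h t u.
Proof. by rewrite /bilin_ext !lin_extU. Qed.

End Bilinear.

End LinearExtension.

(* A [k]-linear category with type of objects [O]. *)
Record lincat (k : fieldType) (O : Type) := LinCat {
  lhom : O -> O -> lmodType k;
  lid : forall x, lhom x x;
  lcomp : forall x y z, lhom y z -> lhom x y -> lhom x z;
  lcomp_linearl : forall x y z (f : lhom x y),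
    linear (fun g : lhom y z => lcomp g f);
  lcomp_linearr : forall x y z (g : lhom y z),
    linear (fun f : lhom x y => lcomp g f);
  lcompA : forall x y z t (h : lhom z t) (g : lhom y z) (f : lhom x y),
    lcomp h (lcomp g f) = lcomp (lcomp h g) f;
  lcomp1l : forall x y (f : lhom x y), lcomp (lid y) f = f;
  lcomp1r : forall x y (f : lhom x y), lcomp f (lid x) = f
}.
Arguments lid {k O l}.

Record linfunctor (k : fieldType) (O O' : Type)
    (C : lincat k O) (D : lincat k O') := LinFunctor {
  lfun_ob : O -> O';
  lfun_hom : forall x y, lhom C x y -> lhom D (lfun_ob x) (lfun_ob y);
  lfun_linear : forall x y, linear (@lfun_hom x y);
  lfun_id : forall x, lfun_hom (lid x) = lid (lfun_ob x);
  lfun_comp : forall x y z (g : lhom C y z) (f : lhom C x y),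
    lfun_hom (lcomp g f) = lcomp (lfun_hom g) (lfun_hom f)
}.

Section Modules.
Variables (k : fieldType) (O : Type) (C : lincat k O).

Record cmodule := CModule {
  cmod_ob :> O -> lmodType k;
  cmod_act : forall x y, lhom C x y -> {linear cmod_ob x -> cmod_ob y};
  cmod_act_linear : forall x y a (f g : lhom C x y) v,
    cmod_act (a *: f + g) v = a *: cmod_act f v + cmod_act g v;
  cmod_act_id : forall x v, cmod_act (lid x) v = v;
  cmod_act_comp : forall x y z (g : lhom C y z) (f : lhom C x y) v,
    cmod_act (lcomp g f) v = cmod_act g (cmod_act f v)
}.

Record cmod_hom (M N : cmodule) := CModHom {
  cmh_fun :> forall x, {linear M x -> N x};
  cmh_nat : forall x y (f : lhom C x y) v,
    cmh_fun y (cmod_act M f v) = cmod_act N f (cmh_fun x v)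
}.

Record csubmodule (M : cmodule) := CSubmodule {
  csub_space :> forall x, subspace (M x);
  csub_act : forall x y (f : lhom C x y) v,
    csub_space x v -> csub_space y (cmod_act M f v)
}.

Section SubQuotient.
Variables (M : cmodule) (P : csubmodule M).

Definition csub_cmod : cmodule.
refine (@CModule (fun x => subspace_type (P x))
  (fun x y f => subspace_map (P x) (P y) (cmod_act M f) (csub_act f)) _ _ _).
- by move=> x y a f g v; apply: val_inj; rewrite /= cmod_act_linear.
- by move=> x v; apply: val_inj; rewrite /= cmod_act_id.
- by move=> x y z g f v; apply: val_inj; rewrite /= cmod_act_comp.
Defined.

Definition cquot_cmod : cmodule.
refine (@CModule (fun x => quotient_space (P x))
  (fun x y f => quotient_map (P x) (P y) (cmod_act M f) (csub_act f)) _ _ _).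
- move=> x y a f g v /=; rewrite -[v]qspace_reprK !quotient_mapE.
  by rewrite cmod_act_linear linearP.
- by move=> x v /=; rewrite -[v]qspace_reprK quotient_mapE cmod_act_id.
- move=> x y z g f v /=.
  by rewrite -[v]qspace_reprK !quotient_mapE cmod_act_comp.
Defined.

End SubQuotient.

Section Sum.
Variables (M N : cmodule).

Definition csum_act x y (f : lhom C x y) (v : (M x * N x)%type) : (M y * N y)%type :=
  (cmod_act M f v.1, cmod_act N f v.2).
Fact csum_act_linear x y f : linear (@csum_act x y f).
Proof. by move=> a u v; rewrite /csum_act !linearP. Qed.
HB.instance Definition _ x y f := GRing.isLinear.Build k (M x * N x)%type
  (M y * N y)%type *:%R (@csum_act x y f) (@csum_act_linear x y f).

Definition csum_cmod : cmodule.
refine (@CModule (fun x => (M x * N x)%type) (fun x y f => csum_act f) _ _ _).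
- by move=> x y a f g [u v]; rewrite /= /csum_act !cmod_act_linear.
- by move=> x [u v]; rewrite /= /csum_act !cmod_act_id.
- by move=> x y z g f [u v]; rewrite /= /csum_act !cmod_act_comp.
Defined.

End Sum.

(* Short exact sequences 0 -> N -> E -> M -> 0. *)
Record extension (M N : cmodule) := Extension {
  ext_mid :> cmodule;
  ext_inj : cmod_hom N ext_mid;
  ext_proj : cmod_hom ext_mid M;
  ext_injP : forall x, injective (ext_inj x);
  ext_projP : forall x m, exists e, ext_proj x e = m;
  ext_exact : forall x e, ext_proj x e = 0 <-> exists n, e = ext_inj x n
}.

(* Such an [h] is automatically an isomorphism, by the five lemma. *)
Definition ext_equiv M N (E F : extension M N) : Prop :=
  exists h : cmod_hom E F,
    (forall x n, h x (ext_inj E x n) = ext_inj F x n) /\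
    (forall x e, ext_proj F x (h x e) = ext_proj E x e).

Section Baer.
Variables (M N : cmodule) (E F : extension M N).

Definition baer_pullback_space x : subspace (csum_cmod E F x).
refine (@Subspace _ (csum_cmod E F x)
  (fun v => ext_proj E x v.1 = ext_proj F x v.2) _ _).
- by rewrite !linear0.
- by move=> a u v eu ev; rewrite !linearP eu ev.
Defined.

Definition baer_pullback : csubmodule (csum_cmod E F).
by exists baer_pullback_space => x y f [e e'] /= ee'; rewrite !cmh_nat ee'.
Defined.

Definition baer_antidiag_space x : subspace (csub_cmod baer_pullback x).
refine (@Subspace _ (csub_cmod baer_pullback x)
  (fun v => exists n, val v = (ext_inj E x n, - ext_inj F x n)) _ _).
- by exists 0; rewrite !linear0.
- move=> a u v [n en] [n' en']; exists (a *: n + n').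
  rewrite (_ : val _ = a *: val u + val v) // en en'.
  by congr pair; rewrite /= linearP // opprD scalerN.
Defined.

Definition baer_antidiag : csubmodule (csub_cmod baer_pullback).
exists baer_antidiag_space => x y f v [n en]; exists (cmod_act N f n).
by rewrite /= en /= /csum_act !cmh_nat /= linearN.
Defined.

Definition baer_mid : cmodule := cquot_cmod baer_antidiag.

Definition baer_inj_pair x (n : N x) : csub_cmod baer_pullback x.
exists (ext_inj E x n, 0); apply/asboolP => /=; rewrite linear0.
by apply/ext_exact; exists n.
Defined.

Definition baer_inj_fun x (n : N x) : baer_mid x :=
  qspace_pi (baer_antidiag x) (baer_inj_pair n).

Fact baer_inj_fun_linear x : linear (@baer_inj_fun x).
Proof.
move=> a n n'; rewrite /baer_inj_fun -linearP; congr (qspace_pi _ _).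
by apply: val_inj => /=; congr pair; rewrite /= ?linearP ?scaler0 ?addr0.
Qed.
HB.instance Definition _ x := GRing.isLinear.Build k (N x) (baer_mid x) *:%R
  (@baer_inj_fun x) (@baer_inj_fun_linear x).

Definition baer_inj : cmod_hom N baer_mid.
exists (fun x => @baer_inj_fun x) => x y f n /=.
rewrite quotient_mapE; congr (qspace_pi _ _); apply: val_inj.
by rewrite /= /csum_act /= cmh_nat linear0.
Defined.

Definition baer_proj_fun x (v : baer_mid x) : M x :=
  ext_proj E x (val (repr v)).1.

Lemma baer_proj_funE x v :
  @baer_proj_fun x (qspace_pi (baer_antidiag x) v) = ext_proj E x (val v).1.
Proof.
rewrite /baer_proj_fun; set w := repr _.
have [n /= en] : baer_antidiag x (w - v).
  by apply/qspace_piP; rewrite qspace_reprK.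
apply/eqP; rewrite -subr_eq0 -linearB; apply/eqP/ext_exact.
by exists n; case: en.
Qed.

Fact baer_proj_fun_linear x : linear (@baer_proj_fun x).
Proof.
move=> a u v; rewrite -[u]qspace_reprK -[v]qspace_reprK -linearP.
by rewrite !baer_proj_funE linearP.
Qed.
HB.instance Definition _ x := GRing.isLinear.Build k (baer_mid x) (M x) *:%R
  (@baer_proj_fun x) (@baer_proj_fun_linear x).

Definition baer_proj : cmod_hom baer_mid M.
exists (fun x => @baer_proj_fun x) => x y f v /=.
by rewrite -[v]qspace_reprK quotient_mapE !baer_proj_funE /= cmh_nat.
Defined.

Fact baer_injP x : injective (baer_inj x).
Proof.
move=> n n' /qspace_piP [m /= [e0 e1]].
have m0 : m = 0.
  apply: (@ext_injP _ _ F x); rewrite linear0.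
  by apply: oppr_inj; rewrite -e1 subrr oppr0.
by apply: (@ext_injP _ _ E x); apply/eqP; rewrite -subr_eq0 e0 m0 linear0.
Qed.

Fact baer_projP x m : exists e, baer_proj x e = m.
Proof.
have [e <-] := ext_projP E m; have [e' ee'] := ext_projP F (ext_proj E x e).
have P : subspace_pred (baer_pullback x) (e, e') by apply/asboolP.
exists (qspace_pi (baer_antidiag x) (exist _ (e, e') P)).
by rewrite /= baer_proj_funE.
Qed.

Fact baer_exact x e : baer_proj x e = 0 <-> exists n, e = baer_inj x n.
Proof.
rewrite -[e]qspace_reprK; case: (repr e) => -[/= u v] uvP.
rewrite baer_proj_funE /=; split; last first.
  by move=> [n /(congr1 (baer_proj x)) /=]; rewrite !baer_proj_funE /= => ->;
    apply/ext_exact; exists n.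
move=> u0; have v0 : ext_proj F x v = 0 by move/asboolP: uvP => /= <-.
move/ext_exact: u0 => [n un]; move/ext_exact: v0 => [m vm].
exists (n + m); apply/qspace_piP; exists (- m) => /=; rewrite un vm.
congr pair; rewrite /= linearN ?opprK ?subr0 //.
by rewrite (linearD (ext_inj E x)) opprD addrA subrr sub0r.
Qed.

(* [E x_M F] modulo [{(n, - n)}], i.e. the pushout along [N + N -> N] of the
   pullback along [M -> M + M] of the direct sum of [E] and [F]. *)
Definition baer_sum : extension M N :=
  Extension baer_injP baer_projP baer_exact.

End Baer.

Section Scale.
Variables (M N : cmodule) (a : k) (E : extension M N).

Definition ext_scale_space x : subspace (csum_cmod N E x).
refine (@Subspace _ (csum_cmod N E x)
  (fun v => exists n, v = (a *: n, - ext_inj E x n)) _ _).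
- by exists 0; rewrite scaler0 !linear0.
- move=> b u v [n ->] [n' ->]; exists (b *: n + n').
  congr pair => /=; last by rewrite linearP opprD scalerN.
  by rewrite scalerDr !scalerA mulrC.
Defined.

Definition ext_scale_sub : csubmodule (csum_cmod N E).
exists ext_scale_space => x y f v [n ->]; exists (cmod_act N f n).
by rewrite /= /csum_act /= linearZ linearN cmh_nat.
Defined.

Definition ext_scale_mid : cmodule := cquot_cmod ext_scale_sub.

Definition ext_scale_inj_fun x (n : N x) : ext_scale_mid x :=
  qspace_pi (ext_scale_sub x) (n, 0).

Fact ext_scale_inj_fun_linear x : linear (@ext_scale_inj_fun x).
Proof.
move=> b n n'; rewrite /ext_scale_inj_fun -linearP; congr (qspace_pi _ _).
by congr pair; rewrite /= scaler0 addr0.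
Qed.
HB.instance Definition _ x := GRing.isLinear.Build k (N x) (ext_scale_mid x)
  *:%R (@ext_scale_inj_fun x) (@ext_scale_inj_fun_linear x).

Definition ext_scale_inj : cmod_hom N ext_scale_mid.
exists (fun x => @ext_scale_inj_fun x) => x y f n /=.
rewrite quotient_mapE; congr (qspace_pi _ _).
by rewrite /= /csum_act /= linear0.
Defined.

Definition ext_scale_proj_fun x (v : ext_scale_mid x) : M x :=
  ext_proj E x (repr v).2.

Lemma ext_proj_inj x n : ext_proj E x (ext_inj E x n) = 0.
Proof. by apply/ext_exact; exists n. Qed.

Lemma ext_scale_proj_funE x v :
  @ext_scale_proj_fun x (qspace_pi (ext_scale_sub x) v) = ext_proj E x v.2.
Proof.
rewrite /ext_scale_proj_fun; set w := repr _.
have [n /= en] : ext_scale_sub x (w - v).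
  by apply/qspace_piP; rewrite qspace_reprK.
apply/eqP; rewrite -subr_eq0 -linearB; move: en => [_ ->].
by rewrite linearN ext_proj_inj oppr0.
Qed.

Fact ext_scale_proj_fun_linear x : linear (@ext_scale_proj_fun x).
Proof.
move=> b u v; rewrite -[u]qspace_reprK -[v]qspace_reprK -linearP.
by rewrite !ext_scale_proj_funE linearP.
Qed.
HB.instance Definition _ x := GRing.isLinear.Build k (ext_scale_mid x) (M x)
  *:%R (@ext_scale_proj_fun x) (@ext_scale_proj_fun_linear x).

Definition ext_scale_proj : cmod_hom ext_scale_mid M.
exists (fun x => @ext_scale_proj_fun x) => x y f v /=.
by rewrite -[v]qspace_reprK quotient_mapE !ext_scale_proj_funE /= cmh_nat.
Defined.

Fact ext_scale_injP x : injective (ext_scale_inj x).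
Proof.
move=> n n' /qspace_piP [m /= [e0 e1]].
have m0 : m = 0.
  apply: (@ext_injP _ _ E x); rewrite linear0.
  by apply: oppr_inj; rewrite -e1 subrr oppr0.
by apply/eqP; rewrite -subr_eq0 e0 m0 scaler0.
Qed.

Fact ext_scale_projP x m : exists e, ext_scale_proj x e = m.
Proof.
have [e <-] := ext_projP E m; exists (qspace_pi (ext_scale_sub x) (0, e)).
by rewrite /= ext_scale_proj_funE.
Qed.

Fact ext_scale_exact x e :
  ext_scale_proj x e = 0 <-> exists n, e = ext_scale_inj x n.
Proof.
rewrite -[e]qspace_reprK; case: (repr e) => [/= u v].
rewrite ext_scale_proj_funE /=; split; last first.
  move=> [n /(congr1 (ext_scale_proj x)) /=]; rewrite !ext_scale_proj_funE /=.
  by move=> ->; rewrite linear0.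
move=> /ext_exact [n vn]; exists (u + a *: n); apply/qspace_piP.
exists (- n); rewrite vn /=.
congr pair; rewrite /= ?linearN ?opprK ?sub0r ?subr0 //.
by rewrite opprD addrA subrr sub0r ?linearN.
Qed.

(* The pushout of [E] along [a] times the identity of [N]. *)
Definition ext_scale : extension M N :=
  Extension ext_scale_injP ext_scale_projP ext_scale_exact.

End Scale.

(* [Ext^1] in the abelian category of [C]-modules, as Yoneda classes of
   extensions. It lives in a larger universe than the carriers of [lmodType],
   so an isomorphism with [V] is expressed directly on the classes. *)
Definition Ext1 (M N : cmodule) :=
  {c : extension M N -> Prop | exists E, c = ext_equiv E}.

Definition ext_class M N (E : extension M N) : Ext1 M N :=
  exist _ (ext_equiv E) (ex_intro _ E erefl).

Definition Ext1_iso (M N : cmodule) (V : lmodType k) : Prop :=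
  exists phi : Ext1 M N -> V,
  [/\ bijective phi,
      forall E F : extension M N, phi (ext_class (baer_sum E F)) =
        phi (ext_class E) + phi (ext_class F) &
      forall a (E : extension M N),
        phi (ext_class (ext_scale a E)) = a *: phi (ext_class E)].

End Modules.

Record category (O : Type) := Category {
  chom : O -> O -> choiceType;
  cid1 : forall x, chom x x;
  ccomp : forall x y z, chom y z -> chom x y -> chom x z;
  ccompA : forall x y z t (h : chom z t) (g : chom y z) (f : chom x y),
    ccomp h (ccomp g f) = ccomp (ccomp h g) f;
  ccomp1l : forall x y (f : chom x y), ccomp (cid1 y) f = f;
  ccomp1r : forall x y (f : chom x y), ccomp f (cid1 x) = f
}.
Arguments cid1 {O c}.

Definition opposite (O : Type) (C : category O) : category O.
refine (@Category O (fun x y => chom C y x) (fun x => cid1 x)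
  (fun x y z g f => ccomp f g) _ _ _).
- by move=> x y z t h g f; rewrite ccompA.
- by move=> x y f; rewrite ccomp1r.
- by move=> x y f; rewrite ccomp1l.
Defined.

Record vfunctor (k : fieldType) (O : Type) (C : category O) := VFunctor {
  vfun_ob : O -> lmodType k;
  vfun_hom : forall x y, chom C x y -> {linear vfun_ob x -> vfun_ob y};
  vfun_id : forall x v, vfun_hom (cid1 x) v = v;
  vfun_comp : forall x y z (g : chom C y z) (f : chom C x y) v,
    vfun_hom (ccomp g f) v = vfun_hom g (vfun_hom f v)
}.

Section Linearization.
Variables (k : fieldType) (O : Type) (C : category O).

Definition linz_comp x y z :
    {malg k[chom C y z]} -> {malg k[chom C x y]} -> {malg k[chom C x z]} :=
  bilin_ext (fun g f => << ccomp g f >>).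

Definition linearization : lincat k O.
refine (@LinCat k O (fun x y => {malg k[chom C x y]}) (fun x => << cid1 x >>)
  linz_comp _ _ _ _ _).
- by move=> x y z f; apply: bilin_ext_linearl.
- by move=> x y z g; apply: bilin_ext_linearr.
- move=> x y z t h g f; rewrite /linz_comp.
  move: h; apply: linear_malg_eq => [||h].
  + exact: bilin_ext_linearl.
  + by move=> a u v; rewrite !bilin_ext_linearl.
  move: g; apply: linear_malg_eq => [||g].
  + by move=> a u v; rewrite bilin_ext_linearl bilin_ext_linearr.
  + by move=> a u v; rewrite bilin_ext_linearr bilin_ext_linearl.
  move: f; apply: linear_malg_eq => [||f].
  + by move=> a u v; rewrite !bilin_ext_linearr.
  + exact: bilin_ext_linearr.
  by rewrite !bilin_extU ccompA.
- move=> x y; apply: linear_malg_eq => [||f] //.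
  + exact: bilin_ext_linearr.
  + by rewrite /linz_comp bilin_extU ccomp1l.
- move=> x y; apply: linear_malg_eq => [||f] //.
  + exact: bilin_ext_linearl.
  + by rewrite /linz_comp bilin_extU ccomp1r.
Defined.

Variable F : vfunctor k C.

Definition linz_act x y (f : lhom linearization x y) (v : vfun_ob F x) :
    vfun_ob F y :=
  lin_ext (fun g => vfun_hom F g v) f.

Fact linz_act_linear x y f : linear (@linz_act x y f).
Proof.
move=> a u v; rewrite /linz_act /lin_ext scaler_sumr -big_split /=.
by apply: eq_bigr => t _; rewrite linearP scalerDr !scalerA mulrC.
Qed.
HB.instance Definition _ x y f := GRing.isLinear.Build k (vfun_ob F x)
  (vfun_ob F y) *:%R (@linz_act x y f) (@linz_act_linear x y f).

Definition linear_extension : cmodule linearization.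
refine (@CModule k O linearization (vfun_ob F) (fun x y f => linz_act f) _ _ _).
- by move=> x y a f g v; apply: lin_ext_linear.
- by move=> x v; rewrite /= /linz_act lin_extU vfun_id.
- move=> x y z g f v /=; move: g; apply: linear_malg_eq => [||g].
  + move=> a g g'.
    exact: etrans (congr1 (lin_ext _) (lcomp_linearl f a g g'))
      (lin_ext_linear _ _ _ _).
  + exact: lin_ext_linear.
  move: f; apply: linear_malg_eq => [||f].
  + move=> a f f'.
    exact: etrans (congr1 (lin_ext _) (lcomp_linearr
      (<< g >> : lhom linearization y z) a f f'))
      (lin_ext_linear _ _ _ _).
  + move=> a f f'; rewrite /linz_act lin_ext_linear.
    exact: (@linz_act_linear y z << g >>).
  by rewrite /linz_act /= /linz_comp bilin_extU !lin_extU vfun_comp.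
Defined.

End Linearization.
Arguments linearization k {O} C.

Section FreeGroup.
Variable n : nat.

(* The letter [(i, false)] stands for [x_i] and [(i, true)] for its inverse. *)
Notation word := (seq ('I_n * bool)).

Inductive word_eq : word -> word -> Prop :=
| word_refl u : word_eq u u
| word_sym u v : word_eq u v -> word_eq v u
| word_trans u v w : word_eq u v -> word_eq v w -> word_eq u w
| word_cancel u i b v : word_eq (u ++ (i, b) :: (i, ~~ b) :: v) (u ++ v).

Definition word_eqb (u v : word) := `[< word_eq u v >].
Fact word_eqb_equiv : equiv_class_of word_eqb.
Proof.
split=> [u|u v|v u w]; first by apply/asboolP/word_refl.
- by apply/asboolP/asboolP => /word_sym.
- by move=> /asboolP uv /asboolP vw; apply/asboolP/(word_trans uv vw).
Qed.
Canonical word_equiv := EquivRelPack word_eqb_equiv.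
Canonical word_encModRel := defaultEncModRel word_eqb.

Definition freegroup := {eq_quot word_eqb}.
HB.instance Definition _ := Choice.on freegroup.

Definition fg_class (u : word) : freegroup := \pi u.

Lemma fg_classP u v : fg_class u = fg_class v <-> word_eq u v.
Proof. by split=> [/eqmodP/asboolP|uv] //; apply/eqmodP/asboolP. Qed.

Lemma fg_reprK (x : freegroup) : fg_class (repr x) = x. Proof. exact: reprK. Qed.

Lemma word_eq_cat u u' v v' :
  word_eq u u' -> word_eq v v' -> word_eq (u ++ v) (u' ++ v').
Proof.
move=> uu' vv'; apply: (@word_trans _ (u' ++ v)).
  elim: uu' => {u u'} [u|u w _ /word_sym//|u w z _ uw _|u i b w].
  - exact: word_refl.
  - exact: word_trans.
  - by rewrite -!catA; apply: word_cancel.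
elim: vv' => {v v'} [v|v w _ /word_sym//|v w z _ vw _|v i b w].
- exact: word_refl.
- exact: word_trans.
- by rewrite !catA; apply: word_cancel.
Qed.

Definition word_inv (u : word) : word := rev [seq (l.1, ~~ l.2) | l <- u].

Lemma word_inv_eq u v : word_eq u v -> word_eq (word_inv u) (word_inv v).
Proof.
elim=> {u v} [u|u v _ /word_sym//|u v w _ uv _|u i b v].
- exact: word_refl.
- exact: word_trans.
- rewrite /word_inv !map_cat !rev_cat /= !rev_cons -!cats1 -!catA /=.
  by rewrite negbK; apply: word_cancel.
Qed.

Lemma word_mulV u : word_eq (u ++ word_inv u) [::].
Proof.
elim/last_ind: u => [|u [i b] IHu]; first exact: word_refl.
rewrite /word_inv map_rcons rev_rcons -cats1 -catA /=.
exact: word_trans (word_cancel _ _ _ _) IHu.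
Qed.

Lemma word_invK : involutive word_inv.
Proof.
move=> u; rewrite /word_inv map_rev revK -map_comp -[RHS]map_id.
by apply: eq_map => -[i b] /=; rewrite negbK.
Qed.

Definition fg_one := fg_class [::].
Definition fg_mul (x y : freegroup) := fg_class (repr x ++ repr y).
Definition fg_inv (x : freegroup) := fg_class (word_inv (repr x)).

Lemma fg_mulE u v : fg_mul (fg_class u) (fg_class v) = fg_class (u ++ v).
Proof. by apply/fg_classP/word_eq_cat; apply/fg_classP; rewrite fg_reprK. Qed.

Lemma fg_invE u : fg_inv (fg_class u) = fg_class (word_inv u).
Proof. by apply/fg_classP/word_inv_eq/fg_classP; rewrite fg_reprK. Qed.

Fact fg_mulA : associative fg_mul.
Proof.
move=> x y z; rewrite -[x]fg_reprK -[y]fg_reprK -[z]fg_reprK.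
by rewrite !fg_mulE catA.
Qed.
Fact fg_mul1 : left_id fg_one fg_mul.
Proof. by move=> x; rewrite -[x]fg_reprK fg_mulE. Qed.
Fact fg_mulr1 : right_id fg_one fg_mul.
Proof. by move=> x; rewrite -[x]fg_reprK fg_mulE cats0. Qed.
Fact fg_mulrV : right_inverse fg_one fg_inv fg_mul.
Proof.
move=> x; rewrite -[x]fg_reprK fg_invE fg_mulE; apply/fg_classP.
exact: word_mulV.
Qed.
Fact fg_mulV : left_inverse fg_one fg_inv fg_mul.
Proof.
move=> x; rewrite -[x]fg_reprK fg_invE fg_mulE; apply/fg_classP.
by rewrite -{2}[repr x]word_invK; apply: word_mulV.
Qed.

HB.instance Definition _ := isGroup.Build freegroup
  fg_mulA fg_mul1 fg_mulr1 fg_mulV fg_mulrV.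

Definition fg_gen (i : 'I_n) : freegroup := fg_class [:: (i, false)].

End FreeGroup.

Local Open Scope group_scope.

Section FreeGroupLift.
Variables (n : nat) (G : groupType) (x : 'I_n -> G).

Definition word_eval (u : seq ('I_n * bool)) : G :=
  foldr (fun l g => (if l.2 then (x l.1)^-1 else x l.1) * g) 1 u.

Lemma word_eval_cat u v : word_eval (u ++ v) = word_eval u * word_eval v.
Proof. by elim: u => [|l u IHu] /=; rewrite ?mul1g // IHu mulgA. Qed.

Lemma word_eval_eq u v : word_eq u v -> word_eval u = word_eval v.
Proof.
elim=> {u v} [u|u v _ ->|u v w _ -> _ ->|u i b v] //.
rewrite !word_eval_cat /=; congr (_ * _).
by case: b; rewrite /= ?mulKg ?mulVKg.
Qed.

Definition fg_lift (g : freegroup n) : G := word_eval (repr g).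

Lemma fg_liftE u : fg_lift (fg_class u) = word_eval u.
Proof. by apply/word_eval_eq/fg_classP; rewrite fg_reprK. Qed.

Fact fg_liftM : {morph fg_lift : g h / g * h}.
Proof.
move=> g h; rewrite -[g]fg_reprK -[h]fg_reprK.
by rewrite -[_ * _]/(fg_mul _ _) fg_mulE !fg_liftE word_eval_cat.
Qed.
HB.instance Definition _ :=
  monoid.isMultiplicative.Build (freegroup n) G fg_lift fg_liftM.

Lemma fg_lift_gen i : fg_lift (fg_gen i) = x i.
Proof. by rewrite fg_liftE /= mulg1. Qed.

End FreeGroupLift.

Section GroupHom.
Variables (n : nat) (G : groupType).
Implicit Types f g : {multiplicative freegroup n -> G}.

Lemma mult_eq (H : groupType) (f g : {multiplicative H -> G}) : f =1 g -> f = g.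
Proof.
case: f => f [[fM]]; case: g => g [[gM]] /= /funext fg.
by case: _ / fg gM => gM; rewrite (Prop_irrelevance fM gM).
Qed.

Lemma mult1 (H : groupType) (f : {multiplicative H -> G}) : f 1 = 1.
Proof. by apply: (@mulgI _ (f 1)); rewrite -gmulfM !mulg1. Qed.

Lemma multV (H : groupType) (f : {multiplicative H -> G}) x :
  f x^-1 = (f x)^-1.
Proof. by apply: (@mulgI _ (f x)); rewrite -gmulfM !mulgV mult1. Qed.

Lemma fg_hom_ext f g : (forall i, f (fg_gen i) = g (fg_gen i)) -> f = g.
Proof.
move=> fg; apply: mult_eq => x; rewrite -[x]fg_reprK.
elim: (repr x) => [|[i b] u IHu].
  by rewrite -[fg_class _]/(1 : freegroup n) !mult1.
rewrite (_ : fg_class _ = fg_class [:: (i, b)] * fg_class u); last first.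
  by rewrite -[RHS]/(fg_mul _ _) fg_mulE.
rewrite !gmulfM IHu; congr (_ * _); case: b => //=; last exact: fg.
rewrite (_ : fg_class _ = (fg_gen i)^-1) ?multV ?fg //.
by rewrite -[RHS]/(fg_inv _) fg_invE.
Qed.

End GroupHom.

Definition gr_hom (m n : nat) := {multiplicative freegroup m -> freegroup n}.
HB.instance Definition _ m n := gen_eqMixin (gr_hom m n).
HB.instance Definition _ m n := gen_choiceMixin (gr_hom m n).

(* The object [n] stands for the free group on [n] generators. *)
Definition gr : category nat.
refine (@Category nat (fun m n => gr_hom m n) (fun n => idfun : gr_hom n n)
  (fun m n p (g : gr_hom n p) (f : gr_hom m n) => (g \o f) : gr_hom m p) _ _ _).
- by move=> m n p q h g f; apply: mult_eq.
- by move=> m n f; apply: mult_eq.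
- by move=> m n f; apply: mult_eq.
Defined.

(* [lhom (kgrop k) m n] has basis the homomorphisms from [freegroup n] to
   [freegroup m]. *)
Definition kgrop (k : fieldType) : lincat k nat := linearization k (opposite gr).

Local Close Scope group_scope.

Local Open Scope group_scope.

Section Abelianization.
Variable G : groupType.

Inductive ab_eq : G -> G -> Prop :=
| ab_refl x : ab_eq x x
| ab_sym x y : ab_eq x y -> ab_eq y x
| ab_trans x y z : ab_eq x y -> ab_eq y z -> ab_eq x z
| ab_mul x x' y y' : ab_eq x x' -> ab_eq y y' -> ab_eq (x * y) (x' * y')
| ab_comm x y : ab_eq (x * y) (y * x).

Definition ab_eqb x y := `[< ab_eq x y >].
Fact ab_eqb_equiv : equiv_class_of ab_eqb.
Proof.
split=> [x|x y|y x z]; first by apply/asboolP/ab_refl.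
- by apply/asboolP/asboolP => /ab_sym.
- by move=> /asboolP xy /asboolP yz; apply/asboolP/(ab_trans xy yz).
Qed.
Canonical ab_equiv := EquivRelPack ab_eqb_equiv.
Canonical ab_encModRel := defaultEncModRel ab_eqb.

Definition abelianization := {eq_quot ab_eqb}.
HB.instance Definition _ := Choice.on abelianization.

Definition ab_class (x : G) : abelianization := \pi x.

Lemma ab_classP x y : ab_class x = ab_class y <-> ab_eq x y.
Proof. by split=> [/eqmodP/asboolP|xy] //; apply/eqmodP/asboolP. Qed.

Lemma ab_reprK (x : abelianization) : ab_class (repr x) = x.
Proof. exact: reprK. Qed.

Definition ab_zero := ab_class 1.
Definition ab_add (x y : abelianization) := ab_class (repr x * repr y).
Definition ab_opp (x : abelianization) := ab_class (repr x)^-1.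

Lemma ab_addE x y : ab_add (ab_class x) (ab_class y) = ab_class (x * y).
Proof. by apply/ab_classP/ab_mul; apply/ab_classP; rewrite ab_reprK. Qed.

Fact ab_addA : associative ab_add.
Proof.
move=> x y z; rewrite -[x]ab_reprK -[y]ab_reprK -[z]ab_reprK.
by rewrite !ab_addE mulgA.
Qed.
Fact ab_addC : commutative ab_add.
Proof. by move=> x y; apply/ab_classP/ab_comm. Qed.
Fact ab_add0 : left_id ab_zero ab_add.
Proof. by move=> x; rewrite -[x]ab_reprK ab_addE mul1g. Qed.
Fact ab_addN : left_inverse ab_zero ab_opp ab_add.
Proof. by move=> x; rewrite -{2}[x]ab_reprK ab_addE mulVg. Qed.

HB.instance Definition _ := GRing.isZmodule.Build abelianization
  ab_addA ab_addC ab_add0 ab_addN.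

End Abelianization.

Section AbelianizationMap.
Variables (G H : groupType) (f : {multiplicative G -> H}).

Definition ab_map (x : abelianization G) : abelianization H :=
  ab_class (f (repr x)).

Lemma ab_map_eq x y : ab_eq x y -> ab_eq (f x) (f y).
Proof.
elim=> {x y} [x|x y _|x y z _ xy _|x x' y y' _ xx' _ yy'|x y].
- exact: ab_refl.
- exact: ab_sym.
- exact: ab_trans.
- by rewrite !gmulfM; apply: ab_mul.
- by rewrite !gmulfM; apply: ab_comm.
Qed.

Lemma ab_mapE x : ab_map (ab_class x) = ab_class (f x).
Proof. by apply/ab_classP/ab_map_eq/ab_classP; rewrite ab_reprK. Qed.

Lemma ab_mapD : {morph ab_map : x y / (x + y)%R}.
Proof.
move=> x y; rewrite -[LHS]/(ab_map (ab_add x y)) -[RHS]/(ab_add _ _).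
by rewrite -[x]ab_reprK -[y]ab_reprK ab_addE !ab_mapE ab_addE gmulfM.
Qed.

End AbelianizationMap.

Local Close Scope group_scope.

Section Dual.
Variable k : fieldType.

Definition dual_subspace (A : zmodType) : subspace (A -> k^o).
refine (@Subspace k (A -> k^o) (fun u => {morph u : x y / x + y}) _ _).
- by move=> x y; rewrite /= addr0.
- move=> a u v uD vD x y; rewrite -![(_ *: _ + _) _]/(_ *: _ + _) uD vD.
  by rewrite scalerDr addrACA.
Defined.

(* [Hom (A, k)], with the pointwise [k]-linear structure. *)
Definition dual (A : zmodType) : lmodType k := subspace_type (dual_subspace A).

Variables (A B : zmodType) (f : A -> B) (fD : {morph f : x y / x + y}).

Definition precomp (u : B -> k^o) : A -> k^o := u \o f.
Fact precomp_linear : linear precomp. Proof. by []. Qed.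
HB.instance Definition _ := GRing.isLinear.Build k (B -> k^o) (A -> k^o) *:%R
  precomp precomp_linear.

Fact precomp_dual u : dual_subspace B u -> dual_subspace A (precomp u).
Proof. by move=> uD x y; rewrite /precomp /= fD uD. Qed.

Definition dual_map : {linear dual B -> dual A} :=
  subspace_map (dual_subspace B) (dual_subspace A) precomp precomp_dual.

End Dual.
Arguments dual_map k {A B f}.

Section SymmetricPower.
Variables (k : fieldType) (d : nat).

Section Objects.
Variable V : lmodType k.

Definition ffun_upd (v : {ffun 'I_d -> V}) (i : 'I_d) (x : V) :
    {ffun 'I_d -> V} := [ffun j => if j == i then x else v j].

(* The relations defining the symmetric power as a quotient of the space with
   basis [V^d]; the basis element [<< v >>] becomes the product of the [v i]. *)
Inductive sym_rel : {malg k[{ffun 'I_d -> V}]} -> Prop :=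
| sym_rel0 : sym_rel 0
| sym_rel_lin a s t : sym_rel s -> sym_rel t -> sym_rel (a *: s + t)
| sym_rel_multilinear v i a x y :
    sym_rel (<< ffun_upd v i (a *: x + y) >>
             - (a *: << ffun_upd v i x >> + << ffun_upd v i y >>))
| sym_rel_perm (v : {ffun 'I_d -> V}) (s : {perm 'I_d}) :
    sym_rel (<< [ffun i => v (s i)] : {ffun 'I_d -> V} >> - << v >>).

Definition sym_subspace := Subspace sym_rel0 sym_rel_lin.

Definition sym_power : lmodType k := quotient_space sym_subspace.

Definition sym_prod (v : {ffun 'I_d -> V}) : sym_power :=
  qspace_pi sym_subspace << v >>.

End Objects.

Section Maps.
Variables (V W : lmodType k) (f : {linear V -> W}).

Definition ffun_map (v : {ffun 'I_d -> V}) : {ffun 'I_d -> W} :=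
  [ffun i => f (v i)].

Definition sym_pre_map : {linear {malg k[{ffun 'I_d -> V}]} ->
    {malg k[{ffun 'I_d -> W}]}} := lin_ext (fun v => << ffun_map v >>).

Fact sym_pre_map_rel s : sym_subspace V s -> sym_subspace W (sym_pre_map s).
Proof.
elim=> {s} [|a s t _ fs _ ft|v i a x y|v s].
- by rewrite linear0; apply: sym_rel0.
- by rewrite linearP; apply: sym_rel_lin.
- rewrite !linearB linearP /= !lin_extU.
  have E z : ffun_map (ffun_upd v i z) = ffun_upd (ffun_map v) i (f z).
    by apply/ffunP => j; rewrite !ffunE; case: eqP.
  by rewrite !E linearP; apply: sym_rel_multilinear.
- rewrite linearB /= !lin_extU.
  have -> : ffun_map [ffun i => v (s i)] = [ffun i => ffun_map v (s i)].
    by apply/ffunP => j; rewrite !ffunE.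
  exact: sym_rel_perm.
Qed.

Definition sym_map : {linear sym_power V -> sym_power W} :=
  quotient_map (sym_subspace V) (sym_subspace W) sym_pre_map sym_pre_map_rel.

Lemma sym_mapE v : sym_map (sym_prod v) = sym_prod (ffun_map v).
Proof. by rewrite /sym_map /= quotient_mapE /= lin_extU. Qed.

End Maps.

Lemma sym_power_eq (V W : lmodType k) (f g : sym_power V -> W) :
  linear f -> linear g -> (forall v, f (sym_prod v) = g (sym_prod v)) ->
  f =1 g.
Proof.
move=> fL gL fg s; rewrite -[s]qspace_reprK; move: (repr s).
apply: linear_malg_eq => [a u v|a u v|]; last exact: fg.
- by rewrite linearP fL.
- by rewrite linearP gL.
Qed.

End SymmetricPower.

Section SymDualAb.
Variables (k : fieldType) (d : nat).

Definition adual (n : nat) : lmodType k := dual k (abelianization (freegroup n)).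

Definition adual_map m n (f : gr_hom m n) : {linear adual n -> adual m} :=
  dual_map k (ab_mapD f).

Definition adual_functor : vfunctor k (opposite gr).
refine (@VFunctor k nat (opposite gr) adual (fun m n f => adual_map f) _ _).
- move=> n v; apply: val_inj; apply/funext => x /=.
  by rewrite /precomp /= -[x]ab_reprK ab_mapE.
- move=> m n p g f v; apply: val_inj. apply: funext => x /=.
  by rewrite /precomp /= -[x]ab_reprK (ab_mapE g) !ab_mapE.
Defined.

Definition sym_comp (O : Type) (C : category O) (F : vfunctor k C) :
  vfunctor k C.
refine (@VFunctor k O C (fun x => sym_power d (vfun_ob F x))
  (fun x y f => sym_map d (vfun_hom F f)) _ _).
- move=> x; apply: sym_power_eq => [||v]; [exact: linearP|by []|].
  rewrite sym_mapE; congr sym_prod; apply/ffunP => i.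
  by rewrite ffunE vfun_id.
- move=> x y z g f; apply: sym_power_eq => [||v].
  + exact: linearP.
  + by move=> a u v; rewrite !linearP.
  rewrite !sym_mapE; congr sym_prod; apply/ffunP => i.
  by rewrite !ffunE vfun_comp.
Defined.

(* [S^d] composed with the dual of abelianization. *)
Definition sym_adual : cmodule (kgrop k) :=
  linear_extension (sym_comp adual_functor).

End SymDualAb.

Local Open Scope nat_scope.

Definition cast_hom (X : nat -> nat -> Type) m m' n n' (em : m = m')
    (en : n = n') (f : X m n) : X m' n' :=
  ecast i (X i n') em (ecast j (X m j) en f).

Definition lcast k (C : lincat k nat) m m' n n' (em : m = m') (en : n = n')
    (f : lhom C m n) : lhom C m' n' :=
  cast_hom (X := fun m n => lhom C m n) em en f.

(* A [k]-linear PROP, i.e. a strict symmetric monoidal [k]-linear category on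
   [nat] with [+] as tensor product of objects. Strict associativity and right
   unitality of [+] are propositional equalities in Rocq, hence the casts. *)
Record linprop (k : fieldType) := LinProp {
  prop_cat :> lincat k nat;
  ptens : forall m n m' n', lhom prop_cat m n -> lhom prop_cat m' n' ->
    lhom prop_cat (m + m') (n + n');
  psym : forall m n, lhom prop_cat (m + n) (n + m);
  ptens_linearl : forall m n m' n' (g : lhom prop_cat m' n'),
    linear (fun f : lhom prop_cat m n => ptens f g);
  ptens_linearr : forall m n m' n' (f : lhom prop_cat m n),
    linear (fun g : lhom prop_cat m' n' => ptens f g);
  ptens_id : forall m n,
    ptens (lid m : lhom prop_cat m m) (lid n : lhom prop_cat n n) =
    lid (m + n);
  ptens_comp : forall m n p m' n' p'
    (g : lhom prop_cat n p) (f : lhom prop_cat m n)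
    (g' : lhom prop_cat n' p') (f' : lhom prop_cat m' n'),
    ptens (lcomp g f) (lcomp g' f') = lcomp (ptens g g') (ptens f f');
  ptensA : forall m n m' n' m'' n'' (f : lhom prop_cat m n)
    (g : lhom prop_cat m' n') (h : lhom prop_cat m'' n''),
    lcast (addnA m m' m'') (addnA n n' n'') (ptens f (ptens g h)) =
    ptens (ptens f g) h;
  ptens1l : forall m n (f : lhom prop_cat m n), ptens (lid 0) f = f;
  ptens1r : forall m n (f : lhom prop_cat m n),
    lcast (addn0 m) (addn0 n) (ptens f (lid 0)) = f;
  psym_nat : forall m n m' n'
    (f : lhom prop_cat m n) (g : lhom prop_cat m' n'),
    lcomp (psym n n') (ptens f g) = lcomp (ptens g f) (psym m m');
  psymK : forall m n, lcomp (psym n m) (psym m n) = lid (m + n);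
  psym0 : forall m, lcast (addn0 m) (erefl m) (psym m 0) = lid m;
  psym_hexagon : forall m n p,
    lcast (addnA m n p) (erefl (n + p + m)) (psym m (n + p)) =
    lcomp (lcast (addnA n m p) (addnA n p m) (ptens (lid n) (psym m p)))
      (ptens (psym m n) (lid p))
}.

Declare Scope linprop_scope.
Notation "g ∘ f" := (lcomp g f)
  (at level 50, left associativity) : linprop_scope.
Notation "f ⊗ g" := (ptens f g)
  (at level 40, left associativity) : linprop_scope.
Local Open Scope linprop_scope.

Record casimir_hopf (k : fieldType) (P : linprop k) := CasimirHopf {
  mu : lhom P 2 1;
  eta : lhom P 0 1;
  Delta : lhom P 1 2;
  epsilon : lhom P 1 0;
  antipode : lhom P 1 1;
  casimir : lhom P 0 2;
  mu_assoc : mu ∘ (mu ⊗ lid 1) = mu ∘ (lid 1 ⊗ mu);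
  mu_unitl : mu ∘ (eta ⊗ lid 1) = lid 1;
  mu_unitr : mu ∘ (lid 1 ⊗ eta) = lid 1;
  Delta_coassoc : (Delta ⊗ lid 1) ∘ Delta = (lid 1 ⊗ Delta) ∘ Delta;
  Delta_counitl : (epsilon ⊗ lid 1) ∘ Delta = lid 1;
  Delta_counitr : (lid 1 ⊗ epsilon) ∘ Delta = lid 1;
  Delta_mu : Delta ∘ mu =
    (mu ⊗ mu) ∘ (lid 1 ⊗ psym P 1 1 ⊗ lid 1) ∘ (Delta ⊗ Delta);
  Delta_eta : Delta ∘ eta = eta ⊗ eta;
  epsilon_mu : epsilon ∘ mu = epsilon ⊗ epsilon;
  epsilon_eta : epsilon ∘ eta = lid 0;
  antipode_l : mu ∘ (antipode ⊗ lid 1) ∘ Delta = eta ∘ epsilon;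
  antipode_r : mu ∘ (lid 1 ⊗ antipode) ∘ Delta = eta ∘ epsilon;
  Delta_cocomm : psym P 1 1 ∘ Delta = Delta;
  casimir_Delta : (Delta ⊗ lid 1) ∘ casimir =
    ((lid 1 ⊗ eta ⊗ lid 1) ∘ casimir + (eta ⊗ casimir))%R;
  casimir_sym : psym P 1 1 ∘ casimir = casimir;
  casimir_ad :
    let ad := mu ∘ (mu ⊗ lid 1) ∘ (lid 2 ⊗ antipode) ∘
      (lid 1 ⊗ psym P 1 1) ∘ (Delta ⊗ lid 1) in
    (ad ⊗ ad) ∘ (lid 1 ⊗ psym P 1 1 ⊗ lid 1) ∘ (Delta ⊗ casimir) =
    casimir ∘ epsilon
}.

Section FreeProp.
Variable k : fieldType.

Inductive jterm : nat -> nat -> Type :=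
| t_id n : jterm n n
| t_comp m n p : jterm n p -> jterm m n -> jterm m p
| t_tens m n m' n' : jterm m n -> jterm m' n' -> jterm (m + m') (n + n')
| t_sym m n : jterm (m + n) (n + m)
| t_zero m n : jterm m n
| t_lin m n : k -> jterm m n -> jterm m n -> jterm m n
| t_mu : jterm 2 1
| t_eta : jterm 0 1
| t_Delta : jterm 1 2
| t_epsilon : jterm 1 0
| t_antipode : jterm 1 1
| t_casimir : jterm 0 2.

HB.instance Definition _ m n := gen_eqMixin (jterm m n).
HB.instance Definition _ m n := gen_choiceMixin (jterm m n).

Fixpoint jeval (P : linprop k) (H : casimir_hopf P) m n (t : jterm m n) :
    lhom P m n :=
  match t in jterm m n return lhom P m n with
  | t_id n => lid n
  | t_comp m n p t u => jeval H t ∘ jeval H u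
  | t_tens m n m' n' t u => jeval H t ⊗ jeval H u
  | t_sym m n => psym P m n
  | t_zero m n => 0%R
  | t_lin m n a t u => (a *: jeval H t + jeval H u)%R
  | t_mu => mu H
  | t_eta => eta H
  | t_Delta => Delta H
  | t_epsilon => epsilon H
  | t_antipode => antipode H
  | t_casimir => casimir H
  end.

(* Two expressions denote the same morphism of the freely generated PROP when
   they agree in every [k]-linear PROP equipped with a Casimir Hopf algebra.
   [jacobi_casimir] and [jacobi_rec] below give the universal property. *)
Definition jeq m n (t u : jterm m n) : Prop :=
  forall (P : linprop k) (H : casimir_hopf P), jeval H t = jeval H u.

Section Hom.
Variables m n : nat.

Definition jeqb (t u : jterm m n) := `[< jeq t u >].
Fact jeqb_equiv : equiv_class_of jeqb.
Proof.
split=> [t|t u|u t v]; first exact/asboolP.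
- by apply/asboolP/asboolP => tu P H; rewrite tu.
- by move=> /asboolP tu /asboolP uv; apply/asboolP => P H; rewrite tu uv.
Qed.
Canonical jeq_equiv := EquivRelPack jeqb_equiv.
Canonical jeq_encModRel := defaultEncModRel jeqb.

Definition jhom := {eq_quot jeqb}.
HB.instance Definition _ := Choice.on jhom.

Definition jclass (t : jterm m n) : jhom := \pi t.

Lemma jclassP t u : jclass t = jclass u <-> jeq t u.
Proof. by split=> [/eqmodP/asboolP|tu] //; apply/eqmodP/asboolP. Qed.

Lemma jreprK (f : jhom) : jclass (repr f) = f. Proof. exact: reprK. Qed.

Lemma jeval_repr (P : linprop k) (H : casimir_hopf P) t :
  jeval H (repr (jclass t)) = jeval H t.
Proof. by move: P H; apply/jclassP; rewrite jreprK. Qed.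

Definition jhom_zero : jhom := jclass (t_zero m n).
Definition jhom_add (f g : jhom) := jclass (t_lin 1%R (repr f) (repr g)).
Definition jhom_scale a (f : jhom) := jclass (t_lin a (repr f) (t_zero m n)).
Definition jhom_opp (f : jhom) := jhom_scale (-1)%R f.

Fact jhom_addA : associative jhom_add.
Proof.
move=> f g h; apply/jclassP => P H.
by rewrite /= !jeval_repr /= !scale1r addrA.
Qed.
Fact jhom_addC : commutative jhom_add.
Proof. by move=> f g; apply/jclassP => P H; rewrite /= !scale1r addrC. Qed.
Fact jhom_add0 : left_id jhom_zero jhom_add.
Proof.
move=> f; rewrite -[RHS]jreprK; apply/jclassP => P H.
by rewrite /= !jeval_repr /= scaler0 add0r.
Qed.
Fact jhom_addN : left_inverse jhom_zero jhom_opp jhom_add.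
Proof.
move=> f; apply/jclassP => P H.
by rewrite /= !jeval_repr /= addr0 scale1r scaleN1r addNr.
Qed.
HB.instance Definition _ := GRing.isZmodule.Build jhom
  jhom_addA jhom_addC jhom_add0 jhom_addN.

Lemma jclassD f g : (f + g)%R = jhom_add f g. Proof. by []. Qed.

Fact jhom_scaleA a b f : jhom_scale a (jhom_scale b f) = jhom_scale (a * b)%R f.
Proof.
by apply/jclassP => P H; rewrite /= !jeval_repr /= !addr0 scalerA.
Qed.
Fact jhom_scale1 : left_id 1%R jhom_scale.
Proof.
move=> f; rewrite -[RHS]jreprK; apply/jclassP => P H.
by rewrite /= scale1r addr0.
Qed.
Fact jhom_scaleDr : right_distributive jhom_scale +%R.
Proof.
move=> a f g; rewrite !jclassD; apply/jclassP => P H.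
by rewrite /= !jeval_repr /= !addr0 !scale1r scalerDr.
Qed.
Fact jhom_scaleDl f : {morph jhom_scale^~ f : a b / (a + b)%R}.
Proof.
move=> a b; rewrite jclassD; apply/jclassP => P H.
by rewrite /= !jeval_repr /= !addr0 !scale1r scalerDl.
Qed.
HB.instance Definition _ := GRing.Zmodule_isLmodule.Build k jhom
  jhom_scaleA jhom_scale1 jhom_scaleDr jhom_scaleDl.

Lemma jhom_lin a (f g : jhom) : (a *: f + g)%R = jclass (t_lin a (repr f) (repr g)).
Proof.
by apply/jclassP => P H; rewrite /= jeval_repr /= addr0 scale1r.
Qed.

Section Eval.
Variables (P : linprop k) (H : casimir_hopf P).

Definition jhom_eval (f : jhom) : lhom P m n := jeval H (repr f).

Lemma jhom_evalE t : jhom_eval (jclass t) = jeval H t.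
Proof. exact: jeval_repr. Qed.

Lemma jhom_eval_linear : linear jhom_eval.
Proof. by move=> a f g; rewrite jhom_lin jhom_evalE. Qed.

End Eval.

Lemma jhomP (f g : jhom) :
  (forall (P : linprop k) (H : casimir_hopf P), jhom_eval H f = jhom_eval H g)
  -> f = g.
Proof. by move=> fg; rewrite -[f]jreprK -[g]jreprK; apply/jclassP. Qed.

End Hom.

Definition jcomp m n p (g : jhom n p) (f : jhom m n) : jhom m p :=
  jclass (t_comp (repr g) (repr f)).
Definition jtens m n m' n' (f : jhom m n) (g : jhom m' n') :
  jhom (m + m') (n + n') := jclass (t_tens (repr f) (repr g)).

Section EvalLemmas.
Variables (P : linprop k) (H : casimir_hopf P).

Lemma jhom_eval_id n : jhom_eval H (jclass (t_id n)) = lid n.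
Proof. exact: jhom_evalE. Qed.
Lemma jhom_eval_comp m n p (g : jhom n p) (f : jhom m n) :
  jhom_eval H (jcomp g f) = jhom_eval H g ∘ jhom_eval H f.
Proof. exact: jhom_evalE. Qed.
Lemma jhom_eval_tens m n m' n' (f : jhom m n) (g : jhom m' n') :
  jhom_eval H (jtens f g) = jhom_eval H f ⊗ jhom_eval H g.
Proof. exact: jhom_evalE. Qed.
Lemma jhom_eval_sym m n : jhom_eval H (jclass (t_sym m n)) = psym P m n.
Proof. exact: jhom_evalE. Qed.

End EvalLemmas.

Definition jacobi_cat : lincat k nat.
refine (@LinCat k nat (fun m n => jhom m n) (fun n => jclass (t_id n)) jcomp
  _ _ _ _ _).
- move=> m n p f a g g'; apply: jhomP => P H.
  by rewrite jhom_eval_comp !jhom_eval_linear !jhom_eval_comp lcomp_linearl.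
- move=> m n p f a g g'; apply: jhomP => P H.
  by rewrite jhom_eval_comp !jhom_eval_linear !jhom_eval_comp lcomp_linearr.
- move=> m n p q h g f; apply: jhomP => P H.
  by rewrite !jhom_eval_comp lcompA.
- move=> m n f; apply: jhomP => P H.
  by rewrite jhom_eval_comp jhom_eval_id lcomp1l.
- move=> m n f; apply: jhomP => P H.
  by rewrite jhom_eval_comp jhom_eval_id lcomp1r.
Defined.

Lemma jhom_eval_cast (P : linprop k) (H : casimir_hopf P) m m' n n'
    (em : m = m') (en : n = n') (f : jhom m n) :
  jhom_eval H (lcast (C := jacobi_cat) em en f) = lcast em en (jhom_eval H f).
Proof. by case: _ / em; case: _ / en. Qed.

Definition jacobi_prop : linprop k.
refine (@LinProp k jacobi_cat jtens (fun m n => jclass (t_sym m n)) _ _ _ _ _ _ _ _ _ _ _).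
- move=> m n m' n' g a f f'; apply: jhomP => P H.
  by rewrite jhom_eval_tens !jhom_eval_linear !jhom_eval_tens ptens_linearl.
- move=> m n m' n' g a f f'; apply: jhomP => P H.
  by rewrite jhom_eval_tens !jhom_eval_linear !jhom_eval_tens ptens_linearr.
- move=> m n; apply: jhomP => P H.
  by rewrite jhom_eval_tens !jhom_eval_id ptens_id.
- move=> m n p m' n' p' g f g' f'; apply: jhomP => P H.
  by rewrite jhom_eval_tens !jhom_eval_comp !jhom_eval_tens ptens_comp.
- move=> m n m' n' m'' n'' f g h; apply: jhomP => P H.
  by rewrite jhom_eval_cast !jhom_eval_tens ptensA.
- move=> m n f; apply: jhomP => P H.
  by rewrite (jhom_eval_tens H (jclass (t_id 0)) f) jhom_eval_id ptens1l.
- move=> m n f; apply: jhomP => P H.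
  by rewrite jhom_eval_cast jhom_eval_tens jhom_eval_id ptens1r.
- move=> m n m' n' f g; apply: jhomP => P H.
  by rewrite !jhom_eval_comp !jhom_eval_tens !jhom_eval_sym psym_nat.
- move=> m n; apply: jhomP => P H.
  by rewrite jhom_eval_comp !jhom_eval_sym jhom_eval_id psymK.
- move=> m; apply: jhomP => P H.
  by rewrite jhom_eval_cast jhom_eval_sym jhom_eval_id psym0.
- move=> m n p; apply: jhomP => P H.
  rewrite jhom_eval_cast jhom_eval_sym psym_hexagon jhom_eval_comp.
  by rewrite jhom_eval_cast !jhom_eval_tens !jhom_eval_sym !jhom_eval_id.
Defined.

Section EvalJacobi.
Variables (P : linprop k) (H : casimir_hopf P).

Lemma jacobi_eval_id n : jhom_eval H (lid n : lhom jacobi_prop n n) = lid n.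
Proof. exact: jhom_eval_id. Qed.
Lemma jacobi_eval_comp m n p (g : lhom jacobi_prop n p) (f : lhom jacobi_prop m n) :
  jhom_eval H (g ∘ f) = jhom_eval H g ∘ jhom_eval H f.
Proof. exact: jhom_eval_comp. Qed.
Lemma jacobi_eval_tens m n m' n' (f : lhom jacobi_prop m n) (g : lhom jacobi_prop m' n') :
  jhom_eval H (f ⊗ g) = jhom_eval H f ⊗ jhom_eval H g.
Proof. exact: jhom_eval_tens. Qed.
Lemma jacobi_eval_sym m n : jhom_eval H (psym jacobi_prop m n) = psym P m n.
Proof. exact: jhom_eval_sym. Qed.
Lemma jacobi_eval_add m n (f g : lhom jacobi_prop m n) :
  jhom_eval H (f + g)%R = (jhom_eval H f + jhom_eval H g)%R.
Proof. by rewrite -[f]scale1r [LHS]jhom_eval_linear !scale1r. Qed.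

End EvalJacobi.

Local Ltac jeval_all := repeat match goal with
  | |- context [jhom_eval _ (lcomp ?g ?f)] => rewrite (jacobi_eval_comp _ g f)
  | |- context [jhom_eval _ (ptens ?f ?g)] => rewrite (jacobi_eval_tens _ f g)
  | |- context [jhom_eval _ (lid ?n)] => rewrite (jacobi_eval_id _ n)
  | |- context [jhom_eval _ (psym _ ?m ?n)] => rewrite (jacobi_eval_sym _ m n)
  | |- context [jhom_eval _ (?f + ?g)%R] => rewrite (jacobi_eval_add _ f g)
  | |- context [jhom_eval _ (jclass ?t)] => rewrite (jhom_evalE _ t)
  end.

Definition jacobi_casimir : casimir_hopf jacobi_prop.
refine (@CasimirHopf k jacobi_prop (jclass t_mu) (jclass t_eta) (jclass t_Delta)
  (jclass t_epsilon) (jclass t_antipode) (jclass t_casimir)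
  _ _ _ _ _ _ _ _ _ _ _ _ _ _ _ _); apply: jhomP => P H; cbv zeta; jeval_all.
- exact: mu_assoc.
- exact: mu_unitl.
- exact: mu_unitr.
- exact: Delta_coassoc.
- exact: Delta_counitl.
- exact: Delta_counitr.
- exact: Delta_mu.
- exact: Delta_eta.
- exact: epsilon_mu.
- exact: epsilon_eta.
- exact: antipode_l.
- exact: antipode_r.
- exact: Delta_cocomm.
- exact: casimir_Delta.
- exact: casimir_sym.
- exact: casimir_ad.
Defined.

Definition jacobi_rec (P : linprop k) (H : casimir_hopf P) : linfunctor jacobi_prop P.
refine (@LinFunctor k nat nat jacobi_prop P id (fun m n => @jhom_eval m n P H) _ _ _).
- by move=> m n; apply: jhom_eval_linear.
- by move=> n; apply: jhom_eval_id.
- by move=> m n p g f; apply: jhom_eval_comp.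
Defined.

End FreeProp.

Definition fg_map m n (phi : 'I_m -> 'I_n) : gr_hom m n :=
  fg_lift (fun i => fg_gen (phi i)).

Definition gr_tens m n m' n' (f : gr_hom m n) (g : gr_hom m' n') :
    gr_hom (m + m') (n + n') :=
  fg_lift (fun i => match fintype.split i with
    | inl j => fg_map (@lshift n n') (f (fg_gen j))
    | inr j => fg_map (@rshift n n') (g (fg_gen j))
    end).

Definition gr_swap m n : gr_hom (m + n) (n + m) :=
  fg_map (fun i => match fintype.split i with
    | inl j => rshift n j
    | inr j => lshift m j
    end).

Section GrLemmas.

Lemma fg_map_gen m n (phi : 'I_m -> 'I_n) i :
  fg_map phi (fg_gen i) = fg_gen (phi i).
Proof. exact: fg_lift_gen. Qed.

Lemma hom_ext n (G : groupType) (f g : {multiplicative freegroup n -> G}) :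
  (forall i, f (fg_gen i) = g (fg_gen i)) -> f =1 g.
Proof. by move=> fg x; rewrite (fg_hom_ext fg). Qed.

Lemma fg_map_comp m n p (phi : 'I_n -> 'I_p) (psi : 'I_m -> 'I_n) x :
  fg_map phi (fg_map psi x) = fg_map (phi \o psi) x.
Proof.
by apply: (hom_ext (f := fg_map phi \o fg_map psi)) => i /=;
  rewrite !fg_map_gen.
Qed.

Lemma fg_map_eq m n (phi psi : 'I_m -> 'I_n) : phi =1 psi ->
  fg_map phi =1 fg_map psi.
Proof. by move=> e; apply: hom_ext => i; rewrite !fg_map_gen e. Qed.

Lemma fg_map_id m (phi : 'I_m -> 'I_m) : phi =1 id -> fg_map phi =1 id.
Proof. by move=> e; apply: (hom_ext (g := idfun)) => i; rewrite fg_map_gen e. Qed.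

Variables (m n m' n' : nat) (f : gr_hom m n) (g : gr_hom m' n').

Lemma gr_tens_lgen i :
  gr_tens f g (fg_gen (lshift m' i)) = fg_map (@lshift n n') (f (fg_gen i)).
Proof.
rewrite [LHS]fg_lift_gen; case: split_ordP => j /eqP.
  by rewrite eq_lshift => /eqP ->.
by rewrite eq_lrshift.
Qed.

Lemma gr_tens_rgen i :
  gr_tens f g (fg_gen (rshift m i)) = fg_map (@rshift n n') (g (fg_gen i)).
Proof.
rewrite [LHS]fg_lift_gen; case: split_ordP => j /eqP.
  by rewrite eq_rlshift.
by rewrite eq_rshift => /eqP ->.
Qed.

Lemma gr_tens_l x :
  gr_tens f g (fg_map (@lshift m m') x) = fg_map (@lshift n n') (f x).
Proof.
apply: (hom_ext (f := gr_tens f g \o fg_map _) (g := fg_map _ \o f)) => i /=.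
by rewrite fg_map_gen gr_tens_lgen.
Qed.

Lemma gr_tens_r x :
  gr_tens f g (fg_map (@rshift m m') x) = fg_map (@rshift n n') (g x).
Proof.
apply: (hom_ext (f := gr_tens f g \o fg_map _) (g := fg_map _ \o g)) => i /=.
by rewrite fg_map_gen gr_tens_rgen.
Qed.

Lemma gr_swap_lgen i : gr_swap m n (fg_gen (lshift n i)) = fg_gen (rshift n i).
Proof.
rewrite fg_map_gen; congr fg_gen; case: split_ordP => j /eqP.
  by rewrite eq_lshift => /eqP ->.
by rewrite eq_lrshift.
Qed.

Lemma gr_swap_rgen i : gr_swap m n (fg_gen (rshift m i)) = fg_gen (lshift m i).
Proof.
rewrite fg_map_gen; congr fg_gen; case: split_ordP => j /eqP.
  by rewrite eq_rlshift.
by rewrite eq_rshift => /eqP ->.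
Qed.

Lemma gr_swap_l x :
  gr_swap m n (fg_map (@lshift m n) x) = fg_map (@rshift n m) x.
Proof.
apply: (hom_ext (f := gr_swap m n \o fg_map _)) => i /=.
by rewrite (fg_map_gen (@lshift m n)) gr_swap_lgen fg_map_gen.
Qed.

Lemma gr_swap_r x :
  gr_swap m n (fg_map (@rshift m n) x) = fg_map (@lshift n m) x.
Proof.
apply: (hom_ext (f := gr_swap m n \o fg_map _)) => i /=.
by rewrite (fg_map_gen (@rshift m n)) gr_swap_rgen fg_map_gen.
Qed.

Lemma gr_ext_add p (u v : gr_hom (m + n) p) :
  (forall i, u (fg_gen (lshift n i)) = v (fg_gen (lshift n i))) ->
  (forall i, u (fg_gen (rshift m i)) = v (fg_gen (rshift m i))) -> u = v.
Proof.
by move=> ul ur; apply: fg_hom_ext => i; case: (split_ordP i) => j ->.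
Qed.

End GrLemmas.

Local Opaque gr_swap gr_tens.

Section KGrop.
Variable k : fieldType.

Lemma lcast_kgrop m m' n n' (em : m = m') (en : n = n') (f : gr_hom n m) :
  lcast (C := kgrop k) em en << f >> =
  << (fg_map (cast_ord em) \o f \o fg_map (cast_ord (esym en)) :
        gr_hom n' m') >>.
Proof.
case: _ / em; case: _ / en; rewrite /lcast /cast_hom /=.
congr << _ >>; apply: mult_eq => x /=.
by rewrite !fg_map_id // => i; apply: val_inj.
Qed.

Lemma lcast_linear m m' n n' (em : m = m') (en : n = n') :
  linear (lcast (C := kgrop k) em en).
Proof. by case: _ / em; case: _ / en. Qed.

Definition kgrop_tens m n m' n' :
  lhom (kgrop k) m n -> lhom (kgrop k) m' n' -> lhom (kgrop k) (m + m') (n + n')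
  := bilin_ext (fun (f : gr_hom n m) (g : gr_hom n' m') => << gr_tens f g >>).

Lemma kgrop_compU m n p (g : gr_hom p n) (f : gr_hom n m) :
  (<< g >> : lhom (kgrop k) n p) ∘ (<< f >> : lhom (kgrop k) m n) =
  << (f \o g : gr_hom p m) >>.
Proof. exact: bilin_extU. Qed.

Lemma kgrop_tensU m n m' n' (f : gr_hom n m) (g : gr_hom n' m') :
  kgrop_tens << f >> << g >> = << gr_tens f g >>.
Proof. exact: bilin_extU. Qed.

Lemma kgrop_compl m n p (f : lhom (kgrop k) m n) :
  linear (fun g : lhom (kgrop k) n p => g ∘ f).
Proof. exact: lcomp_linearl. Qed.
Lemma kgrop_compr m n p (g : lhom (kgrop k) n p) :
  linear (fun f : lhom (kgrop k) m n => g ∘ f).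
Proof. exact: lcomp_linearr. Qed.
Lemma kgrop_tensl m n m' n' (g : lhom (kgrop k) m' n') :
  linear (fun f : lhom (kgrop k) m n => kgrop_tens f g).
Proof. exact: bilin_ext_linearl. Qed.
Lemma kgrop_tensr m n m' n' (f : lhom (kgrop k) m n) :
  linear (fun g : lhom (kgrop k) m' n' => kgrop_tens f g).
Proof. exact: bilin_ext_linearr. Qed.

Lemma linear_comp_fun (U V W : lmodType k) (g : V -> W) (f : U -> V) :
  linear g -> linear f -> linear (fun x => g (f x)).
Proof. by move=> gl fl a u v; rewrite fl gl. Qed.

Fact kgrop_tens_comp m n p m' n' p' (g : lhom (kgrop k) n p)
    (f : lhom (kgrop k) m n) (g' : lhom (kgrop k) n' p')
    (f' : lhom (kgrop k) m' n') :
  kgrop_tens (g ∘ f) (g' ∘ f') = kgrop_tens g g' ∘ kgrop_tens f f'.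
Proof.
move: g; apply: linear_malg_eq => [||g].
- exact: (linear_comp_fun (kgrop_tensl _) (kgrop_compl _)).
- exact: (linear_comp_fun (kgrop_compl _) (kgrop_tensl _)).
move: f; apply: linear_malg_eq => [||f].
- exact: (linear_comp_fun (kgrop_tensl _) (kgrop_compr _)).
- exact: (linear_comp_fun (kgrop_compr _) (kgrop_tensl _)).
move: g'; apply: linear_malg_eq => [||g'].
- exact: (linear_comp_fun (kgrop_tensr _) (kgrop_compl _)).
- exact: (linear_comp_fun (kgrop_compl _) (kgrop_tensr _)).
move: f'; apply: linear_malg_eq => [||f'].
- exact: (linear_comp_fun (kgrop_tensr _) (kgrop_compr _)).
- exact: (linear_comp_fun (kgrop_compr _) (kgrop_tensr _)).
rewrite !kgrop_compU !kgrop_tensU kgrop_compU; congr << _ >>.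
apply: gr_ext_add => i /=.
  by rewrite !gr_tens_lgen gr_tens_l.
by rewrite !gr_tens_rgen gr_tens_r.
Qed.

Fact kgrop_tensA m n m' n' m'' n'' (f : lhom (kgrop k) m n)
    (g : lhom (kgrop k) m' n') (h : lhom (kgrop k) m'' n'') :
  lcast (addnA m m' m'') (addnA n n' n'') (kgrop_tens f (kgrop_tens g h)) =
  kgrop_tens (kgrop_tens f g) h.
Proof.
move: f; apply: linear_malg_eq => [||f].
- exact: (linear_comp_fun (lcast_linear _ _) (kgrop_tensl _)).
- exact: (linear_comp_fun (kgrop_tensl _) (kgrop_tensl _)).
move: g; apply: linear_malg_eq => [||g].
- exact: (linear_comp_fun (lcast_linear _ _)
    (linear_comp_fun (kgrop_tensr _) (kgrop_tensl _))).
- exact: (linear_comp_fun (kgrop_tensl _) (kgrop_tensr _)).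
move: h; apply: linear_malg_eq => [||h].
- exact: (linear_comp_fun (lcast_linear _ _)
    (linear_comp_fun (kgrop_tensr _) (kgrop_tensr _))).
- exact: kgrop_tensr.
rewrite !kgrop_tensU lcast_kgrop; congr << _ >>.
have e1 i : cast_ord (esym (addnA n n' n'')) (lshift n'' (lshift n' i)) =
    lshift (n' + n'') i by apply: val_inj.
have e2 i : cast_ord (esym (addnA n n' n'')) (lshift n'' (rshift n i)) =
    rshift n (lshift n'' i) by apply: val_inj.
have e3 i : cast_ord (esym (addnA n n' n'')) (rshift (n + n') i) =
    rshift n (rshift n' i) by apply: val_inj; rewrite /= addnA.
apply: gr_ext_add => i /=.
  case: (split_ordP i) => j -> /=; rewrite fg_map_gen ?e1 ?e2.
    rewrite !gr_tens_lgen !fg_map_comp.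
    by apply: fg_map_eq => x; apply: val_inj.
  rewrite !(gr_tens_lgen, gr_tens_rgen) !fg_map_comp.
  by apply: fg_map_eq => x; apply: val_inj.
rewrite fg_map_gen e3 !gr_tens_rgen !fg_map_comp.
by apply: fg_map_eq => x; apply: val_inj; rewrite /= addnA.
Qed.

Fact kgrop_tens1l m n (f : lhom (kgrop k) m n) :
  kgrop_tens (lid 0 : lhom (kgrop k) 0 0) f = f.
Proof.
move: f; apply: linear_malg_eq => [||f] //; first exact: kgrop_tensr.
rewrite kgrop_tensU; congr << _ >>; apply: (@gr_ext_add 0 n m) => -[i li] //.
rewrite gr_tens_rgen fg_map_id; last by move=> x; apply: val_inj.
by congr (f (fg_gen _)); apply: val_inj.
Qed.

Fact kgrop_tens1r m n (f : lhom (kgrop k) m n) :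
  lcast (addn0 m) (addn0 n) (kgrop_tens f (lid 0 : lhom (kgrop k) 0 0)) = f.
Proof.
move: f; apply: linear_malg_eq => [||f] //.
  exact: (linear_comp_fun (lcast_linear _ _) (kgrop_tensl _)).
rewrite kgrop_tensU lcast_kgrop; congr << _ >>; apply: fg_hom_ext => i /=.
rewrite fg_map_gen (_ : cast_ord _ i = lshift 0 i); last exact: val_inj.
by rewrite gr_tens_lgen fg_map_comp fg_map_id // => x; apply: val_inj.
Qed.

Definition kgrop_sym m n : lhom (kgrop k) (m + n) (n + m) := << gr_swap n m >>.

Fact kgrop_sym_nat m n m' n'
    (f : lhom (kgrop k) m n) (g : lhom (kgrop k) m' n') :
  kgrop_sym n n' ∘ kgrop_tens f g = kgrop_tens g f ∘ kgrop_sym m m'.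
Proof.
move: f; apply: linear_malg_eq => [||f].
- exact: (linear_comp_fun (kgrop_compr _) (kgrop_tensl _)).
- exact: (linear_comp_fun (kgrop_compl _) (kgrop_tensr _)).
move: g; apply: linear_malg_eq => [||g].
- exact: (linear_comp_fun (kgrop_compr _) (kgrop_tensr _)).
- exact: (linear_comp_fun (kgrop_compl _) (kgrop_tensl _)).
rewrite !kgrop_tensU !kgrop_compU; congr << _ >>; apply: gr_ext_add => i /=.
  by rewrite gr_swap_lgen gr_tens_lgen gr_tens_rgen gr_swap_l.
by rewrite gr_swap_rgen gr_tens_lgen gr_tens_rgen gr_swap_r.
Qed.

Fact kgrop_symK m n : kgrop_sym n m ∘ kgrop_sym m n = lid (m + n).
Proof.
rewrite kgrop_compU; congr << _ >>; apply: gr_ext_add => i /=.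
  by rewrite gr_swap_lgen gr_swap_rgen.
by rewrite gr_swap_rgen gr_swap_lgen.
Qed.

Fact kgrop_sym0 m : lcast (addn0 m) (erefl m) (kgrop_sym m 0) = lid m.
Proof.
rewrite lcast_kgrop; congr << _ >>; apply: fg_hom_ext => i /=.
rewrite fg_map_gen (_ : cast_ord _ i = rshift 0 i); last exact: val_inj.
by rewrite gr_swap_rgen fg_map_gen; congr fg_gen; apply: val_inj.
Qed.

Fact kgrop_hexagon m n p :
  lcast (addnA m n p) (erefl (n + p + m)) (kgrop_sym m (n + p)) =
  lcast (addnA n m p) (addnA n p m)
    (kgrop_tens (lid n : lhom (kgrop k) n n) (kgrop_sym m p)) ∘
  kgrop_tens (kgrop_sym m n) (lid p : lhom (kgrop k) p p).
Proof.
rewrite !kgrop_tensU !lcast_kgrop kgrop_compU; congr << _ >>.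
have e1 i : cast_ord (esym (addnA n p m)) (lshift m (lshift p i)) =
    lshift (p + m) i by apply: val_inj.
have e2 i : cast_ord (esym (addnA n p m)) (lshift m (rshift n i)) =
    rshift n (lshift m i) by apply: val_inj.
have e3 i : cast_ord (esym (addnA n p m)) (rshift (n + p) i) =
    rshift n (rshift p i) by apply: val_inj; rewrite /= addnA.
have e0 q (e : q = q) (i : 'I_q) : cast_ord e i = i by apply: val_inj.
apply: gr_ext_add => i /=; rewrite (@fg_map_gen _ _ (cast_ord (esym (addnA n p m))));
  rewrite (@fg_map_gen _ _ (cast_ord (esym (erefl (n + p + m))))) e0.
  rewrite gr_swap_lgen (@fg_map_gen _ _ (cast_ord _)); case: (split_ordP i) => j -> /=.
    rewrite e1 gr_tens_lgen !fg_map_gen /=.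
    rewrite (_ : cast_ord _ _ = lshift p (lshift m j)); last exact: val_inj.
    rewrite gr_tens_lgen gr_swap_lgen fg_map_gen.
    by congr fg_gen; apply: val_inj.
  rewrite e2 gr_tens_rgen gr_swap_lgen !fg_map_gen.
  rewrite (_ : cast_ord _ _ = rshift (n + m) j); last first.
    by apply: val_inj; rewrite /= addnA.
  rewrite gr_tens_rgen fg_map_gen.
  by congr fg_gen; apply: val_inj; rewrite /= addnA.
rewrite gr_swap_rgen fg_map_gen e3 gr_tens_rgen gr_swap_rgen !fg_map_gen.
rewrite (_ : cast_ord (addnA n m p) _ = lshift p (rshift n i)); last exact: val_inj.
rewrite gr_tens_lgen gr_swap_rgen fg_map_gen.
by congr fg_gen; apply: val_inj.
Qed.

Definition kgrop_prop : linprop k.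
refine (@LinProp k (kgrop k) kgrop_tens kgrop_sym kgrop_tensl kgrop_tensr
  _ kgrop_tens_comp kgrop_tensA kgrop_tens1l kgrop_tens1r kgrop_sym_nat
  kgrop_symK kgrop_sym0 kgrop_hexagon).
move=> m n; rewrite [LHS]kgrop_tensU; congr << _ >>.
apply: gr_ext_add => i; first by rewrite gr_tens_lgen fg_map_gen.
by rewrite gr_tens_rgen fg_map_gen.
Defined.

End KGrop.

Section GenN.

Definition genn n i : freegroup n :=
  if insub i is Some j then fg_gen j else 1%g.

Lemma gennE n (i : 'I_n) : fg_gen i = genn n i.
Proof. by rewrite /genn valK. Qed.

Lemma genn_lt n i (lt_in : i < n) : genn n i = fg_gen (Ordinal lt_in).
Proof. by rewrite gennE. Qed.

Lemma hom_ext_genn n (G : groupType) (f g : {multiplicative freegroup n -> G}) :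
  (forall i, i < n -> f (genn n i) = g (genn n i)) -> f = g.
Proof. by move=> fg; apply: fg_hom_ext => i; rewrite gennE fg. Qed.

Lemma fg_map_lshift m n i : i < m ->
  fg_map (@lshift m n) (genn m i) = genn (m + n) i.
Proof. by move=> lt_im; rewrite (genn_lt lt_im) fg_map_gen gennE. Qed.

Lemma fg_map_rshift m n i : i < n ->
  fg_map (@rshift m n) (genn n i) = genn (m + n) (m + i).
Proof. by move=> lt_in; rewrite (genn_lt lt_in) fg_map_gen gennE. Qed.

Variables (m n m' n' : nat) (f : gr_hom m n) (g : gr_hom m' n').

Lemma gr_tens_genl i : i < m ->
  gr_tens f g (genn (m + m') i) = fg_map (@lshift n n') (f (genn m i)).
Proof. by move=> lt_im; rewrite -fg_map_lshift ?gr_tens_l. Qed.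

Lemma gr_tens_genr i : i < m' ->
  gr_tens f g (genn (m + m') (m + i)) = fg_map (@rshift n n') (g (genn m' i)).
Proof.
move=> lt_i; rewrite (genn_lt lt_i) -(gr_tens_rgen f); congr (gr_tens _ _ _).
by rewrite gennE.
Qed.

Lemma gr_swap_genl i : i < m -> gr_swap m n (genn (m + n) i) = genn (n + m) (n + i).
Proof.
by move=> lt_i; rewrite -fg_map_lshift // (genn_lt lt_i) fg_map_gen gr_swap_lgen gennE.
Qed.

Lemma gr_swap_genr i : i < n -> gr_swap m n (genn (m + n) (m + i)) = genn (n + m) i.
Proof.
move=> lt_i; rewrite (_ : genn (m + n) _ = fg_gen (rshift m (Ordinal lt_i))).
  by rewrite gr_swap_rgen gennE.
by rewrite gennE.
Qed.

End GenN.

Local Open Scope group_scope.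
(* These are morphisms of [gr]; those of [kgrop] go the other way. *)
Definition gr_mu : gr_hom 1 2 := fg_lift (fun _ => genn 2 0 * genn 2 1).
Definition gr_eta : gr_hom 1 0 := fg_lift (fun _ => 1).
Definition gr_Delta : gr_hom 2 1 := fg_lift (fun _ => genn 1 0).
Definition gr_epsilon : gr_hom 0 1 := fg_lift (fun _ => 1).
Definition gr_antipode : gr_hom 1 1 := fg_lift (fun _ => (genn 1 0)^-1).

Lemma gr_muE : gr_mu (genn 1 0) = genn 2 0 * genn 2 1.
Proof. by rewrite (@genn_lt 1 0 isT); exact: fg_lift_gen. Qed.
Lemma gr_etaE : gr_eta (genn 1 0) = 1.
Proof. by rewrite (@genn_lt 1 0 isT); exact: fg_lift_gen. Qed.
Lemma gr_DeltaE0 : gr_Delta (genn 2 0) = genn 1 0.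
Proof. by rewrite (@genn_lt 2 0 isT); exact: fg_lift_gen. Qed.
Lemma gr_DeltaE1 : gr_Delta (genn 2 1) = genn 1 0.
Proof. by rewrite (@genn_lt 2 1 isT); exact: fg_lift_gen. Qed.
Lemma gr_antipodeE : gr_antipode (genn 1 0) = (genn 1 0)^-1.
Proof. by rewrite [X in gr_antipode X](@genn_lt 1 0 isT); exact: fg_lift_gen. Qed.

Local Opaque gr_swap gr_tens gr_mu gr_eta gr_Delta gr_epsilon gr_antipode genn fg_map.

Local Ltac sub_nat i m := let j := eval compute in (subn i m) in j.
Local Notation app := Multiplicative.sort.
Local Ltac gr_tensE m n m' n' f g q i :=
  rewrite -[app (@gr_tens m n m' n' f g) (genn q i)]
    /(gr_tens f g (genn (m + m') i)) (@gr_tens_genl m n m' n' f g i isT).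
Local Ltac gr_tensE' m n m' n' f g q i :=
  let j := sub_nat i m in
  rewrite -[app (@gr_tens m n m' n' f g) (genn q i)]
    /(gr_tens f g (genn (m + m') (m + j))) (@gr_tens_genr m n m' n' f g j isT).
Local Ltac gr_swapE m n q i :=
  rewrite -[app (@gr_swap m n) (genn q i)]/(gr_swap m n (genn (m + n) i))
    (@gr_swap_genl m n i isT).
Local Ltac gr_swapE' m n q i :=
  let j := sub_nat i m in
  rewrite -[app (@gr_swap m n) (genn q i)]
    /(gr_swap m n (genn (m + n) (m + j))) (@gr_swap_genr m n j isT).
Local Ltac gr_step := match goal with
  | |- context [app ?u (?x * ?y)] => rewrite (@gmulfM _ _ u x y)
  | |- context [app ?u 1] => rewrite (mult1 u)
  | |- context [app ?u (?x^-1)] => rewrite (multV u x)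
  | |- context [app (@gr_tens ?m ?n ?m' ?n' ?f ?g) (genn ?q ?i)] =>
      first [gr_tensE m n m' n' f g q i | gr_tensE' m n m' n' f g q i]
  | |- context [app (@gr_swap ?m ?n) (genn ?q ?i)] =>
      first [gr_swapE m n q i | gr_swapE' m n q i]
  | |- context [app (fg_map (@lshift ?m ?n)) (genn ?q ?i)] =>
      rewrite (@fg_map_lshift m n i isT)
  | |- context [app (fg_map (@rshift ?m ?n)) (genn ?q ?i)] =>
      rewrite (@fg_map_rshift m n i isT)
  | |- context [app gr_mu _] => rewrite gr_muE
  | |- context [app gr_eta _] => rewrite gr_etaE
  | |- context [app gr_antipode _] => rewrite gr_antipodeE
  | |- context [app gr_Delta _] => first [rewrite gr_DeltaE0 | rewrite gr_DeltaE1]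
  | |- _ => progress simpl
  end.

Section KGropCasimir.
Variable k : fieldType.
Notation K := (kgrop_prop k).

Definition kgrop_hom m n (f : gr_hom n m) : lhom K m n := << f >>.

Lemma kgr_comp m n p (g : gr_hom p n) (f : gr_hom n m) :
  kgrop_hom g ∘ kgrop_hom f = kgrop_hom (f \o g : gr_hom p m).
Proof. exact: kgrop_compU. Qed.
Lemma kgr_tens m n m' n' (f : gr_hom n m) (g : gr_hom n' m') :
  kgrop_hom f ⊗ kgrop_hom g = kgrop_hom (gr_tens f g).
Proof. exact: kgrop_tensU. Qed.
Lemma kgr_sym m n : psym K m n = kgrop_hom (gr_swap n m).
Proof. by []. Qed.
Lemma kgr_id n : (lid n : lhom K n n) = kgrop_hom (idfun : gr_hom n n).
Proof. by []. Qed.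

Local Ltac kgr_step := match goal with
  | |- context [@lid _ _ (prop_cat (kgrop_prop _)) ?n] => rewrite (@kgr_id n)
  | |- context [psym (kgrop_prop _) ?m ?n] => rewrite (@kgr_sym m n)
  | |- context [lcomp (@kgrop_hom ?n ?p ?g) (@kgrop_hom ?m _ ?f)] =>
      rewrite (@kgr_comp m n p g f)
  | |- context [ptens (@kgrop_hom ?m ?n ?f) (@kgrop_hom ?m' ?n' ?g)] =>
      rewrite (@kgr_tens m n m' n' f g)
  end.

Local Ltac gr_solve := do ! kgr_step; congr << _ >>;
  apply: hom_ext_genn => -[|[|[|[|[]]]]] //= _; do ! gr_step;
  by rewrite ?mulg1 ?mul1g ?mulgV ?mulVg -?mulgA.

Lemma lcomp0r (C : lincat k nat) m n p (g : lhom C n p) :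
  g ∘ (0 : lhom C m n)%R = 0%R.
Proof.
have := lcomp_linearr g (-1)%R 0%R (0%R : lhom C m n).
by rewrite /= scaler0 addr0 scaleN1r addNr.
Qed.
Lemma lcomp0l (C : lincat k nat) m n p (f : lhom C m n) :
  (0 : lhom C n p)%R ∘ f = 0%R.
Proof.
have := lcomp_linearl f (-1)%R 0%R (0%R : lhom C n p).
by rewrite /= scaler0 addr0 scaleN1r addNr.
Qed.
Lemma ptens0r (P : linprop k) m n m' n' (f : lhom P m n) :
  f ⊗ (0 : lhom P m' n')%R = 0%R.
Proof.
have := ptens_linearr f (-1)%R 0%R (0%R : lhom P m' n').
by rewrite /= scaler0 addr0 scaleN1r addNr.
Qed.

Definition kgrop_casimir : casimir_hopf K.
refine (@CasimirHopf k K (kgrop_hom gr_mu) (kgrop_hom gr_eta)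
  (kgrop_hom gr_Delta) (kgrop_hom gr_epsilon) (kgrop_hom gr_antipode) 0%R
  _ _ _ _ _ _ _ _ _ _ _ _ _ _ _ _).
- gr_solve.
- gr_solve.
- gr_solve.
- gr_solve.
- gr_solve.
- gr_solve.
- gr_solve.
- gr_solve.
- gr_solve.
- gr_solve.
- gr_solve.
- gr_solve.
- gr_solve.
- by rewrite !lcomp0r ptens0r addr0.
- by rewrite lcomp0r.
- by cbv zeta; rewrite ptens0r lcomp0r lcomp0l.
Defined.

End KGropCasimir.

Local Close Scope group_scope.
Local Close Scope nat_scope.

Definition pullback_module (k : fieldType) (O O' : Type) (C : lincat k O)
  (D : lincat k O') (F : linfunctor C D) (M : cmodule D) : cmodule C.
refine (@CModule k O C (fun x => M (lfun_ob F x))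
  (fun x y f => cmod_act M (lfun_hom F f)) _ _ _).
- by move=> x y a f g v; rewrite lfun_linear cmod_act_linear.
- by move=> x v; rewrite lfun_id cmod_act_id.
- by move=> x y z g f v; rewrite lfun_comp cmod_act_comp.
Defined.

(* The functor sending each Hopf generator to the corresponding morphism of
   [k gr^op] and the Casimir tensor to [0]: this is the projection onto the
   degree [0] part, identified with [k gr^op]. *)
Definition jacobi_proj (k : fieldType) :
    linfunctor (jacobi_prop k) (kgrop_prop k) :=
  jacobi_rec (kgrop_casimir k).

Definition T_module (k : fieldType) (M : cmodule (kgrop k)) :
    cmodule (jacobi_prop k) :=
  pullback_module (jacobi_proj k) M.

(* Main.v *)
From HB Require Import structures.
Require Import Defs.
From mathcomp Require Import all_boot all_algebra.
From mathcomp Require Import perm finmap monalg boolp functions.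

Set Implicit Arguments.
Unset Strict Implicit.
Unset Printing Implicit Defensive.

Import GRing.Theory.
Local Open Scope ring_scope.
Local Open Scope linprop_scope.

(** Write [X_d] for the generator of degree [d] of [S^d o a#] in one variable,
    [M = T (S^d o a#)] and [N = T (S^d' o a#)], and let [E] be an extension of [M]
    by [N].

    The proof manipulates group-like morphisms only. A family of exponents
    [a_1, ..., a_n] gives a column [psi n a : 1 -> n] and a row
    [row_mor n a : n -> 1]; the composite of a row [r] and a column [a] is the
    convolution power [pw (r . a)] of the identity, and the bialgebra operations
    send columns to columns. The images of [X_d] under the columns are the [d]-th
    powers of linear forms, which span the symmetric power (polarization), and the
    rows evaluate a symmetric tensor at points, hence are jointly faithful. These
    facts, gathered in [sym_module], are all that is used of [S^d o a#].

    Over the degree 0 part every extension splits. By Newton's binomial formula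
    for [pw a] and polynomiality of [M] and [N], [pw a] acts polynomially in [a] on
    [E 1], and the coefficient of [a ^ d] in [pw a y], for a lift [y] of [X_d], is a
    lift [e] with [pw a e = a ^ d e] ([weight_lift]). Sending the columns of [X_d]
    to those of [e] is well defined: a linear combination of columns of [e] lying
    over [0] belongs to [N], and every row kills it since it multiplies [e] by the
    value of [0] at a point ([column_graph_fun]). This section commutes with the
    bialgebra operations, hence with the antipode ([antipode_natural]).

    What remains of [E] is the action of the Casimir tensor on the section, a map
    from [M n] to [N (2 + n)]. It is determined by its value on [e], which is a
    form in three variables, linear in the first by the first axiom of the Casimir
    tensor, symmetric in the first two, and of degree [d] in the third. So it is
    [lam x y z ^ d], and it is of degree [d'], whence [lam = 0] unless
    [d' = d + 2] ([rhoE], [rho_degree]). The scalar [lam] determines [E] up to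
    equivalence and is linear for the Baer sum and the scaling of extensions.

    For [d' = d + 2] an extension with [lam = 1] comes from a PROP where the Casimir
    tensor is not zero: that of kernels between the affine spaces [k ^ n]. Its
    Hopf algebra is the algebra of functions on the additive group [k], and its
    Casimir tensor is the function [x y]. On homogeneous functions of degree [d],
    the term of degree [d + 2] in the action of a morphism of [A] is a derivation
    [casimir_part], which twists the action on [N + M] into the desired extension. *)

(** * Group-like morphisms in a PROP with a Hopf algebra *)

Local Open Scope nat_scope.

Section Casts.
Variables (k : fieldType) (C : lincat k nat).

Lemma lcast_id m n (em : m = m) (en : n = n) (f : lhom C m n) : lcast em en f = f.
Proof. by rewrite (eq_irrelevance em erefl) (eq_irrelevance en erefl). Qed.

Lemma lcast_comp m m' n n' p p' (em : m = m') (en : n = n') (ep : p = p')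
    (g : lhom C n p) (f : lhom C m n) :
  lcast em ep (g ∘ f) = lcast en ep g ∘ lcast em en f.
Proof. by case: _ / em; case: _ / en; case: _ / ep. Qed.

Lemma lcompDl m n p (g g' : lhom C n p) (f : lhom C m n) :
  (g + g')%R ∘ f = ((g ∘ f) + (g' ∘ f))%R.
Proof. by have := lcomp_linearl f 1%R g g'; rewrite !scale1r. Qed.
Lemma lcompDr m n p (g : lhom C n p) (f f' : lhom C m n) :
  g ∘ (f + f')%R = ((g ∘ f) + (g ∘ f'))%R.
Proof. by have := lcomp_linearr g 1%R f f'; rewrite !scale1r. Qed.
Lemma lcompZl m n p a (g : lhom C n p) (f : lhom C m n) :
  (a *: g)%R ∘ f = (a *: (g ∘ f))%R.
Proof. by have := lcomp_linearl f a g 0%R; rewrite !addr0 lcomp0l addr0. Qed.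
Lemma lcompZr m n p a (g : lhom C n p) (f : lhom C m n) :
  g ∘ (a *: f)%R = (a *: (g ∘ f))%R.
Proof. by have := lcomp_linearr g a f 0%R; rewrite !addr0 lcomp0r addr0. Qed.

End Casts.

Section PropAlgebra.
Variables (k : fieldType) (P : linprop k).

Lemma ptensDl m n m' n' (f f' : lhom P m n) (g : lhom P m' n') :
  (f + f')%R ⊗ g = (f ⊗ g + f' ⊗ g)%R.
Proof. by have := ptens_linearl g 1%R f f'; rewrite !scale1r. Qed.
Lemma ptensDr m n m' n' (f : lhom P m n) (g g' : lhom P m' n') :
  f ⊗ (g + g')%R = (f ⊗ g + f ⊗ g')%R.
Proof. by have := ptens_linearr f 1%R g g'; rewrite !scale1r. Qed.
Lemma ptens0l m n m' n' (g : lhom P m' n') : (0 : lhom P m n)%R ⊗ g = 0%R.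
Proof.
have := ptens_linearl g (-1)%R 0%R (0%R : lhom P m n).
by rewrite /= scaler0 addr0 scaleN1r addNr.
Qed.
Lemma ptensZl m n m' n' a (f : lhom P m n) (g : lhom P m' n') :
  (a *: f)%R ⊗ g = (a *: (f ⊗ g))%R.
Proof. by have := ptens_linearl g a f 0%R; rewrite !addr0 ptens0l addr0. Qed.
Lemma ptensZr m n m' n' a (f : lhom P m n) (g : lhom P m' n') :
  f ⊗ (a *: g)%R = (a *: (f ⊗ g))%R.
Proof. by have := ptens_linearr f a g 0%R; rewrite !addr0 ptens0r addr0. Qed.

Lemma ptens_compl m n p b (g : lhom P n p) (f : lhom P m n) :
  (g ∘ f) ⊗ lid b = (g ⊗ lid b) ∘ (f ⊗ lid b) :> lhom P _ _.
Proof. by rewrite -ptens_comp lcomp1l. Qed.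
Lemma ptens_compr m n p b (g : lhom P n p) (f : lhom P m n) :
  lid b ⊗ (g ∘ f) = (lid b ⊗ g) ∘ (lid b ⊗ f) :> lhom P _ _.
Proof. by rewrite -ptens_comp lcomp1l. Qed.

End PropAlgebra.

Notation tensA f g h := (etrans (esym (lcast_id _ _ _)) (ptensA f g h)).

Section Hopf.
Variables (k : fieldType) (P : linprop k) (H : casimir_hopf P).
Local Notation μ := (mu H).
Local Notation η := (eta H).
Local Notation Δ := (Delta H).
Local Notation ε := (epsilon H).

(** The pairing of morphisms out of the Hopf algebra into a tensor product. It
    reduces the computations below to associativity, unitality and symmetry of
    one operation, with [F ⊗ G] acting on the factors. *)
Definition star p q (f : lhom P 1 p) (g : lhom P 1 q) : lhom P 1 (p + q) :=
  (f ⊗ g) ∘ Δ.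
Local Notation "f ⋆ g" := (star f g) (at level 40, left associativity).

Lemma tens_star p q p' q' (F : lhom P p p') (G : lhom P q q') f g :
  (F ⊗ G) ∘ (f ⋆ g) = (F ∘ f) ⋆ (G ∘ g).
Proof. by rewrite /star lcompA ptens_comp. Qed.

Lemma starA p q r (f : lhom P 1 p) (g : lhom P 1 q) (h : lhom P 1 r) :
  lcast erefl (addnA p q r) (f ⋆ (g ⋆ h)) = (f ⋆ g) ⋆ h.
Proof.
rewrite /star -[f in LHS]lcomp1r ptens_comp -lcompA -Delta_coassoc.
rewrite -[h in RHS]lcomp1r ptens_comp -lcompA -ptensA.
by rewrite (lcast_comp _ (addnA 1 1 1)) (lcast_id erefl).
Qed.

Lemma star_swap p q (f : lhom P 1 p) (g : lhom P 1 q) :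
  psym P p q ∘ (f ⋆ g) = g ⋆ f.
Proof. by rewrite /star lcompA psym_nat -lcompA Delta_cocomm. Qed.

Lemma eps_star q (f : lhom P 1 q) : ε ⋆ f = f.
Proof.
rewrite /star -[ε]lcomp1l -[f in LHS]lcomp1r ptens_comp ptens1l -lcompA.
by rewrite Delta_counitl lcomp1r.
Qed.

Lemma star_eps (f : lhom P 1 1) : f ⋆ ε = f.
Proof.
rewrite /star -[ε]lcomp1l -[f in LHS]lcomp1r ptens_comp -lcompA Delta_counitr.
by rewrite lcomp1r -[RHS]ptens1r (lcast_id (addn0 1)).
Qed.

Lemma star_coalg p q (f : lhom P 1 p) (g : lhom P 1 q) (h : lhom P 1 1) :
  Δ ∘ h = h ⋆ h -> (f ⋆ g) ∘ h = (f ∘ h) ⋆ (g ∘ h).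
Proof. by move=> hh; rewrite /star -lcompA hh -/(star h h) tens_star. Qed.

Lemma starA1 r (f g : lhom P 1 1) (h : lhom P 1 r) : (f ⋆ (g ⋆ h)) = (f ⋆ g) ⋆ h.
Proof. by rewrite -[LHS](lcast_id erefl (addnA 1 1 r)) starA. Qed.


Notation starAE f g h := (etrans (esym (lcast_id _ _ _)) (starA f g h)).

(** The group-like endomorphisms of the generating object: [pw b] is the [b]-th
    convolution power of the identity. *)
Fixpoint pw (b : nat) : lhom P 1 1 :=
  if b is b'.+1 then μ ∘ (lid 1 ⋆ pw b') else η ∘ ε.

Lemma eps_pw b : ε ∘ pw b = ε.
Proof.
elim: b => [|b IHb] /=; first by rewrite lcompA epsilon_eta lcomp1l.
by rewrite lcompA epsilon_mu (tens_star ε ε) IHb lcomp1r eps_star.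
Qed.

Lemma conv_etal (f : lhom P 1 1) : μ ∘ (pw 0 ⋆ f) = f.
Proof.
rewrite -[f in LHS]lcomp1l [pw 0]/(η ∘ ε) -tens_star eps_star lcompA.
by rewrite mu_unitl lcomp1l.
Qed.

(** Coalgebra morphisms are closed under convolution because the coproduct is
    cocommutative: the four factors can be reordered. *)
Lemma conv_coalg (f g : lhom P 1 1) : Δ ∘ f = f ⋆ f -> Δ ∘ g = g ⋆ g ->
  Δ ∘ (μ ∘ (f ⋆ g)) = (μ ∘ (f ⋆ g)) ⋆ (μ ∘ (f ⋆ g)).
Proof.
move=> Df Dg; rewrite lcompA Delta_mu -!lcompA (tens_star Δ Δ) Df Dg.
rewrite (starAE (f ⋆ f) g g) -(starAE f f g).
rewrite (tens_star (lid 1 ⊗ psym P 1 1) (lid 1)) (tens_star (lid 1) (psym P 1 1)).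
rewrite star_swap !lcomp1l (starAE f g f) -(starAE (f ⋆ g) f g).
by rewrite (tens_star μ μ).
Qed.

Lemma Delta_pw b : Δ ∘ pw b = pw b ⋆ pw b.
Proof.
elim: b => [|b IHb] /=; last first.
  by apply: conv_coalg; rewrite // lcomp1r /star ptens_id lcomp1l.
by rewrite lcompA Delta_eta -(tens_star η η) eps_star.
Qed.

Lemma convA (f g h : lhom P 1 1) : μ ∘ ((μ ∘ (f ⋆ g)) ⋆ h) = μ ∘ (f ⋆ (μ ∘ (g ⋆ h))).
Proof.
rewrite -[h in LHS]lcomp1l -[f in RHS]lcomp1l.
rewrite -(tens_star μ (lid 1) (f ⋆ g)) -(tens_star (lid 1) μ) -(starAE f g h).
by rewrite !lcompA mu_assoc.
Qed.

Lemma conv_pw a b : μ ∘ (pw a ⋆ pw b) = pw (a + b).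
Proof. by elim: a => [|a IHa]; rewrite ?conv_etal //= convA IHa. Qed.

Lemma pw1 : pw 1 = lid 1.
Proof.
by rewrite /= -[lid 1 in LHS]lcomp1l -tens_star star_eps lcompA mu_unitr lcomp1l.
Qed.

Lemma conv_comp_pw (f g : lhom P 1 1) b :
  (μ ∘ (f ⋆ g)) ∘ pw b = μ ∘ ((f ∘ pw b) ⋆ (g ∘ pw b)).
Proof. by rewrite -lcompA (star_coalg f g (Delta_pw b)). Qed.

Lemma pwM a b : pw a ∘ pw b = pw (a * b).
Proof.
elim: a => [|a IHa] /=; first by rewrite -lcompA eps_pw.
by rewrite conv_comp_pw lcomp1l IHa conv_pw mulSn.
Qed.

(** The morphism [1 -> n] given by a column of exponents: it corresponds to the
    group homomorphism sending [x_i] to [x ^ a i]. *)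
Fixpoint psi n (a : nat -> nat) : lhom P 1 n :=
  match n return lhom P 1 n with
  | 0 => ε
  | n'.+1 => pw (a 0) ⋆ psi n' (fun j => a j.+1)
  end.

Lemma psi1 a : psi 1 a = pw (a 0).
Proof. exact: star_eps. Qed.

Lemma psi_pw n a b : psi n a ∘ pw b = psi n (fun j => a j * b).
Proof.
elim: n a => [|n IHn] a /=; first exact: eps_pw.
by rewrite (star_coalg (pw _) _ (Delta_pw b)) pwM IHn.
Qed.

Definition scons x (a : nat -> nat) j := if j is j'.+1 then a j' else x.

Lemma mu_psi n x y a :
  (μ ⊗ (lid n : lhom P n n)) ∘ psi (2 + n) (scons x (scons y a)) =
  psi (1 + n) (scons (x + y) a).
Proof. by rewrite /= starA1 tens_star conv_pw lcomp1l. Qed.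

Lemma eta_psi n a :
  (η ⊗ (lid n : lhom P n n)) ∘ psi n a = psi (1 + n) (scons 0 a).
Proof. by rewrite -[psi n a in LHS]eps_star tens_star lcomp1l. Qed.

Lemma Delta_psi n x a :
  (Δ ⊗ (lid n : lhom P n n)) ∘ psi (1 + n) (scons x a) =
  psi (2 + n) (scons x (scons x a)).
Proof. by rewrite /= starA1 tens_star Delta_pw lcomp1l. Qed.

Lemma eps_psi n x a : (ε ⊗ (lid n : lhom P n n)) ∘ psi (1 + n) (scons x a) = psi n a.
Proof. by rewrite /= tens_star eps_pw lcomp1l eps_star. Qed.

Lemma sym_psi n x y a :
  (psym P 1 1 ⊗ (lid n : lhom P n n)) ∘ psi (2 + n) (scons x (scons y a)) =
  psi (2 + n) (scons y (scons x a)).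
Proof. by rewrite /= !starA1 tens_star star_swap lcomp1l. Qed.

Lemma id_tens_psi m n (f : lhom P m n) x a :
  ((lid 1 : lhom P 1 1) ⊗ f) ∘ psi (1 + m) (scons x a) = pw x ⋆ (f ∘ psi m a).
Proof. by rewrite /= tens_star lcomp1l. Qed.

Lemma eq_psi n a b : (forall j, j < n -> a j = b j) -> psi n a = psi n b.
Proof.
elim: n a b => [|n IHn] a b //= ab.
by rewrite ab // (IHn _ (fun j => b j.+1)) // => j jn; exact: ab.
Qed.

Definition dotn n (r a : nat -> nat) := \sum_(j < n) r j * a j.

(** A row corresponds to the group homomorphism sending [x] to the product of
    the [x_i ^ r i] in increasing order; composites with columns do not depend on the
    order. *)
Fixpoint row_mor n (r : nat -> nat) : lhom P n 1 :=
  match n return lhom P n 1 with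
  | 0 => η
  | n'.+1 => μ ∘ (pw (r 0) ⊗ row_mor n' (fun j => r j.+1))
  end.

Lemma row_mor_psi n r a : row_mor n r ∘ psi n a = pw (dotn n r a).
Proof.
elim: n r a => [|n IHn] r a; first by rewrite /dotn big_ord0.
by rewrite /= -lcompA (tens_star (pw _)) IHn pwM conv_pw /dotn big_ord_recl.
Qed.

(** The idempotent projecting onto the augmentation part of one tensor factor,
    and its tensor powers. *)
Definition aug : lhom P 1 1 := (lid 1 - pw 0)%R.

Fixpoint augs n : lhom P n n :=
  match n return lhom P n n with 0 => lid 0 | n'.+1 => aug ⊗ augs n' end.

Lemma augK : aug ∘ aug = aug.
Proof.
rewrite /aug -!scaleN1r lcompDl !lcompDr !lcompZl !lcompZr !lcomp1l lcomp1r pwM.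
by rewrite scalerA mulrNN mulr1 scale1r scaleN1r addNr addr0.
Qed.

Lemma augsK n : augs n ∘ augs n = augs n.
Proof.
elim: n => [|n IHn] /=; first by rewrite lcomp1l.
by rewrite -(ptens_comp aug aug) augK IHn.
Qed.

Fixpoint augpw j : lhom P 1 1 :=
  if j is j'.+1 then μ ∘ (aug ⋆ augpw j') else pw 0.

Lemma augpwE j : augpw j = row_mor j (fun=> 1) ∘ (augs j ∘ psi j (fun=> 1)).
Proof.
elim: j => [|j IHj]; first by rewrite /= lcomp1l.
by rewrite [LHS]/= IHj [row_mor _ _]/= [augs _]/= [psi _ _]/= (tens_star aug) -lcompA
  (tens_star (pw 1)) !pw1 lcomp1r lcomp1l.
Qed.

Lemma starDl p q (f f' : lhom P 1 p) (g : lhom P 1 q) :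
  (f + f')%R ⋆ g = ((f ⋆ g) + (f' ⋆ g))%R.
Proof. by rewrite /star ptensDl lcompDl. Qed.
Lemma starZl p q a (f : lhom P 1 p) (g : lhom P 1 q) :
  (a *: f)%R ⋆ g = (a *: (f ⋆ g))%R.
Proof. by rewrite /star ptensZl lcompZl. Qed.
Lemma starDr p q (f : lhom P 1 p) (g g' : lhom P 1 q) :
  f ⋆ (g + g')%R = ((f ⋆ g) + (f ⋆ g'))%R.
Proof. by rewrite /star ptensDr lcompDl. Qed.
Lemma starZr p q a (f : lhom P 1 p) (g : lhom P 1 q) :
  f ⋆ (a *: g)%R = (a *: (f ⋆ g))%R.
Proof. by rewrite /star ptensZr lcompZl. Qed.

Definition convr (f : lhom P 1 1) (g : lhom P 1 1) : lhom P 1 1 := μ ∘ (f ⋆ g).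
Fact convr_linear f : linear (convr f).
Proof. by move=> a g h; rewrite /convr starDr starZr lcompDr lcompZr. Qed.
HB.instance Definition _ f := GRing.isLinear.Build k (lhom P 1 1) (lhom P 1 1) *:%R
  (convr f) (convr_linear f).

Lemma convDl f f' g : convr (f + f')%R g = (convr f g + convr f' g)%R.
Proof. by rewrite /convr starDl lcompDr. Qed.
Lemma convNl f g : convr (- f)%R g = (- convr f g)%R.
Proof. by rewrite -!scaleN1r /convr starZl lcompZr. Qed.

(** Newton's binomial formula for the identity, written as the convolution unit
    plus [aug]. *)
Lemma pw_binomial a N : a < N ->
  pw a = (\sum_(j < N) 'C(a, j)%:R *: augpw j)%R.
Proof.
elim: a N => [|a IHa] [|N] // aN.
  rewrite big_ord_recl bin0 scale1r big1 ?addr0 // => i _.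
  by rewrite bin0n scale0r.
have pwS : pw a.+1 = (convr aug (pw a) + pw a)%R.
  by rewrite -{2}[pw a]conv_etal -[RHS]convDl /aug subrK.
rewrite pwS {1}(IHa N) // (IHa N.+1) ?ltnS 1?ltnW // linear_sum /=.
rewrite !big_ord_recl !bin0 addrCA; congr (_ + _)%R; rewrite -big_split /=.
apply: eq_bigr => j _; rewrite linearZ /= -scalerDl; congr (_ *: _)%R.
by rewrite binS natrD addrC.
Qed.

(** Sandwiching [augs n] between a row and a column gives iterated finite
    differences, which kill polynomials of degree less than [n]. *)
Lemma row_mor_augs_psi n r a : exists2 l : seq (k * nat),
  row_mor n r ∘ (augs n ∘ psi n a) = (\sum_(c <- l) c.1 *: pw c.2)%R &
  forall (F : {poly k}) t, size F <= n ->
    (\sum_(c <- l) c.1 * F.[t + c.2%:R] = 0)%R.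
Proof.
elim: n r a => [|n IHn] r a.
  exists [:: (1%R, 0)].
    by rewrite /= lcomp1l big_seq1 scale1r.
  by move=> F t; rewrite leqn0 size_poly_eq0 => /eqP ->; rewrite big_seq1 horner0 mulr0.
have [l El Fl] := IHn (fun j => r j.+1) (fun j => a j.+1).
pose b := r 0 * a 0.
exists ([seq (c.1, b + c.2) | c <- l] ++ [seq (- c.1, c.2)%R | c <- l]).
  rewrite /= (tens_star aug) -lcompA (tens_star (pw _)) El -[LHS]/(convr _ _).
  have -> : pw (r 0) ∘ (aug ∘ pw (a 0)) = (pw b - pw 0)%R.
    rewrite /aug -!scaleN1r lcompDl lcompDr lcompZl lcompZr lcomp1l !pwM.
    by rewrite mul0n muln0.
  rewrite convDl convNl [in X in (_ - X)%R]/convr conv_etal linear_sum big_cat !big_map /=.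
  rewrite -sumrN; congr (_ + _)%R; apply: eq_bigr => c _; last by rewrite scaleNr.
  by rewrite linearZ /= /convr conv_pw.
move=> F t sF; rewrite big_cat !big_map /= -big_split /=.
(* The first variable contributes a difference operator, lowering the degree. *)
pose G := (F \Po ('X + b%:R%:P) - F)%R.
have sG : size G <= n.
  rewrite /G; have [->|F0] := eqVneq F 0%R.
    by rewrite comp_poly0 subrr size_poly0.
  have s1 : size ('X + b%:R%:P : {poly k})%R = 2 by rewrite size_XaddC.
  have sFc : size (F \Po ('X + b%:R%:P))%R = size F.
    by rewrite size_comp_poly2.
  rewrite -ltnS (leq_trans _ sF) //.
  have : size (F \Po ('X + b%:R%:P) - F)%R <= size F.
    by rewrite (leq_trans (size_polyD _ _)) // size_polyN sFc maxnn.
  rewrite leq_eqVlt => /orP[/eqP E|//].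
  have : lead_coef (F \Po ('X + b%:R%:P) - F)%R = 0%R.
    rewrite lead_coefE E coefB -{1}sFc -!lead_coefE lead_coef_comp ?s1 //.
    by rewrite lead_coefXaddC expr1n mulr1 subrr.
  by move/eqP; rewrite lead_coef_eq0 => /eqP->; rewrite size_poly0 lt0n size_poly_eq0.
rewrite -[RHS](Fl G t sG); apply: eq_bigr => c _.
rewrite /G hornerD hornerN horner_comp hornerD hornerX hornerC mulrBr mulNr natrD.
by rewrite -addrA [(c.2%:R + _)%R]addrC.
Qed.

End Hopf.

Local Open Scope ring_scope.

(** * Generation of the free PROP *)

Local Open Scope nat_scope.

Section UpToCast.
Variables (k : fieldType) (P : linprop k).

(** Equality of morphisms whose sources and targets are only propositionally
    equal; it turns the casts of a strict PROP into a congruence. *)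
Definition simeq m n m' n' (f : lhom P m n) (g : lhom P m' n') : Prop :=
  exists em en, lcast em en f = g.

Lemma simeq_refl m n (f : lhom P m n) : simeq f f.
Proof. by exists erefl, erefl. Qed.
Lemma simeq_lcast m n m' n' (em : m = m') (en : n = n') (f : lhom P m n) :
  simeq f (lcast em en f).
Proof. by exists em, en. Qed.
Lemma simeq_sym m n m' n' (f : lhom P m n) (g : lhom P m' n') : simeq f g -> simeq g f.
Proof. by move=> [em [en <-]]; case: _ / em; case: _ / en; exact: simeq_refl. Qed.
Lemma simeq_trans m n m' n' m'' n'' (f : lhom P m n) (g : lhom P m' n')
  (h : lhom P m'' n'') : simeq f g -> simeq g h -> simeq f h.
Proof.
move=> [em [en <-]] [em' [en' <-]]; case: _ / em'; case: _ / en'.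
exact: simeq_lcast.
Qed.
Lemma simeq_tens m n m' n' p q p' q' (f : lhom P m n) (f' : lhom P m' n')
    (g : lhom P p q) (g' : lhom P p' q') :
  simeq f f' -> simeq g g' -> simeq (f ⊗ g) (f' ⊗ g').
Proof.
move=> [em [en <-]] [ep [eq <-]].
by case: _ / em; case: _ / en; case: _ / ep; case: _ / eq; exact: simeq_refl.
Qed.
Lemma simeq_tensA m n m' n' m'' n'' (f : lhom P m n) (g : lhom P m' n')
    (h : lhom P m'' n'') : simeq (f ⊗ (g ⊗ h)) ((f ⊗ g) ⊗ h).
Proof. by rewrite -ptensA; exact: simeq_lcast. Qed.

Lemma psym1S n : psym P 1 (1 + n) =
  ((lid 1 : lhom P 1 1) ⊗ psym P 1 n) ∘ (psym P 1 1 ⊗ (lid n : lhom P n n)).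
Proof.
rewrite -[LHS](lcast_id (addnA 1 1 n) erefl) psym_hexagon; congr (_ ∘ _).
exact: (lcast_id (addnA 1 1 n) (addnA 1 n 1)).
Qed.

(** The mirror image of the hexagon, obtained by uniqueness of inverses. *)
Lemma psymS1 n : psym P (1 + n) 1 =
  (psym P 1 1 ⊗ (lid n : lhom P n n)) ∘ ((lid 1 : lhom P 1 1) ⊗ psym P n 1).
Proof.
set Y := RHS; have XY : psym P 1 (1 + n) ∘ Y = lid _.
  rewrite psym1S /Y -lcompA (lcompA (psym P 1 1 ⊗ _)) -(ptens_comp (psym P 1 1)).
  rewrite psymK lcomp1l ptens_id lcomp1l.
  by rewrite -(ptens_comp (lid 1) (lid 1) (psym P 1 n)) psymK lcomp1l ptens_id.
by rewrite -[LHS]lcomp1r -XY lcompA psymK lcomp1l.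
Qed.

End UpToCast.

Section Closure.
Variables (k : fieldType) (P : linprop k).
Variable Q : forall m n, lhom P m n -> Prop.
Hypothesis Qid : forall n, Q (lid n : lhom P n n).
Hypothesis Qcomp : forall m n p (g : lhom P n p) (f : lhom P m n),
  Q g -> Q f -> Q (g ∘ f).
Hypothesis Qtau : forall a b,
  Q ((lid a : lhom P a a) ⊗ (psym P 1 1 ⊗ (lid b : lhom P b b))).

Definition stably m n (f : lhom P m n) : Prop :=
  forall a b, Q ((lid a : lhom P a a) ⊗ (f ⊗ (lid b : lhom P b b))).

Lemma closed_simeq m n m' n' (f : lhom P m n) (g : lhom P m' n') :
  simeq f g -> Q f -> Q g.
Proof. by move=> [em [en <-]]; case: _ / em; case: _ / en. Qed.

Lemma stably_simeq m n m' n' (f : lhom P m n) (g : lhom P m' n') :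
  simeq f g -> stably f -> stably g.
Proof.
move=> fg Qf a b; apply: closed_simeq (Qf a b).
by do ! apply: simeq_tens; try exact: simeq_refl.
Qed.

Lemma stably_comp m n p (g : lhom P n p) (f : lhom P m n) :
  stably g -> stably f -> stably (g ∘ f).
Proof. by move=> Qg Qf a b; rewrite ptens_compl ptens_compr; exact: Qcomp. Qed.

Lemma stably_id n : stably (lid n : lhom P n n).
Proof. by move=> a b; rewrite !ptens_id. Qed.

Lemma stably_idl c m n (f : lhom P m n) : stably f -> stably ((lid c : lhom P c c) ⊗ f).
Proof.
move=> Qf a b; apply: closed_simeq (Qf (a + c) b).
rewrite -ptens_id; apply: simeq_trans (simeq_sym (simeq_tensA _ _ _)) _.
by apply: simeq_tens; [exact: simeq_refl|exact: simeq_tensA].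
Qed.

Lemma stably_idr c m n (f : lhom P m n) : stably f -> stably (f ⊗ (lid c : lhom P c c)).
Proof.
move=> Qf a b; apply: closed_simeq (Qf a (c + b)).
apply: simeq_tens; first exact: simeq_refl.
by rewrite -ptens_id; exact: simeq_tensA.
Qed.

Lemma stably_closed m n (f : lhom P m n) : stably f -> Q f.
Proof.
move=> Qf; apply: closed_simeq (Qf 0 0); rewrite ptens1l.
by rewrite -[f in X in simeq _ X]ptens1r; exact: simeq_lcast.
Qed.

Lemma stably_psymr n : stably (psym P n 1).
Proof.
elim: n => [|n IHn].
  have e1 : psym P 1 0 = lid 1 by rewrite -(psym0 P 1) (lcast_id (addn0 1)).
  have -> : psym P 0 1 = lid 1 by rewrite -(psymK P 1 0) e1 lcomp1r.
  exact: stably_id.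
rewrite psymS1; apply: stably_comp; last exact: (@stably_idl 1 _ _ (psym P n 1)).
exact: (@stably_idr n _ _ (psym P 1 1)).
Qed.

Lemma stably_psym m n : stably (psym P m n).
Proof.
elim: n => [|n IHn].
  apply: stably_simeq (stably_id m); rewrite -psym0.
  exact: simeq_sym (simeq_lcast _ _ _).
have H := psym_hexagon P m 1 n.
apply: stably_simeq (simeq_sym (simeq_lcast (addnA m 1 n) erefl _)) _.
rewrite H; apply: stably_comp; last by apply: stably_idr; exact: stably_psymr.
by apply: stably_simeq (simeq_lcast _ _ _) _; exact: stably_idl.
Qed.

(** Naturality of the symmetry moves an identity factor from the left of [g] to
    its right, so that [g] need only be considered in the first position. *)
Lemma stablyW m n (g : lhom P m n) :
  (forall b, Q (g ⊗ (lid b : lhom P b b))) -> stably g.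
Proof.
move=> Qg a b; apply: closed_simeq (simeq_sym (simeq_tensA _ _ _)) _.
have -> : (lid a : lhom P a a) ⊗ g = psym P n a ∘ (g ⊗ lid a) ∘ psym P a m.
  by rewrite psym_nat -lcompA psymK lcomp1r.
have Qs p q : Q (psym P p q ⊗ (lid b : lhom P b b)).
  by have := stably_psym p q 0 b; rewrite ptens1l.
rewrite !ptens_compl; do 2?[apply: (Qcomp) => //].
by apply: closed_simeq (Qg (a + b)); rewrite -ptens_id; exact: simeq_tensA.
Qed.

Variable H : casimir_hopf P.
Hypothesis Q0 : forall m n, Q (0 : lhom P m n)%R.
Hypothesis Qlin : forall m n a (f g : lhom P m n), Q f -> Q g -> Q (a *: f + g)%R.
Hypothesis Qmu : forall b, Q (mu H ⊗ (lid b : lhom P b b)).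
Hypothesis Qeta : forall b, Q (eta H ⊗ (lid b : lhom P b b)).
Hypothesis QDelta : forall b, Q (Delta H ⊗ (lid b : lhom P b b)).
Hypothesis Qeps : forall b, Q (epsilon H ⊗ (lid b : lhom P b b)).
Hypothesis Qanti : forall b, Q (antipode H ⊗ (lid b : lhom P b b)).
Hypothesis Qcas : forall b, Q (casimir H ⊗ (lid b : lhom P b b)).

(** Every expression is a combination of composites of generators, each next to
    identities. *)
Lemma stably_jeval m n (t : jterm k m n) : stably (jeval H t).
Proof.
elim: t => {m n} /= [n|m n p t IHt u IHu|m n m' n' t IHt u IHu|m n|m n|m n a t IHt u IHu||||||].
- exact: stably_id.
- exact: stably_comp.
- rewrite -[jeval H t]lcomp1r -[jeval H u]lcomp1l ptens_comp.
  by apply: stably_comp; [exact: stably_idr|exact: stably_idl].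
- exact: stably_psym.
- by move=> a b; rewrite ptens0l ptens0r.
- by move=> c b; rewrite ptens_linearl ptens_linearr; apply: Qlin.
- exact: stablyW.
- exact: stablyW.
- exact: stablyW.
- exact: stablyW.
- exact: stablyW.
- exact: stablyW.
Qed.

Lemma closed_jeval m n (t : jterm k m n) : Q (jeval H t).
Proof. exact/stably_closed/stably_jeval. Qed.

End Closure.

Section Jacobi.
Variable k : fieldType.
Local Notation J := (jacobi_casimir k).

Lemma jeval_jacobi m n (t : jterm k m n) : jeval J t = jclass t :> lhom (jacobi_prop k) m n.
Proof.
apply: jhomP => P H; rewrite jhom_evalE.
elim: t => {m n} [n|m n p t IHt u IHu|m n m' n' t IHt u IHu|m n|m n|m n a t IHt u IHu||||||];
  try exact: jhom_evalE.
- by rewrite [RHS]/= -IHt -IHu; exact: jacobi_eval_comp.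
- by rewrite [RHS]/= -IHt -IHu; exact: jacobi_eval_tens.
- by rewrite [RHS]/= -IHt -IHu; exact: jhom_eval_linear.
Qed.

Lemma jacobi_jeval m n (f : lhom (jacobi_prop k) m n) : f = jeval J (repr f).
Proof. by rewrite jeval_jacobi jreprK. Qed.

End Jacobi.

Local Open Scope ring_scope.

(** * Compatibility with the antipode *)

Local Open Scope nat_scope.

Section HopfGen.
Variables (k : fieldType) (P : linprop k) (H : casimir_hopf P).
Local Notation μ := (mu H).
Local Notation η := (eta H).
Local Notation Δ := (Delta H).
Local Notation ε := (epsilon H).
Local Notation S := (antipode H).
Local Notation I := (lid 1 : lhom P 1 1).
Local Notation "f ⋆ g" := (star H f g) (at level 40, left associativity).

(** The bialgebra operations, each next to a bystander factor. The antipode is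
    left out on purpose: it is determined by the other operations, as
    [antipode_natural] shows. *)
Inductive hopf_gen : forall m n, lhom P m n -> Prop :=
| hopf_gen_mu b : hopf_gen (μ ⊗ (lid b : lhom P b b))
| hopf_gen_eta b : hopf_gen (η ⊗ (lid b : lhom P b b))
| hopf_gen_Delta b : hopf_gen (Δ ⊗ (lid b : lhom P b b))
| hopf_gen_eps b : hopf_gen (ε ⊗ (lid b : lhom P b b))
| hopf_gen_sym a b : hopf_gen ((lid a : lhom P a a) ⊗ (psym P 1 1 ⊗ (lid b : lhom P b b))).

(** The columns correspond to the group homomorphisms to [F_1], on which the
    bialgebra operations act through matrices of natural numbers. *)
Lemma hopf_gen_psi m n (f : lhom P m n) a : hopf_gen f ->
  exists b, f ∘ psi H m a = psi H n b.
Proof.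
have E q c : exists x c', psi H (1 + q) c = psi H (1 + q) (scons x c').
  by exists (c 0), (fun j => c j.+1); apply: eq_psi => -[].
have E2 q c : exists x y c', psi H (2 + q) c = psi H (2 + q) (scons x (scons y c')).
  by exists (c 0), (c 1), (fun j => c j.+2); apply: eq_psi => -[|[]].
move=> Gf; case: _ _ f / Gf a => [b|b|b|b|c b] a.
- by have [x [y [c ->]]] := E2 b a; rewrite mu_psi; eexists.
- by rewrite eta_psi; eexists.
- by have [x [c ->]] := E b a; rewrite Delta_psi; eexists.
- by have [x [c ->]] := E b a; rewrite eps_psi; eexists.
elim: c a => [|c IHc] a.
  by rewrite ptens1l; have [x [y [c ->]]] := E2 b a; rewrite sym_psi; eexists.
rewrite -(ptens_id P 1 c) -(tensA (lid 1) (lid c) (psym P 1 1 ⊗ lid b)).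
have [x [a' ->]] := E (c + (1 + 1 + b)) a.
have [b' Eb] := IHc a'; exists (scons x b').
by rewrite id_tens_psi Eb.
Qed.

Variables (X Y : cmodule P) (h : forall n, X n -> Y n).
Hypothesis hP : forall m n (f : lhom P m n), hopf_gen f ->
  forall v, h (cmod_act X f v) = cmod_act Y f (h v).

Let Q m n (f : lhom P m n) := forall v, h (cmod_act X f v) = cmod_act Y f (h v).
Let Qid n : Q (lid n). Proof. by move=> v; rewrite !cmod_act_id. Qed.
Let Qcomp m n p (g : lhom P n p) (f : lhom P m n) : Q g -> Q f -> Q (g ∘ f).
Proof. by move=> Qg Qf v; rewrite !cmod_act_comp Qg Qf. Qed.
Let Qtau a b : Q ((lid a : lhom P a a) ⊗ (psym P 1 1 ⊗ (lid b : lhom P b b))).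
Proof. exact/hP/hopf_gen_sym. Qed.

Lemma hopf_gen_stably m n (g : lhom P m n) :
  (forall b, hopf_gen (g ⊗ (lid b : lhom P b b))) -> stably Q g.
Proof. by move=> gG; apply: stablyW => // b; exact/hP. Qed.

(** In a Hopf algebra [S = S * id * S] for the convolution product, and the two
    ways of bracketing this product show that anything compatible with the
    bialgebra operations is compatible with [S]. *)
Lemma antipode_natural b v :
  h (cmod_act X (S ⊗ (lid b : lhom P b b)) v) = cmod_act Y (S ⊗ lid b) (h v).
Proof.
pose T m n (f : lhom P m n) : lhom P (m + b) (n + b) := f ⊗ lid b.
have TM m n p (g : lhom P n p) (f : lhom P m n) : T _ _ (g ∘ f) = T _ _ g ∘ T _ _ f.
  exact: ptens_compl.
have QT m n (f : lhom P m n) : stably Q f -> Q (T _ _ f).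
  by move=> Qf; have := Qf 0 b; rewrite ptens1l.
have Qm := hopf_gen_stably hopf_gen_mu; have Qe := hopf_gen_stably hopf_gen_eta.
have QD := hopf_gen_stably hopf_gen_Delta; have Qc := hopf_gen_stably hopf_gen_eps.
have DE : I ⋆ I = Δ by rewrite /star ptens_id lcomp1l.
have e1 : (ε ⊗ I) ∘ (I ⋆ S) = S by rewrite (tens_star H ε I) lcomp1r lcomp1l eps_star.
have e2 : (Δ ⊗ I) ∘ (I ⋆ S) = I ⋆ (I ⋆ S).
  by rewrite (tens_star H Δ I) lcomp1r lcomp1l -DE starA1.
have e2' : (I ⊗ μ) ∘ (I ⋆ (I ⋆ S)) = I ⊗ η.
  rewrite (tens_star H I μ) lcomp1l {2}/star lcompA antipode_r.
  by rewrite -{1}[I]lcomp1l -(tens_star H I η) star_eps lcomp1r.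
(* [A] brackets the product of [S * id * S] on the left, [e4] on the right. *)
pose A : lhom P 3 1 := μ ∘ ((μ ∘ (S ⊗ I)) ⊗ I).
have e3 : A ∘ (Δ ⊗ I) = ε ⊗ I.
  rewrite /A -lcompA -(ptens_comp (μ ∘ (S ⊗ I)) Δ I I) lcomp1l.
  by rewrite antipode_l ptens_compl lcompA mu_unitl lcomp1l.
have e4 : A = (μ ∘ (S ⊗ I)) ∘ (I ⊗ μ).
  rewrite /A ptens_compl lcompA mu_assoc -!lcompA; congr (_ ∘ _).
  rewrite -(tensA S I I) -(ptens_comp I S μ (I ⊗ I)) -(ptens_comp S I I μ).
  by rewrite ptens_id !lcomp1l !lcomp1r.
have e5 : (μ ∘ (S ⊗ I)) ∘ (I ⊗ η) = S.
  rewrite -lcompA -(ptens_comp S I I η) lcomp1r lcomp1l -[S in LHS]lcomp1l.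
  rewrite -[η]lcomp1r (ptens_comp I S η (lid 0)) lcompA mu_unitr lcomp1l.
  by rewrite -[RHS]ptens1r (lcast_id (addn0 1)).
pose y := h (cmod_act X (T _ _ (I ⋆ (I ⋆ S))) v).
have y1 : y = cmod_act Y (T _ _ (Δ ⊗ I)) (h (cmod_act X (T _ _ (I ⋆ S)) v)).
  rewrite /y -e2 TM cmod_act_comp; apply: (QT _ _ (Δ ⊗ I)).
  exact: (@stably_idr k P Q 1 _ _ Δ QD).
transitivity (cmod_act Y (T _ _ A) y).
  rewrite y1 -cmod_act_comp -TM e3 -{1}e1.
  rewrite -[(_ ∘ _) ⊗ _]/(T _ _ _) TM cmod_act_comp; apply: (QT _ _ (ε ⊗ I)).
  exact: (@stably_idr k P Q 1 _ _ ε Qc).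
rewrite e4 TM cmod_act_comp /y -(QT _ _ (I ⊗ μ)); last first.
  exact: (@stably_idl k P Q 1 _ _ μ Qm).
rewrite -cmod_act_comp -TM e2' (QT _ _ (I ⊗ η)); last first.
  exact: (@stably_idl k P Q 1 _ _ η Qe).
by rewrite -cmod_act_comp -TM e5.
Qed.

End HopfGen.

Local Open Scope ring_scope.

(** * The polarization formula *)

Section Ryser.
Variables (R : comNzRingType) (d : nat).

Definition cosign (I : {set 'I_d}) : R := \prod_(m < d) (if m \in I then 1 else -1).

(** Ryser's formula for the permanent of [b]; applied to the values of a product
    of [d] linear forms this is the polarization identity. *)
Lemma ryser (b : 'I_d -> 'I_d -> R) :
  \sum_(I : {set 'I_d}) cosign I * \prod_l (\sum_(m in I) b l m) =
  \sum_(s : 'S_d) \prod_l b l (s l).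
Proof.
transitivity (\sum_(f : {ffun 'I_d -> 'I_d}) \prod_l b l (f l) *
    \sum_(I : {set 'I_d}) \prod_m (if m \in I then 1 else - (m \notin codom f)%:R)).
  transitivity (\sum_(I : {set 'I_d}) \sum_(f : {ffun 'I_d -> 'I_d})
      \prod_l b l (f l) * (cosign I * \prod_l (f l \in I)%:R)).
    apply: eq_bigr => I _.
    under [X in _ * X]eq_bigr => l _ do rewrite big_mkcond.
    rewrite bigA_distr_bigA big_distrr; apply: eq_bigr => f _ /=.
    rewrite mulrCA; congr (_ * _); rewrite -big_split; apply: eq_bigr => l _ /=.
    by case: ifP; rewrite ?mulr1 ?mulr0.
  rewrite exchange_big; apply: eq_bigr => f _ /=; rewrite mulr_sumr.
  apply: eq_bigr => I _; congr (_ * _); rewrite /cosign.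
  have [/forallP fI|] := boolP [forall l, f l \in I].
    rewrite [X in _ * X]big1 ?mulr1 => [|l _]; last by rewrite fI.
    apply: eq_bigr => m _; case: ifPn => // mI.
    suff -> : m \notin codom f by [].
    by apply: contra mI => /codomP[l ->].
  rewrite negb_forall => /existsP[l fl].
  rewrite [X in _ * X](bigD1 l) //= (negPf fl) mul0r mulr0.
  by rewrite [RHS](bigD1 (f l)) //= (negPf fl) codom_f oppr0 mul0r.
(* Inclusion-exclusion leaves the surjective [f], that is, the permutations. *)
have E (f : {ffun 'I_d -> 'I_d}) :
    \sum_(I : {set 'I_d}) \prod_m (if m \in I then 1 else - (m \notin codom f)%:R) =
    (injectiveb f)%:R :> R.
  rewrite -(bigA_distr _ _ (fun=> 1)) /=.
  have [/injectiveP inj_f|] := boolP (injectiveb f).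
    rewrite big1 // => m _; rewrite (_ : m \in codom f) ?oppr0 ?addr0 //.
    exact: inj_card_onto.
  move=> ninj; have /existsP[m mf] : [exists m, m \notin codom f].
    apply: contraR ninj; rewrite negb_exists => /forallP f_onto.
    have /image_injP f_inj : #|image f 'I_d| == #|'I_d|.
      by apply/eqP/eq_card => m; rewrite [RHS]inE; apply: negbNE; exact: f_onto.
    by apply/injectiveP => x y; exact: f_inj.
  by rewrite (bigD1 m) //= mf subrr mul0r.
under eq_bigr => f _ do rewrite E.
rewrite (bigID (fun f : {ffun 'I_d -> 'I_d} => injectiveb f)) /=.
rewrite [X in _ + X]big1 ?addr0 => [|f /negPf ->]; last by rewrite mulr0.
rewrite (reindex (@pval _)) /=; last first.
  pose in_Sn := insubd (1%g : 'S_d).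
  by exists in_Sn => /= f Uf; first apply: val_inj; exact: insubdK.
apply: eq_big => [s|s _]; first by rewrite (valP s).
rewrite (valP s) mulr1; apply: eq_bigr => l _.
by rewrite pvalE.
Qed.

End Ryser.

(** * Symmetric powers of the dual of the abelianization *)

Section LinearSums.
Variables (k : fieldType) (V W : lmodType k) (f : V -> W).
Hypothesis lin_f : linear f.

Lemma linear_fun0 : f 0 = 0.
Proof. by have := lin_f (-1) 0 0; rewrite scaler0 addr0 scaleN1r addNr. Qed.

Lemma linear_funZ a u : f (a *: u) = a *: f u.
Proof. by have := lin_f a u 0; rewrite linear_fun0 !addr0. Qed.

Lemma linear_funD u v : f (u + v) = f u + f v.
Proof. by have := lin_f 1 u v; rewrite !scale1r. Qed.

Lemma linear_fun_sum (I : Type) (r : seq I) (P : pred I) (F : I -> V) :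
  f (\sum_(i <- r | P i) F i) = \sum_(i <- r | P i) f (F i).
Proof.
elim: r => [|i r IHr]; first by rewrite !big_nil linear_fun0.
by rewrite !big_cons; case: ifP => _; rewrite ?linear_funD IHr.
Qed.

End LinearSums.

(** The dual of the abelianization of a free group has the coordinate functions
    [adual_coord i], exponent sums of the [i]-th generator, as a basis. *)
Section DualBasis.
Variables (k : fieldType) (n : nat).
Local Notation word := (seq ('I_n * bool)).

Definition word_exponent (i : 'I_n) (u : word) : k :=
  \sum_(l <- u) (if l.1 == i then (-1) ^+ l.2 else 0).

Lemma word_exponent_cat i u v :
  word_exponent i (u ++ v) = word_exponent i u + word_exponent i v.
Proof. exact: big_cat. Qed.

Lemma word_exponent_eq i u v : word_eq u v -> word_exponent i u = word_exponent i v.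
Proof.
elim=> {u v} [u|u v _ ->|u v w _ -> _ ->|u j b v] //.
rewrite !word_exponent_cat; congr (_ + _).
rewrite /word_exponent !big_cons /=; case: (j == i); last by rewrite !add0r.
by case: b; rewrite /= ?expr1 ?expr0 addrA ?addNr ?subrr add0r.
Qed.

Definition fg_exponent i (g : freegroup n) : k := word_exponent i (repr g).

Lemma fg_exponentE i u : fg_exponent i (fg_class u) = word_exponent i u.
Proof. by apply/word_exponent_eq/fg_classP; rewrite fg_reprK. Qed.

Lemma fg_exponentM i g h : fg_exponent i (g * h)%g = fg_exponent i g + fg_exponent i h.
Proof.
rewrite -[g]fg_reprK -[h]fg_reprK -[(_ * _)%g]/(fg_mul _ _) fg_mulE !fg_exponentE.
exact: word_exponent_cat.
Qed.

Lemma fg_exponent_ab i g h : ab_eq g h -> fg_exponent i g = fg_exponent i h.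
Proof.
elim=> {g h} [g|g h _ ->|g h l _ -> _ ->|g g' h h' _ e _ e'|g h] //.
  by rewrite !fg_exponentM e e'.
by rewrite !fg_exponentM addrC.
Qed.

Definition ab_exponent i (x : abelianization (freegroup n)) : k^o :=
  fg_exponent i (repr x).

Lemma ab_exponentE i g : ab_exponent i (ab_class g) = fg_exponent i g.
Proof. by apply/fg_exponent_ab/ab_classP; rewrite ab_reprK. Qed.

Lemma ab_exponentD i : {morph ab_exponent i : x y / x + y}.
Proof.
move=> x y; rewrite -[x]ab_reprK -[y]ab_reprK -[LHS]/(ab_exponent i (ab_add _ _)).
by rewrite ab_addE !ab_exponentE fg_exponentM.
Qed.

Definition adual_coord (i : 'I_n) : adual k n.
exists (ab_exponent i); apply/asboolP; exact: ab_exponentD.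
Defined.

Definition adual_eval (g : freegroup n) (v : adual k n) : k^o := val v (ab_class g).

Lemma adual_eval_linear g : linear (adual_eval g).
Proof. by []. Qed.
HB.instance Definition _ g := GRing.isLinear.Build k (adual k n) k^o *:%R
  (adual_eval g) (adual_eval_linear g).

Lemma adual_evalM g h v : adual_eval (g * h)%g v = adual_eval g v + adual_eval h v.
Proof.
rewrite /adual_eval -ab_addE; case: v => v /= /asboolP; exact.
Qed.

Lemma adual_eval1 v : adual_eval 1%g v = 0.
Proof.
by apply: (addrI (adual_eval 1%g v)); rewrite -adual_evalM mulg1 addr0.
Qed.

Lemma adual_evalV g v : adual_eval (g^-1)%g v = - adual_eval g v.
Proof.
by apply: (addrI (adual_eval g v)); rewrite -adual_evalM mulgV subrr adual_eval1.
Qed.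

Lemma adual_evalX g b v : adual_eval (g ^+ b)%g v = adual_eval g v *+ b.
Proof.
elim: b => [|b IHb]; first by rewrite expg0 adual_eval1 mulr0n.
by rewrite expgS adual_evalM IHb mulrS.
Qed.

Lemma adual_ext (u v : adual k n) :
  (forall i, adual_eval (fg_gen i) u = adual_eval (fg_gen i) v) -> u = v.
Proof.
move=> uv; apply: val_inj; apply/funext => x; rewrite -[x]ab_reprK.
rewrite -[LHS]/(adual_eval _ u) -[RHS]/(adual_eval _ v).
move: (repr x) => g; rewrite -[g]fg_reprK; elim: (repr g) => [|[i b] w IHw].
  by rewrite -[fg_class _]/(1%g : freegroup n) !adual_eval1.
rewrite (_ : fg_class _ = (fg_class [:: (i, b)] * fg_class w)%g); last first.
  by rewrite -[RHS]/(fg_mul _ _) fg_mulE.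
rewrite !adual_evalM IHw; congr (_ + _); case: b; last exact: uv.
rewrite (_ : fg_class _ = (fg_gen i)^-1%g) ?adual_evalV ?uv //.
by rewrite -[RHS]/(fg_inv _) fg_invE.
Qed.

Lemma adual_coordE i j : adual_eval (fg_gen i) (adual_coord j) = (i == j)%:R.
Proof.
rewrite /adual_eval /= ab_exponentE fg_exponentE /word_exponent big_seq1 /=.
by case: eqP.
Qed.

Lemma adual_basis v : v = \sum_i adual_eval (fg_gen i) v *: adual_coord i.
Proof.
apply: adual_ext => i; rewrite linear_sum (bigD1 i) //= linearZ /= adual_coordE eqxx.
rewrite big1 ?addr0 => [|j ji]; first by rewrite /GRing.scale /= mulr1.
by rewrite linearZ /= adual_coordE eq_sym (negPf ji) scaler0.
Qed.

Definition adual_form (a : nat -> nat) : adual k n :=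
  \sum_(i < n) (a i)%:R *: adual_coord i.

Lemma adual_formE a i : adual_eval (fg_gen i) (adual_form a) = (a i)%:R.
Proof.
rewrite linear_sum (bigD1 i) //= linearZ /= adual_coordE eqxx big1 => [|j ji].
  by rewrite addr0 /GRing.scale /= mulr1.
by rewrite linearZ /= adual_coordE eq_sym (negPf ji) scaler0.
Qed.

End DualBasis.

Section Multilinear.
Variables (k : fieldType) (d : nat) (V W : lmodType k).
Implicit Types m : {ffun 'I_d -> V} -> W.

Definition symmetric_ffun m := forall (v : {ffun 'I_d -> V}) (s : 'S_d),
  m ([ffun i => v (s i)] : {ffun 'I_d -> V}) = m v.

Definition multilinear_ffun m := forall v i a x y,
  m (ffun_upd v i (a *: x + y)) = a *: m (ffun_upd v i x) + m (ffun_upd v i y).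

Lemma ffun_upd_id (v : {ffun 'I_d -> V}) i : ffun_upd v i (v i) = v.
Proof. by apply/ffunP => j; rewrite ffunE; case: eqP => [->|]. Qed.

(** The arguments are replaced by basis vectors one slot at a time. *)
Lemma multilinear_ext m1 m2 n (x : 'I_n -> V) (c : 'I_n -> V -> k) :
  multilinear_ffun m1 -> multilinear_ffun m2 ->
  (forall v, v = \sum_j c j v *: x j) ->
  (forall i : {ffun 'I_d -> 'I_n}, m1 [ffun l => x (i l)] = m2 [ffun l => x (i l)]) ->
  m1 =1 m2.
Proof.
move=> lm1 lm2 vE m12.
have P t : forall v : {ffun 'I_d -> V}, (forall l : 'I_d, t <= l -> exists j, v l = x j)%N -> m1 v = m2 v.
  elim: t => [|t IHt] v vx.
    have /choice [i iP] l : exists j, v l = x j by exact: vx.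
    suff -> : v = [ffun l => x ([ffun l => i l] l)] by exact: m12.
    by apply/ffunP => l; rewrite !ffunE.
  case: (ltnP t d) => [td|dt]; last first.
    by apply: IHt => l tl; have := ltn_ord l; rewrite ltnNge (leq_trans dt).
  pose l0 := Ordinal td; rewrite -(ffun_upd_id v l0) (vE (v l0)).
  pose F m (z : V) := m (ffun_upd v l0 z).
  have lF m : multilinear_ffun m -> linear (F m) by move=> lm a u w; exact: lm.
  rewrite -[LHS]/(F m1 _) -[RHS]/(F m2 _) !(linear_fun_sum (lF _ _)) //.
  apply: eq_bigr => j _; rewrite !(linear_funZ (lF _ _)) //; congr (_ *: _).
  apply: IHt => l tl; rewrite ffunE; case: eqP => [_|ll0]; first by exists j.
  apply: vx; rewrite ltn_neqAle tl andbT; apply/eqP => tl'; apply: ll0.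
  exact: val_inj.
by move=> v; apply: (P d) => l; rewrite leqNgt ltn_ord.
Qed.

End Multilinear.

Lemma multilinear_prod (k : fieldType) d (V : lmodType k) (phi : 'I_d -> V -> k^o) :
  (forall l, linear (phi l)) ->
  multilinear_ffun (fun v => (\prod_l phi l (v l) : k^o)).
Proof.
move=> lphi v i a x y.
have E z : \prod_l phi l (ffun_upd v i z l) =
    phi i z * \prod_(l | l != i) phi l (v l).
  rewrite (bigD1 i) //= ffunE eqxx; congr (_ * _); apply: eq_bigr => l li.
  by rewrite ffunE (negPf li).
by rewrite !E lphi mulrDl scalerAl.
Qed.

Section SymmetricPowers.
Variables (k : fieldType) (d : nat) (V : lmodType k).
Local Notation Sym := (sym_power d V).

Lemma sym_prod_multilinear : multilinear_ffun (@sym_prod k d V).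
Proof.
move=> v i a x y; rewrite /sym_prod -linearP; apply/qspace_piP.
exact: sym_rel_multilinear.
Qed.

Lemma sym_prod_perm (v : {ffun 'I_d -> V}) (s : 'S_d) :
  sym_prod [ffun i => v (s i)] = sym_prod v.
Proof. by apply/qspace_piP; exact: sym_rel_perm. Qed.

Lemma sym_power_ind (Pr : Sym -> Prop) :
  (forall a u v, Pr u -> Pr v -> Pr (a *: u + v)) -> Pr 0 ->
  (forall v, Pr (sym_prod v)) -> forall z, Pr z.
Proof.
move=> PrD Pr0 Prp z; rewrite -[z]qspace_reprK [repr z]monalgE linear_sum.
elim/big_rec: _ => // t x _ Px.
have -> : << (repr z)@_t *g t >> = (repr z)@_t *: << t >> :> {malg k[{ffun 'I_d -> V}]}.
  by apply/malgP => s; rewrite mcoeffZ !mcoeffU mulrnAr mulr1.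
by rewrite linearZ /=; apply: PrD => //; exact: Prp.
Qed.

Variables (W : lmodType k) (m : {ffun 'I_d -> V} -> W).
Hypothesis lin_m : multilinear_ffun m.
Hypothesis sym_m : symmetric_ffun m.

(** The universal property of the symmetric power. *)
Definition sym_lift & multilinear_ffun m & symmetric_ffun m :=
  fun z : Sym => lin_ext m (repr z).
Local Notation lift := (sym_lift lin_m sym_m).

Lemma sym_lift_pi s : lift (qspace_pi (sym_subspace d V) s) = lin_ext m s.
Proof.
have K r : sym_rel r -> lin_ext m r = 0.
  elim=> {r} [|a r t _ r0 _ t0|v i a x y|v t].
  - exact: linear0.
  - by rewrite lin_ext_linear r0 t0 scaler0 addr0.
  - by rewrite !linearB linearP /= !lin_extU lin_m subrr.
  - by rewrite linearB /= !lin_extU sym_m subrr.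
apply/eqP; rewrite -subr_eq0 -linearB; apply/eqP/K.
by apply: (proj1 (qspace_piP (sym_subspace d V) _ _)); rewrite qspace_reprK.
Qed.

Lemma sym_lift_linear : linear lift.
Proof.
move=> a u v; rewrite -[u]qspace_reprK -[v]qspace_reprK -linearP.
by rewrite !sym_lift_pi linearP.
Qed.

Lemma sym_liftE v : lift (sym_prod v) = m v.
Proof. by rewrite sym_lift_pi lin_extU. Qed.

End SymmetricPowers.

Section SymDual.
Variables (k : fieldType) (d n : nat).
Local Notation V := (adual k n).
Local Notation Sym := (sym_power d V).
Local Notation x := (adual_coord k).

Definition sym_mono (i : {ffun 'I_d -> 'I_n}) : Sym := sym_prod [ffun l => x (i l)].

Lemma sym_mono_perm (i : {ffun 'I_d -> 'I_n}) (s : 'S_d) : sym_mono [ffun l => i (s l)] = sym_mono i.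
Proof.
rewrite -[RHS](sym_prod_perm _ s); congr sym_prod.
by apply/ffunP => l; rewrite !ffunE.
Qed.

Lemma sym_prodE (v : {ffun 'I_d -> V}) :
  sym_prod v = \sum_(i : {ffun 'I_d -> 'I_n})
    (\prod_l adual_eval (fg_gen (i l)) (v l)) *: sym_mono i.
Proof.
pose m2 (v : {ffun 'I_d -> V}) : Sym := \sum_(i : {ffun 'I_d -> 'I_n})
    (\prod_l adual_eval (fg_gen (i l)) (v l)) *: sym_mono i.
move: v; apply: (multilinear_ext (m2 := m2) (x := @adual_coord k n)
  (c := fun i v => adual_eval (fg_gen i) v)); last 2 first.
- exact: adual_basis.
- move=> i; rewrite /m2 (bigD1 i) //= big1 ?scale1r => [|l _]; last first.
    by rewrite ffunE adual_coordE eqxx.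
  rewrite big1 ?addr0 // => j ji.
  have /existsP[l jl] : [exists l, j l != i l].
    apply: contraR ji; rewrite negb_exists => /forallP ji; apply/eqP/ffunP => l.
    by apply/eqP; rewrite -[_ == _]negbK; exact: ji.
  by rewrite (bigD1 l) //= ffunE adual_coordE (negPf jl) mul0r scale0r.
- exact: sym_prod_multilinear.
- move=> v i a y z; rewrite /m2 scaler_sumr -big_split; apply: eq_bigr => j _ /=.
  have := multilinear_prod (phi := fun l v => adual_eval (fg_gen (j l)) v)
    (fun l => adual_eval_linear _) v i a y z.
  by move=> ->; rewrite scalerDl scalerA.
Qed.

Definition point_eval (y : nat -> k) (v : V) : k^o :=
  \sum_(i < n) adual_eval (fg_gen i) v * y i.

Lemma point_eval_linear y : linear (point_eval y).
Proof.
move=> a u v; rewrite /point_eval scaler_sumr -big_split; apply: eq_bigr => i _ /=.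
by rewrite linearP mulrDl -scalerAl.
Qed.

Definition point_eval_prod y (v : {ffun 'I_d -> V}) : k^o := \prod_l point_eval y (v l).

Fact point_eval_prod_lin y : multilinear_ffun (point_eval_prod y).
Proof. exact: (multilinear_prod (fun _ => point_eval_linear y)). Qed.

Fact point_eval_prod_sym y : symmetric_ffun (point_eval_prod y).
Proof.
move=> v s; rewrite /point_eval_prod [RHS](reindex_inj (@perm_inj _ s)).
by apply: eq_bigr => l _; rewrite ffunE.
Qed.

Definition sym_eval y : Sym -> k^o :=
  sym_lift (point_eval_prod_lin y) (point_eval_prod_sym y).

Lemma sym_eval_linear y : linear (sym_eval y).
Proof. exact: (sym_lift_linear (point_eval_prod_lin y) (point_eval_prod_sym y)). Qed.
HB.instance Definition _ y := GRing.isLinear.Build k Sym k^o *:%R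
  (sym_eval y) (sym_eval_linear y).

Lemma sym_evalE y v : sym_eval y (sym_prod v) = \prod_l point_eval y (v l).
Proof. exact: (sym_liftE (point_eval_prod_lin y) (point_eval_prod_sym y)). Qed.

Definition form_pow (a : nat -> nat) : Sym := sym_prod [ffun=> adual_form k n a].

Lemma form_pow_eval y a : sym_eval y (form_pow a) = (\sum_(i < n) (a i)%:R * y i) ^+ d.
Proof.
rewrite sym_evalE (eq_bigr (fun=> \sum_(i < n) (a i)%:R * y i)); last first.
  move=> l _; rewrite ffunE; apply: eq_bigr => i _; rewrite adual_formE //.
by rewrite prodr_const card_ord.
Qed.

(** As a point or as a linear form, this is the sum over [m] in [I] of the basis
    vectors [i m], the argument of the terms of the polarization formula. *)
Definition tally (i : {ffun 'I_d -> 'I_n}) (I : {set 'I_d}) (j : nat) : nat :=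
  \sum_(m in I) (i m == j :> nat).

Hypothesis char0 : [pchar k] =i pred0.

Lemma fact_neq0 : (d`!)%:R != 0 :> k.
Proof.
by rewrite (proj1 (pcharf0P k) char0) -lt0n fact_gt0.
Qed.

Lemma sum_perm_const (F : Sym) : \sum_(s : 'S_d) F = (d`!)%:R *: F.
Proof. by rewrite sumr_const card_Sn scaler_nat. Qed.

Lemma sum_tally (c : 'I_n -> k) i I :
  \sum_(j < n) c j * (tally i I j)%:R = \sum_(m in I) c (i m).
Proof.
under eq_bigr => j _ do rewrite /tally natr_sum mulr_sumr.
rewrite exchange_big; apply: eq_bigr => m _ /=.
rewrite (bigD1 (i m)) //= eqxx mulr1 big1 ?addr0 // => j ji.
by rewrite [_ == _]eq_sym (negPf ji : (j == i m :> nat) = false) mulr0.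
Qed.

(** By polarization, the coefficients of a form are signed sums of its values;
    [ryser] evaluates these sums on a product of linear forms. *)
Lemma sym_polarization (z : Sym) : (d`!)%:R *: z =
  \sum_(i : {ffun 'I_d -> 'I_n})
    (\sum_(I : {set 'I_d}) cosign k I * sym_eval (fun j => (tally i I j)%:R) z) *: sym_mono i.
Proof.
move: z; apply: sym_power_eq => [a u v|a u v|v].
- by rewrite scalerDr !scalerA mulrC.
- rewrite scaler_sumr -big_split; apply: eq_bigr => i _ /=.
  rewrite scalerA -scalerDl; congr (_ *: _).
  rewrite mulr_sumr -big_split; apply: eq_bigr => I _ /=.
  by rewrite linearP mulrDr mulrCA.
transitivity (\sum_(i : {ffun 'I_d -> 'I_n}) \sum_(s : 'S_d)
    (\prod_l adual_eval (fg_gen (i (s l))) (v l)) *: sym_mono i); last first.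
  apply: eq_bigr => i _; rewrite -scaler_suml; congr (_ *: _).
  rewrite -(ryser (fun l m => adual_eval (fg_gen (i m)) (v l))).
  apply: eq_bigr => I _; rewrite sym_evalE; congr (_ * _); apply: eq_bigr => l _.
  by rewrite -(sum_tally (fun j => adual_eval (fg_gen j) (v l))).
rewrite exchange_big -sum_perm_const; apply: eq_bigr => s _.
pose h (s : 'S_d) (i : {ffun 'I_d -> 'I_n}) := [ffun l => i (s l)].
rewrite [LHS]sym_prodE [LHS](reindex_onto (h s) (h s^-1%g)) /=; last first.
  by move=> i _; apply/ffunP => l; rewrite !ffunE permK.
apply: eq_big => [i|i _].
  suff -> : h s^-1%g (h s i) = i by rewrite eqxx.
  by apply/ffunP => l; rewrite !ffunE permKV.
rewrite sym_mono_perm; congr (_ *: _); apply: eq_bigr => l _.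
by rewrite ffunE.
Qed.

Lemma sym_eval_inj (z : Sym) :
  (forall r : nat -> nat, sym_eval (fun j => (r j)%:R) z = 0) -> z = 0.
Proof.
move=> z0; have := sym_polarization z; rewrite big1 => [|i _].
  by move=> /eqP; rewrite scaler_eq0 (negPf fact_neq0) => /eqP.
by rewrite big1 ?scale0r // => I _; rewrite z0 mulr0.
Qed.

(** Polarization on the side of the forms: monomials are combinations of powers. *)
Lemma sym_mono_form_pow i : (d`!)%:R *: sym_mono i =
  \sum_(I : {set 'I_d}) cosign k I *: form_pow (tally i I).
Proof.
transitivity (\sum_(s : 'S_d) \sum_(j : {ffun 'I_d -> 'I_n})
    (\prod_l (i (s l) == j l)%:R) *: sym_mono j).
  rewrite -sum_perm_const; apply: eq_bigr => s _.
  rewrite (bigD1 [ffun l => i (s l)]) //= sym_mono_perm big1 => [|l _]; last first.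
    by rewrite ffunE eqxx.
  rewrite scale1r big1 ?addr0 // => j ji.
  have /existsP[l jl] : [exists l, i (s l) != j l].
    apply: contraR ji; rewrite negb_exists => /forallP ji; apply/eqP/ffunP => l.
    by apply/esym/eqP; rewrite ffunE -[_ == _]negbK; exact: ji.
  by rewrite (bigD1 l) //= (negPf jl) mul0r scale0r.
rewrite exchange_big /=.
transitivity (\sum_(j : {ffun 'I_d -> 'I_n}) \sum_(I : {set 'I_d})
    (cosign k I * \prod_l (tally i I (j l))%:R) *: sym_mono j).
  apply: eq_bigr => j _; rewrite -!scaler_suml; congr (_ *: _).
  rewrite -(ryser (fun l m => (i m == j l)%:R)); apply: eq_bigr => I _.
  by congr (_ * _); apply: eq_bigr => l _; rewrite /tally natr_sum.
rewrite exchange_big; apply: eq_bigr => I _ /=.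
rewrite /form_pow sym_prodE scaler_sumr; apply: eq_bigr => j _.
rewrite scalerA; congr (_ * _ *: _); apply: eq_bigr => l _.
by rewrite ffunE adual_formE.
Qed.

Lemma form_pow_ind (Pr : Sym -> Prop) :
  (forall a u v, Pr u -> Pr v -> Pr (a *: u + v)) -> Pr 0 ->
  (forall a, Pr (form_pow a)) -> forall z, Pr z.
Proof.
move=> PrD Pr0 Prf; have PrZ a u : Pr u -> Pr (a *: u).
  by move=> Pu; rewrite -[_ *: u]addr0; exact: PrD.
have Psum (I : finType) (F : I -> Sym) : (forall i, Pr (F i)) -> Pr (\sum_i F i).
  by move=> PF; elim/big_rec: _ => // i u _ Pu; rewrite -[F i]scale1r; exact: PrD.
apply: sym_power_ind => // v; rewrite sym_prodE; apply: (Psum) => i; apply: (PrZ).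
rewrite -[sym_mono i]scale1r -(mulVf fact_neq0) -scalerA sym_mono_form_pow.
by apply: (PrZ); apply: (Psum) => I; apply: (PrZ).
Qed.

End SymDual.

(** * The modules of symmetric powers *)

Local Open Scope nat_scope.

Section EvalPsi.
Variables (k : fieldType) (P : linprop k) (H : casimir_hopf P).
Local Notation J := (jacobi_casimir k).

Lemma jacobi_eval_mu : jhom_eval H (mu J) = mu H. Proof. exact: jhom_evalE. Qed.
Lemma jacobi_eval_eta : jhom_eval H (eta J) = eta H. Proof. exact: jhom_evalE. Qed.
Lemma jacobi_eval_Delta : jhom_eval H (Delta J) = Delta H. Proof. exact: jhom_evalE. Qed.
Lemma jacobi_eval_eps : jhom_eval H (epsilon J) = epsilon H. Proof. exact: jhom_evalE. Qed.
Lemma jacobi_eval_anti : jhom_eval H (antipode J) = antipode H. Proof. exact: jhom_evalE. Qed.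
Lemma jacobi_eval_cas : jhom_eval H (casimir J) = casimir H. Proof. exact: jhom_evalE. Qed.

Lemma jacobi_eval_star p q (f : lhom (jacobi_prop k) 1 p) (g : lhom (jacobi_prop k) 1 q) :
  jhom_eval H (star J f g) = star H (jhom_eval H f) (jhom_eval H g).
Proof. by rewrite /star jacobi_eval_comp jacobi_eval_tens jacobi_eval_Delta. Qed.

Lemma jacobi_eval_pw b : jhom_eval H (pw J b) = pw H b.
Proof.
elim: b => [|b IHb] /=.
  by rewrite (jacobi_eval_comp H (eta J)) jacobi_eval_eta jacobi_eval_eps.
rewrite (jacobi_eval_comp H (mu J)) (jacobi_eval_star (lid 1)) jacobi_eval_mu IHb.
by rewrite jacobi_eval_id.
Qed.

Lemma jacobi_eval_psi n a : jhom_eval H (psi J n a) = psi H n a.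
Proof.
elim: n a => [|n IHn] a; first exact: jacobi_eval_eps.
by rewrite [LHS](jacobi_eval_star (pw J _)) jacobi_eval_pw IHn.
Qed.

End EvalPsi.

Section KGropPsi.
Variable k : fieldType.
Local Notation G := (kgrop_casimir k).

Definition gr_pow n (a : nat -> nat) : gr_hom n 1 := fg_lift (fun i => genn 1 0 ^+ a i)%g.

Lemma gr_powE n a i : gr_pow n a (fg_gen i) = (genn 1 0 ^+ a i)%g.
Proof. exact: fg_lift_gen. Qed.

Local Opaque gr_pow gr_mu gr_eta gr_Delta gr_epsilon gr_tens genn fg_map.

Lemma kgrop_star n (f : gr_hom 1 1) (g : gr_hom n 1) :
  star G (kgrop_hom k f) (kgrop_hom k g) =
  kgrop_hom k (gr_Delta \o gr_tens f g : gr_hom (1 + n) 1).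
Proof. by rewrite /star kgr_tens kgr_comp. Qed.

Lemma gr_Delta_l x : gr_Delta (fg_map (@lshift 1 1) x) = x.
Proof.
apply: (hom_ext (f := gr_Delta \o fg_map (@lshift 1 1)) (g := idfun)) => i /=.
by rewrite gennE (ord1 i) /= fg_map_lshift // gr_DeltaE0.
Qed.

Lemma gr_Delta_r x : gr_Delta (fg_map (@rshift 1 1) x) = x.
Proof.
apply: (hom_ext (f := gr_Delta \o fg_map (@rshift 1 1)) (g := idfun)) => i /=.
by rewrite gennE (ord1 i) /= fg_map_rshift // gr_DeltaE1.
Qed.

Lemma kgrop_pw b : pw G b = kgrop_hom k (gr_pow 1 (fun=> b)).
Proof.
elim: b => [|b IHb].
  rewrite -[LHS]/(kgrop_hom k gr_eta ∘ kgrop_hom k gr_epsilon) kgr_comp.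
  congr kgrop_hom; apply: fg_hom_ext => i /=.
  by rewrite gr_powE gennE (ord1 i) /= gr_etaE mult1.
rewrite -[LHS]/(kgrop_hom k gr_mu ∘ star G (kgrop_hom k (idfun : gr_hom 1 1)) (pw G b)).
rewrite IHb kgrop_star kgr_comp; congr kgrop_hom.
apply: fg_hom_ext => i /=; rewrite gr_powE gennE (ord1 i) gr_muE !gmulfM.
rewrite -[genn 2 0](@fg_map_lshift 1 1 0) // gr_tens_l.
rewrite -[genn 2 1](@fg_map_rshift 1 1 0) // gr_tens_r.
by rewrite gr_Delta_l gr_Delta_r (@genn_lt 1 0 isT) gr_powE gennE expgS.
Qed.

Lemma kgrop_psi n a : psi G n a = kgrop_hom k (gr_pow n a).
Proof.
elim: n a => [|n IHn] a; first by congr kgrop_hom; apply: fg_hom_ext => -[].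
rewrite -[LHS]/(star G (pw G (a 0)) (psi G n (fun j => a j.+1))) IHn kgrop_pw kgrop_star; congr kgrop_hom.
apply: (@gr_ext_add 1 n) => i /=.
  by rewrite gr_tens_lgen gr_Delta_l !gr_powE (ord1 i).
by rewrite gr_tens_rgen gr_Delta_r !gr_powE.
Qed.

End KGropPsi.

Local Open Scope ring_scope.

Lemma cmod_act0 (k : fieldType) (O : Type) (C : lincat k O) (M : cmodule C) x y v :
  cmod_act M (0 : lhom C x y) v = 0.
Proof. exact: (@linear_fun0 k _ _ (fun f => cmod_act M f v) (fun a f g => cmod_act_linear a f g v)). Qed.

Lemma cmod_act_sum (k : fieldType) (O : Type) (C : lincat k O) (M : cmodule C) x y
    (I : Type) (r : seq I) (c : I -> k) (f : I -> lhom C x y) v :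
  cmod_act M (\sum_(i <- r) c i *: f i) v = \sum_(i <- r) c i *: cmod_act M (f i) v.
Proof.
elim: r => [|i r IHr]; first by rewrite !big_nil cmod_act0.
by rewrite !big_cons cmod_act_linear IHr.
Qed.

(** An abstract description of [T (S^d o a#)]: it is spanned by the images of one
    element under the columns, which are powers of linear forms for [sm_eval];
    evaluation at natural points separates it; the Casimir tensor kills it. *)
Record sym_module (k : fieldType) (d : nat) (M : cmodule (jacobi_prop k)) := SymModule {
  sm_unit : M 1%N;
  sm_eval : forall n, (nat -> k) -> M n -> k^o;
  sm_eval_linear : forall n y, linear (@sm_eval n y);
  sm_ind : forall n (Pr : M n -> Prop),
    (forall a u v, Pr u -> Pr v -> Pr (a *: u + v)) -> Pr 0 ->
    (forall a, Pr (cmod_act M (psi (jacobi_casimir k) n a) sm_unit)) -> forall z, Pr z;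
  sm_eval_psi : forall n y a,
    sm_eval y (cmod_act M (psi (jacobi_casimir k) n a) sm_unit) =
    (\sum_(i < n) (a i)%:R * y i) ^+ d;
  sm_eval_inj : forall n (z : M n),
    (forall r : nat -> nat, sm_eval (fun j => (r j)%:R) z = 0) -> z = 0;
  sm_casimir : forall n z,
    cmod_act M (casimir (jacobi_casimir k) ⊗ (lid n : lhom (jacobi_prop k) n n)) z = 0
}.

HB.instance Definition _ k d M (S : @sym_module k d M) n y :=
  GRing.isLinear.Build k (M n) k^o *:%R (@sm_eval k d M S n y) (@sm_eval_linear k d M S n y).

Section TModule.
Variables (k : fieldType) (d : nat).
Hypothesis char0 : [pchar k] =i pred0.
Local Notation A := (jacobi_prop k).
Local Notation J := (jacobi_casimir k).
Local Notation T := (T_module (sym_adual k d)).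

Lemma T_act_psi n a :
  cmod_act T (psi J n a) (form_pow k d 1 (fun=> 1%N)) = form_pow k d n a.
Proof.
rewrite /= (jacobi_eval_psi (kgrop_casimir k)) kgrop_psi /linz_act lin_extU /=.
rewrite sym_mapE; congr sym_prod; apply/ffunP => l; rewrite !ffunE.
apply: adual_ext => i; rewrite adual_formE.
rewrite /adual_eval /= /precomp /= ab_mapE gr_powE.
rewrite -[LHS]/(adual_eval (genn 1 0 ^+ a i)%g (adual_form k 1 (fun=> 1%N))).
by rewrite adual_evalX (@genn_lt 1 0 isT) adual_formE.
Qed.

Definition T_sym_module : sym_module d T.
refine (@SymModule k d T (form_pow k d 1 (fun=> 1%N)) (fun n y => @sym_eval k d n y)
  (fun n y => @sym_eval_linear k d n y) _ _ (fun n => @sym_eval_inj k d n char0) _).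
- by move=> n Pr PrD Pr0 Prp; apply: form_pow_ind => // a; rewrite -T_act_psi.
- by move=> n y a; rewrite T_act_psi form_pow_eval.
- move=> n z; rewrite /= jacobi_eval_tens jacobi_eval_cas ptens0l /linz_act.
  exact: (linear_fun0 (lin_ext_linear _)).
Defined.

End TModule.

Section SymModuleTheory.
Variables (k : fieldType) (d : nat).
Local Notation A := (jacobi_prop k).
Local Notation J := (jacobi_casimir k).
Variables (M : cmodule A) (S : sym_module d M).
Local Notation X := (sm_unit S).

Definition sm_evaln n (r : nat -> nat) : M n -> k^o := sm_eval S (fun j => (r j)%:R).
HB.instance Definition _ n r := GRing.isLinear.Build k (M n) k^o *:%R
  (@sm_evaln n r) (sm_eval_linear S (fun j => (r j)%:R)).

Lemma sm_evaln_psi n r a : sm_evaln r (cmod_act M (psi J n a) X) = (dotn n r a)%:R ^+ d.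
Proof.
rewrite /sm_evaln sm_eval_psi /dotn natr_sum; congr (_ ^+ _).
by apply: eq_bigr => i _; rewrite mulrC natrM.
Qed.

Lemma sm_evaln_inj n (z : M n) : (forall r, sm_evaln r z = 0) -> z = 0.
Proof. exact: sm_eval_inj. Qed.

(** Since the columns of the generator span, the action of [f] on values is
    the transpose of its action on columns. *)
Lemma sm_evaln_act m n (f : lhom A m n) (phi : (nat -> nat) -> nat -> nat) r r' :
  (forall a, f ∘ psi J m a = psi J n (phi a)) ->
  (forall a, dotn n r (phi a) = dotn m r' a) ->
  forall z : M m, sm_evaln r (cmod_act M f z) = sm_evaln r' z.
Proof.
move=> fpsi phiT; apply: (@sm_ind _ _ _ S) => [a u v uE vE||a].
- by rewrite !linearP /= uE vE.
- by rewrite !linear0.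
- by rewrite -cmod_act_comp fpsi !sm_evaln_psi phiT.
Qed.

Lemma sm_evaln_scale n b r (z : M n) :
  sm_evaln (fun j => (b * r j)%N) z = b%:R ^+ d * sm_evaln r z.
Proof.
move: z; apply: (@sm_ind _ _ _ S) => [a u v uE vE||a].
- by rewrite !linearP /= uE vE mulrDr /GRing.scale /= mulrCA.
- by rewrite !linear0 mulr0.
- rewrite !sm_evaln_psi -exprMn -natrM /dotn big_distrr /=.
  by congr (_%:R ^+ _); apply: eq_bigr => i _; rewrite mulnA.
Qed.

Lemma sm_act_pw b : cmod_act M (pw J b) X = b%:R ^+ d *: X.
Proof.
have X1 r : sm_evaln r X = (r 0%N)%:R ^+ d.
  have <- : cmod_act M (psi J 1 (fun=> 1%N)) X = X.
    by rewrite psi1 pw1 cmod_act_id.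
  by rewrite sm_evaln_psi /dotn big_ord1 muln1.
apply/eqP; rewrite -subr_eq0; apply/eqP/sm_evaln_inj => r.
have -> : pw J b = psi J 1 (fun=> b) by rewrite psi1.
rewrite linearB linearZ /= sm_evaln_psi X1 /dotn big_ord1 natrM exprMn.
by rewrite /GRing.scale /= mulrC subrr.
Qed.

Lemma sm_act_row_mor n r (z : M n) : cmod_act M (row_mor J n r) z = sm_evaln r z *: X.
Proof.
move: z; apply: (@sm_ind _ _ _ S) => [a u v uE vE||a].
- by rewrite !linearP /= uE vE scalerDl scalerA.
- by rewrite !linear0 scale0r.
- by rewrite -cmod_act_comp row_mor_psi sm_act_pw sm_evaln_psi.
Qed.

Lemma sm_unit_neq0 : X != 0.
Proof.
apply/eqP => X0; have := sm_evaln_psi 1 (fun=> 1%N) (fun=> 1%N).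
rewrite X0 !linear0 /dotn big_ord1 expr1n.
by move=> /esym/eqP; rewrite oner_eq0.
Qed.

Lemma sm_row_mor_inj n (z : M n) : (forall r, cmod_act M (row_mor J n r) z = 0) -> z = 0.
Proof.
move=> z0; apply: sm_evaln_inj => r; have := z0 r; rewrite sm_act_row_mor => /eqP.
by rewrite scaler_eq0 (negPf sm_unit_neq0) orbF => /eqP.
Qed.

(** A form of degree [d] has no term involving more than [d] variables. *)
Lemma sm_augs0 n (z : M n) : (d < n)%N -> cmod_act M (augs J n) z = 0.
Proof.
move=> dn; apply: sm_row_mor_inj => r; rewrite -cmod_act_comp; move: z.
apply: (@sm_ind _ _ _ S) => [a u v u0 v0||a].
- by rewrite linearP u0 v0 scaler0 addr0.
- exact: linear0.
rewrite -cmod_act_comp -lcompA; have [l -> l0] := row_mor_augs_psi J n r a.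
rewrite cmod_act_sum.
rewrite (eq_bigr (fun c => (c.1 * (0 + c.2%:R) ^+ d) *: X)); last first.
  by move=> c _; rewrite sm_act_pw scalerA add0r.
rewrite -scaler_suml (_ : \sum_(c <- l) _ = 0) ?scale0r //.
rewrite -[RHS](l0 'X^d 0); last by rewrite size_polyXn.
by apply: eq_bigr => c _; rewrite hornerXn.
Qed.

End SymModuleTheory.

(** * Vectors of pure weight in an extension *)

Section NaturalPolynomials.
Variable k : fieldType.
Hypothesis char0 : [pchar k] =i pred0.

Lemma natr_inj : injective (fun n : nat => n%:R : k).
Proof.
have E := proj1 (pcharf0P k) char0.
have H a b : (a <= b)%N -> a%:R = b%:R :> k -> a = b.
  move=> ab /eqP; rewrite eq_sym -subr_eq0 -natrB // E subn_eq0 => ba.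
  by apply/eqP; rewrite eqn_leq ab.
move=> a b ab; case: (leqP a b) => [/H|/ltnW/H]; first exact.
by move=> h; apply/esym/h.
Qed.

Lemma pow2_inj i j : (2%:R : k) ^+ i = 2%:R ^+ j -> i = j.
Proof. by rewrite -!natrX => /natr_inj /eqP; rewrite eqn_exp2l // => /eqP. Qed.

(** Replacing [a] by [2 a] and subtracting [2 ^ D] times the original removes the
    top coefficient, and the powers of 2 are distinct in characteristic 0. *)
Lemma vector_poly_eq0 (W : lmodType k) D (w : nat -> W) :
  (forall a : nat, \sum_(j < D) a%:R ^+ j *: w j = 0) ->
  forall j, (j < D)%N -> w j = 0.
Proof.
elim: D w => [|D IHD] w w0 // j; rewrite ltnS => jD.
have wl i : (i < D)%N -> w i = 0.
  move=> iD; have := IHD (fun j => (2%:R ^+ j - 2%:R ^+ D) *: w j) _ i iD.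
  have w1 (a : nat) : \sum_(j < D) a%:R ^+ j *: ((2%:R ^+ j - 2%:R ^+ D) *: w j) = 0.
    have := w0 (2 * a)%N; have := w0 a; rewrite !big_ord_recr /=.
    move=> /eqP; rewrite addrC addr_eq0 => /eqP wD /eqP.
    rewrite natrM exprMn -scalerA wD scalerN scaler_sumr subr_eq0 => /eqP wE.
    transitivity (\sum_(j < D) (2%:R * a%:R) ^+ j *: w j -
      \sum_(j < D) 2%:R ^+ D *: (a%:R ^+ j *: w j)); last by rewrite wE subrr.
    rewrite -sumrB; apply: eq_bigr => j' _.
    by rewrite !scalerA -scalerBl mulrBr exprMn mulrC [_ * 2%:R ^+ D]mulrC.
  move=> /(_ w1) /eqP.
  rewrite scaler_eq0 subr_eq0 => /orP[/eqP /pow2_inj ij|/eqP //].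
  by move: iD; rewrite ij ltnn.
case: (ltnP j D) => [/wl //|Dj]; have -> : j = D by apply/eqP; rewrite eqn_leq jD.
have := w0 1%N; rewrite big_ord_recr /= expr1n scale1r big1 ?add0r // => i _.
by rewrite wl ?scaler0.
Qed.

Lemma binomial_poly j : exists q : {poly k}, forall a : nat, q.[a%:R] = 'C(a, j)%:R.
Proof.
elim: j => [|j [q qE]]; first by exists 1%:P => a; rewrite hornerC bin0.
exists (j.+1%:R^-1 *: (q * ('X - j%:R%:P))) => a.
rewrite hornerZ hornerM hornerXsubC qE.
have j0 : j.+1%:R != 0 :> k by rewrite (proj1 (pcharf0P k) char0).
apply: (mulfI j0); rewrite mulVKf // -natrM mul_bin_left natrM mulrC.
case: (leqP j a) => [ja|aj]; first by rewrite natrB.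
by rewrite bin_small // !mulr0.
Qed.

End NaturalPolynomials.

Section WeightVector.
Variables (k : fieldType) (d d' : nat).
Hypothesis char0 : [pchar k] =i pred0.
Local Notation A := (jacobi_prop k).
Local Notation J := (jacobi_casimir k).
Variables (M N : cmodule A) (SM : sym_module d M) (SN : sym_module d' N).
Variable E : extension M N.
Local Notation X := (sm_unit SM).

Lemma ext_lift n (y : E n) : ext_proj E n y = 0 -> {z | y = ext_inj E n z}.
Proof. by move=> /ext_exact /cid. Qed.

(** The augmentation idempotents on more than [d] variables kill [M], so they
    carry [E] into [N], where those on more than [d'] variables vanish; being
    idempotent, they already vanish on [E]. *)
Lemma augpw_ext0 j (y : E 1%N) : (d < j)%N -> (d' < j)%N -> cmod_act E (augpw J j) y = 0.
Proof.
move=> dj d'j; rewrite augpwE cmod_act_comp; set u := cmod_act E (_ ∘ _) y.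
suff -> : u = 0 by rewrite linear0.
have [z uz] : {z | u = ext_inj E j z}.
  by apply: ext_lift; rewrite cmh_nat cmod_act_comp (sm_augs0 SM).
have -> : u = cmod_act E (augs J j) u by rewrite -cmod_act_comp lcompA augsK.
by rewrite uz -cmh_nat (sm_augs0 SN) // linear0.
Qed.

(** By [augpw_ext0], Newton's formula for [pw a y] has a bounded number of terms,
    and binomial coefficients are polynomials in [a]. *)
Lemma pw_ext_poly (y : E 1%N) : exists D (e : nat -> E 1%N), (d < D)%N /\
  forall a, cmod_act E (pw J a) y = \sum_(i < D) a%:R ^+ i *: e i.
Proof.
have [R [dR d'R]] : exists R, (d < R)%N /\ (d' < R)%N.
  by exists (maxn d d').+1; rewrite !ltnS leq_maxl leq_maxr.
have [q qE] := choice (binomial_poly char0).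
pose D := maxn d.+1 (\max_(j < R) size (q j)).
exists D, (fun i => \sum_(j < R) (q j)`_i *: cmod_act E (augpw J j) y).
split=> [|a]; first exact: leq_maxl.
have -> : cmod_act E (pw J a) y = \sum_(j < R) 'C(a, j)%:R *: cmod_act E (augpw J j) y.
  rewrite (@pw_binomial _ _ J a (R + a.+1)) ?ltn_addl // cmod_act_sum big_split_ord /=.
  rewrite [X in _ + X]big1 ?addr0 // => j _.
  by rewrite augpw_ext0 ?scaler0 // ltn_addr.
transitivity (\sum_(j < R) \sum_(i < D)
    a%:R ^+ i *: ((q j)`_i *: cmod_act E (augpw J j) y)).
  apply: eq_bigr => j _; rewrite -qE (@horner_coef_wide _ D); last first.
    by apply: leq_trans (leq_maxr _ _); exact: (leq_bigmax j).
  by rewrite scaler_suml; apply: eq_bigr => i _; rewrite scalerA mulrC.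
by rewrite exchange_big; apply: eq_bigr => i _; rewrite scaler_sumr.
Qed.

(** The generator of [M] lifts to a vector of weight [d]: the coefficient of
    [a ^ d] in [pw a y], for any lift [y]. *)
Lemma weight_lift : exists e : E 1%N, ext_proj E 1%N e = X /\
  forall b, cmod_act E (pw J b) e = b%:R ^+ d *: e.
Proof.
have [y yX] := ext_projP E X; have [D [e [dD eE]]] := pw_ext_poly y.
have pe i : (i < D)%N -> ext_proj E 1%N (e i) = (i == d)%:R *: X.
  move=> iD; apply/eqP; rewrite -subr_eq0; apply/eqP.
  apply: (vector_poly_eq0 char0
    (w := fun i => ext_proj E 1%N (e i) - (i == d)%:R *: X) _ iD) => a.
  rewrite (eq_bigr (fun i : 'I_D => ext_proj E 1%N (a%:R ^+ i *: e i) -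
    (a%:R ^+ i * (i == d :> nat)%:R) *: X)); last first.
    by move=> j _; rewrite /= scalerBr scalerA [X in _ = X - _]linearZ.
  rewrite sumrB -linear_sum -eE cmh_nat yX sm_act_pw.
  rewrite (bigD1 (Ordinal dD)) //= eqxx mulr1 big1 ?addr0 ?subrr // => j jd.
  by rewrite [_ == _](negPf jd : (j == d :> nat) = false) mulr0 scale0r.
exists (e d); split=> [|b]; first by rewrite pe // eqxx scale1r.
apply/eqP; rewrite -subr_eq0; apply/eqP.
apply: (vector_poly_eq0 char0
  (w := fun i => cmod_act E (pw J b) (e i) - b%:R ^+ i *: e i) _ dD) => a.
rewrite (eq_bigr (fun i : 'I_D => cmod_act E (pw J b) (a%:R ^+ i *: e i) -
  (b * a)%:R ^+ i *: e i)); last first.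
  by move=> j _; rewrite /= scalerBr scalerA [X in _ = X - _]linearZ natrM exprMn [b%:R ^+ _ * _]mulrC.
by rewrite sumrB -linear_sum -!eE -cmod_act_comp pwM subrr.
Qed.

End WeightVector.

(** * The splitting in degree 0 and the action of the Casimir tensor *)

Local Open Scope nat_scope.

Section CasimirColumns.
Variables (k : fieldType) (P : linprop k) (H : casimir_hopf P).
Local Notation I n := (lid n : lhom P n n).
Local Notation c := (casimir H).

Lemma casimir_psi n a :
  (c ⊗ I n) ∘ psi H n a = (I 2 ⊗ psi H n a) ∘ (c ⊗ I 1).
Proof.
rewrite -[psi H n a in LHS]ptens1l -(ptens_comp c (I 0) (I n) (psi H n a)).
by rewrite -(ptens_comp (I 2) c (psi H n a) (I 1)) !lcomp1l !lcomp1r.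
Qed.

Lemma casimir_pw b : (c ⊗ I 1) ∘ pw H b = (I 2 ⊗ pw H b) ∘ (c ⊗ I 1).
Proof. by rewrite -(psi1 H (fun=> b)) casimir_psi. Qed.

(** The first axiom of the Casimir tensor, next to one bystander factor. *)
Lemma Delta_casimir :
  (Delta H ⊗ I 2) ∘ (c ⊗ I 1) =
  ((((I 1 ⊗ eta H) ⊗ I 2) ∘ (c ⊗ I 1)) + ((eta H ⊗ I 3) ∘ (c ⊗ I 1)))%R.
Proof.
rewrite -{1 2}(ptens_id P 1 1) (tensA (Delta H) (I 1) (I 1)) (tensA (I 1 ⊗ eta H) (I 1) (I 1)).
rewrite -(ptens_compl 1 (Delta H ⊗ I 1) c) casimir_Delta ptensDl.
rewrite (ptens_compl 1 (I 1 ⊗ eta H ⊗ I 1) c); congr (_ + _)%R.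
rewrite -(tensA (eta H) c (I 1)) -[eta H in LHS]lcomp1r -[c ⊗ I 1 in LHS]lcomp1l.
by rewrite (ptens_comp (eta H) (I 0) (I 3) (c ⊗ I 1)) ptens1l.
Qed.

Lemma sym_casimir : (psym P 1 1 ⊗ I 1) ∘ (c ⊗ I 1) = c ⊗ I 1.
Proof. by rewrite -(ptens_compl 1 (psym P 1 1) c) casimir_sym. Qed.

Lemma psi_scons n a : psi H n.+1 a = psi H (1 + n) (scons (a 0) (fun j => a j.+1)).
Proof. by []. Qed.

Lemma id_eta_psi a : ((I 1 ⊗ eta H) ⊗ I 2) ∘ psi H 3 a =
  psi H 4 (scons (a 0) (scons 0 (fun j => a j.+1))).
Proof.
rewrite -(tensA (I 1) (eta H) (I 2)) (psi_scons 2).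
by rewrite (id_tens_psi H (eta H ⊗ I 2)) eta_psi.
Qed.

Lemma id_psi_psi n b a : (I 2 ⊗ psi H n b) ∘ psi H 3 a =
  psi H (2 + n) (scons (a 0) (scons (a 1) (fun j => b j * a 2))).
Proof.
rewrite -(ptens_id P 1 1) -(tensA (I 1) (I 1) (psi H n b)) (psi_scons 2).
rewrite (id_tens_psi H (I 1 ⊗ psi H n b)) (psi_scons 1).
by rewrite (id_tens_psi H (psi H n b)) psi1 psi_pw.
Qed.

End CasimirColumns.

Local Open Scope ring_scope.

(** Extensions of [M] by [N] are classified by a scalar: once [M] is lifted
    compatibly with the bialgebra structure, the Casimir tensor maps [w] to a
    multiple of the product of [w] with the first two coordinates. *)
Definition ext_invariant (k : fieldType) (d d' : nat) (M N : cmodule (jacobi_prop k))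
    (SM : sym_module d M) (SN : sym_module d' N) (E : extension M N) (lam : k) : Prop :=
  exists s : forall n, M n -> E n,
  [/\ forall n, linear (s n),
      forall n w, ext_proj E n (s n w) = w,
      forall m n f, @hopf_gen _ _ (jacobi_casimir k) m n f ->
        forall w, s n (cmod_act M f w) = cmod_act E f (s m w) &
      forall n w z r,
        cmod_act E (casimir (jacobi_casimir k) ⊗ (lid n : lhom (jacobi_prop k) n n)) (s n w) =
          ext_inj E (2 + n)%N z ->
        sm_evaln SN r z = lam * (r 0%N * r 1%N)%:R * sm_evaln SM (fun j => r j.+2) w].

Local Opaque jacobi_prop jacobi_casimir.

Section Splitting.
Variables (k : fieldType) (d d' : nat).
Hypothesis char0 : [pchar k] =i pred0.
Local Notation A := (jacobi_prop k).
Local Notation J := (jacobi_casimir k).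
Variables (M N : cmodule A) (SM : sym_module d M) (SN : sym_module d' N).
Variable E : extension M N.
Local Notation X := (sm_unit SM).
Local Notation I n := (lid n : lhom A n n).
Local Notation c := (casimir J).

Lemma casimir_ext n (y : E n) : exists z, cmod_act E (c ⊗ I n) y = ext_inj E (2 + n)%N z.
Proof.
have [z ->] : {z | cmod_act E (c ⊗ I n) y = ext_inj E (2 + n)%N z}.
  by apply: ext_lift; rewrite cmh_nat (sm_casimir SM).
by exists z.
Qed.

(** The image [z] of the Casimir tensor acting on a vector of weight [d], seen as
    a form [rho] in three variables: primitivity makes it additive in the first,
    symmetry exchanges the first two, and the weight governs the third. *)
Section Casimir.
Variable z : N 3%N.
Hypothesis z_Delta : cmod_act N (Delta J ⊗ I 2) z =
  cmod_act N ((I 1 ⊗ eta J) ⊗ I 2) z + cmod_act N (eta J ⊗ I 3) z.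
Hypothesis z_sym : cmod_act N (psym A 1 1 ⊗ I 1) z = z.
Hypothesis z_pw : forall b, cmod_act N (I 2 ⊗ pw J b) z = b%:R ^+ d *: z.

Let rho x y t : k := sm_evaln SN (scons x (scons y (fun=> t))) z.

Lemma rho_add x x' y t : rho (x + x')%N y t = rho x y t + rho x' y t.
Proof.
pose r4 := scons x (scons x' (scons y (fun=> t))).
have := congr1 (sm_evaln SN r4) z_Delta; rewrite linearD /=.
rewrite (@sm_evaln_act _ _ _ _ _ _ _ (fun a => scons (a 0%N) a) r4
  (scons (x + x')%N (scons y (fun=> t)))); last 2 first.
- by move=> a; rewrite psi_scons (Delta_psi J 2); apply: eq_psi => -[|[|[|[]]]].
- by move=> a; rewrite /dotn !big_ord_recl !big_ord0 /= mulnDl !addnA.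
rewrite (@sm_evaln_act _ _ _ _ _ _ _
  (fun a => scons (a 0%N) (scons 0%N (fun j => a j.+1))) r4
  (scons x (scons y (fun=> t)))); last 2 first.
- exact: id_eta_psi.
- by move=> a; rewrite /dotn !big_ord_recl !big_ord0 /= muln0 add0n.
rewrite (@sm_evaln_act _ _ _ _ _ _ _ (scons 0%N) r4
  (scons x' (scons y (fun=> t)))) //; last first.
- by move=> a; rewrite /dotn !big_ord_recl !big_ord0 /= muln0 add0n.
by move=> a; rewrite (eta_psi J 3).
Qed.

Lemma rho_sym x y t : rho x y t = rho y x t.
Proof.
rewrite /rho -{1}z_sym (@sm_evaln_act _ _ _ _ _ _ _
  (fun a => scons (a 1%N) (scons (a 0%N) (fun j => a j.+2))) _
  (scons y (scons x (fun=> t)))) //.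
- move=> a; rewrite (@eq_psi _ _ J 3 a (scons (a 0%N) (scons (a 1%N) (fun j => a j.+2)))).
    by rewrite (sym_psi J 1).
  by case=> [|[|[]]].
- by move=> a; rewrite /dotn !big_ord_recl !big_ord0 /= addnCA.
Qed.

Lemma rho_pow x y t : rho x y t = t%:R ^+ d * rho x y 1.
Proof.
have := congr1 (sm_evaln SN (scons x (scons y (fun=> 1%N)))) (z_pw t).
rewrite linearZ /= => zt; rewrite -[RHS]zt; apply/esym; rewrite -(psi1 J (fun=> t)).
apply: (@sm_evaln_act _ _ _ _ _ _ _ (fun a =>
  scons (a 0%N) (scons (a 1%N) (fun j => t * a 2%N)%N))).
- exact: id_psi_psi.
- by move=> a; rewrite /dotn !big_ord_recl !big_ord0 /= mul1n.
Qed.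

Lemma rhoE x y t : rho x y t = (x * y)%:R * t%:R ^+ d * rho 1 1 1.
Proof.
have rhol u v : rho u v 1 = u%:R * rho 1 v 1.
  elim: u => [|u IHu].
    have := rho_add 0 0 v 1; rewrite addn0 => /eqP; rewrite -subr_eq subrr => /eqP <-.
    by rewrite mul0r.
  by rewrite -addn1 rho_add IHu natrD mulrDl mul1r.
by rewrite rho_pow rhol (rho_sym 1 y) rhol natrM -!mulrA mulrCA; congr (_ * _); rewrite mulrCA.
Qed.

(** Comparison of the values at [(2, 2, 2)] and [(1, 1, 1)], as [z] has degree
    [d']. *)
Lemma rho_degree : d' = (d + 2)%N \/ rho 1 1 1 = 0.
Proof.
have := sm_evaln_scale SN 2 (scons 1 (scons 1 (fun=> 1%N))) z.
have -> : (fun j => 2 * scons 1 (scons 1 (fun=> 1)) j)%N = scons 2 (scons 2 (fun=> 2%N)).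
  by apply/funext => -[|[]].
rewrite -/(rho 2 2 2) -/(rho 1 1 1) rhoE => /eqP.
rewrite -subr_eq0 -mulrBl mulf_eq0 subr_eq0 natrM => /orP[/eqP E2|/eqP ->]; last by right.
by left; apply: (pow2_inj char0); rewrite exprD -E2 mulrC expr2.
Qed.

End Casimir.

Section WeightedSection.
Variable e : E 1%N.
Hypothesis e_lift : ext_proj E 1%N e = X.
Hypothesis e_weight : forall b, cmod_act E (pw J b) e = b%:R ^+ d *: e.

(** The section is first given as a graph, since what has to be proved is that it
    is well defined on linear combinations of columns. *)
Inductive column_graph n : M n -> E n -> Prop :=
| column_graph0 : column_graph 0 0
| column_graph_lin a u v y y' : column_graph u y -> column_graph v y' ->
    column_graph (a *: u + v) (a *: y + y')
| column_graph_psi a : column_graph (cmod_act M (psi J n a) X) (cmod_act E (psi J n a) e).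

Lemma column_graph_proj n (w : M n) y : column_graph w y -> ext_proj E n y = w.
Proof.
elim=> {w y} [|a u v y y' _ uE _ vE|a]; first exact: linear0.
  by rewrite linearP uE vE.
by rewrite cmh_nat e_lift.
Qed.

Lemma column_graph_row_mor n (w : M n) y r : column_graph w y ->
  cmod_act E (row_mor J n r) y = sm_evaln SM r w *: e.
Proof.
elim=> {w y} [|a u v y y' _ uE _ vE|a]; first by rewrite !linear0 scale0r.
  by rewrite !linearP /= uE vE scalerDl scalerA.
by rewrite -cmod_act_comp row_mor_psi e_weight sm_evaln_psi.
Qed.

(** A vector over [0] lies in [N], where the rows are jointly faithful; and rows
    turn columns of [e] into multiples of [e]. *)
Lemma column_graph_fun n (w : M n) y y' : column_graph w y -> column_graph w y' -> y = y'.
Proof.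
move=> wy wy'; have := column_graph_lin (-1) wy' wy; rewrite !scaleN1r addNr addrC => Gy.
have [z yz] := ext_lift (column_graph_proj Gy).
apply/eqP; rewrite -subr_eq0 yz; apply/eqP; rewrite (_ : z = 0) ?linear0 //.
apply: (sm_row_mor_inj SN) => r; apply: (@ext_injP _ _ _ _ _ E).
by rewrite cmh_nat -yz (column_graph_row_mor r Gy) !linear0 scale0r.
Qed.

Lemma column_graph_total n (w : M n) : exists y, column_graph w y.
Proof.
move: w; apply: (@sm_ind _ _ _ SM) => [a u v [y uy] [y' vy]||a].
- by exists (a *: y + y'); exact: column_graph_lin.
- by exists 0; exact: column_graph0.
- by exists (cmod_act E (psi J n a) e); exact: column_graph_psi.
Qed.

Lemma column_graph_act m n (f : lhom A m n) w y : hopf_gen J f ->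
  column_graph w y -> column_graph (cmod_act M f w) (cmod_act E f y).
Proof.
move=> Gf; elim=> {w y} [|a u v y y' _ uE _ vE|a].
- by rewrite !linear0; exact: column_graph0.
- by rewrite !linearP; exact: column_graph_lin.
- have [b fb] := hopf_gen_psi a Gf.
  by rewrite -!cmod_act_comp fb; exact: column_graph_psi.
Qed.

Lemma column_graph_casimir n (w : M n) y (z1 : N 3%N) lam : column_graph w y ->
  cmod_act E (c ⊗ I 1) e = ext_inj E 3%N z1 ->
  (forall x x' t, sm_evaln SN (scons x (scons x' (fun=> t))) z1 =
    (x * x')%:R * t%:R ^+ d * lam) ->
  exists z, cmod_act E (c ⊗ I n) y = ext_inj E (2 + n)%N z /\
  forall r, sm_evaln SN r z = lam * (r 0%N * r 1%N)%:R * sm_evaln SM (fun j => r j.+2) w.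
Proof.
move=> wy ez1 z1E; elim: wy => {w y} [|a u v y y' _ [z [uE zu]] _ [z' [vE zv]]|a].
- by exists 0; split=> [|r]; rewrite !linear0 ?mulr0.
- exists (a *: z + z'); split=> [|r]; first by rewrite !linearP uE vE.
  by rewrite !linearP /= zu zv mulrDr /GRing.scale /= mulrCA.
exists (cmod_act N (I 2 ⊗ psi J n a) z1); split=> [|r].
  by rewrite -cmod_act_comp casimir_psi cmod_act_comp ez1 cmh_nat.
rewrite (@sm_evaln_act _ _ _ _ _ _ _
  (fun b => scons (b 0%N) (scons (b 1%N) (fun j => a j * b 2%N)%N)) r
  (scons (r 0%N) (scons (r 1%N) (fun=> dotn n (fun j => r j.+2) a)))).
- by rewrite z1E sm_evaln_psi mulrC mulrA.
- exact: id_psi_psi.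
- move=> b; rewrite /dotn !big_ord_recl !big_ord0 /= addn0; congr (_ + (_ + _))%N.
  by rewrite big_distrl; apply: eq_bigr => j _; rewrite /= mulnA.
Qed.

End WeightedSection.

(** The invariant is the coefficient of the form [rho] attached to a vector of
    weight [d]; its value on [e] determines it on all columns of [e]. *)
Lemma ext_invariant_exists :
  exists2 lam, ext_invariant SM SN E lam & d' = (d + 2)%N \/ lam = 0.
Proof.
have [e [eX ew]] := weight_lift char0 SM SN E.
have [z1 ez1] := casimir_ext e.
have inj n := @ext_injP _ _ _ _ _ E n.
have zD : cmod_act N (Delta J ⊗ I 2) z1 =
    cmod_act N ((I 1 ⊗ eta J) ⊗ I 2) z1 + cmod_act N (eta J ⊗ I 3) z1.
  apply: inj; rewrite linearD /= !cmh_nat -ez1 -!cmod_act_comp Delta_casimir.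
  by rewrite -{1}[_ ∘ _]scale1r cmod_act_linear scale1r.
have zs : cmod_act N (psym A 1 1 ⊗ I 1) z1 = z1.
  by apply: inj; rewrite cmh_nat -ez1 -cmod_act_comp sym_casimir.
have zp b : cmod_act N (I 2 ⊗ pw J b) z1 = b%:R ^+ d *: z1.
  apply: inj; rewrite cmh_nat -ez1 -cmod_act_comp -casimir_pw cmod_act_comp ew.
  by rewrite !linearZ /= ez1.
pose lam := sm_evaln SN (scons 1 (scons 1 (fun=> 1%N))) z1.
have [s sG] : exists s : forall n, M n -> E n, forall n w, column_graph e w (s n w).
  exists (fun n w => sval (cid (column_graph_total e w))) => n w.
  exact: svalP (cid _).
exists lam; last exact: rho_degree.
exists s; split=> [n a u v|n w|m n f Gf w|n w z r].
- by apply: (column_graph_fun eX ew (sG n _)); exact: column_graph_lin.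
- exact: (column_graph_proj eX (sG n w)).
- by apply: (column_graph_fun eX ew (sG n _)); exact: column_graph_act.
have [z' [-> zE]] := column_graph_casimir (sG n w) ez1 (rhoE zD zs zp).
by move/inj <-; exact: zE.
Qed.

End Splitting.

(** * Classification of the extensions *)

Local Opaque jacobi_prop jacobi_casimir.

Section Classification.
Variables (k : fieldType) (d d' : nat).
Hypothesis char0 : [pchar k] =i pred0.
Local Notation A := (jacobi_prop k).
Local Notation J := (jacobi_casimir k).
Variables (M N : cmodule A) (SM : sym_module d M) (SN : sym_module d' N).
Local Notation I n := (lid n : lhom A n n).
Local Notation c := (casimir J).
Local Notation inv := (ext_invariant SM SN).
Implicit Types E F : extension M N.

(** The two lifts of [M] are matched with each other, and [N] with itself. This
    is compatible with the Casimir tensor because its action on the lifts can be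
    read off from values at points. *)
Lemma ext_invariant_equiv E F lam : inv E lam -> inv F lam -> ext_equiv E F.
Proof.
move=> [s [sl sp sG sc]] [t [tl tp tG tc]].
have injE n := @ext_injP _ _ _ _ _ E n.
have pE n (y : E n) : ext_proj E n (y - s n (ext_proj E n y)) = 0.
  by rewrite linearB /= sp subrr.
pose rho n (y : E n) : N n := sval (ext_lift (pE n y)).
have rhoE n (y : E n) : ext_inj E n (rho n y) = y - s n (ext_proj E n y).
  exact: esym (svalP (ext_lift (pE n y))).
pose h n (y : E n) : F n := t n (ext_proj E n y) + ext_inj F n (rho n y).
have rhol n a (u v : E n) : rho n (a *: u + v) = a *: rho n u + rho n v.
  by apply: injE; rewrite linearP /= !rhoE linearP sl scalerBr opprD addrACA.
have hl n : linear (h n).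
  move=> a u v; rewrite /h rhol !linearP tl.
  by rewrite [LHS]addrACA -scalerDr.
pose H n : {linear E n -> F n} :=
  HB.pack (h n) (GRing.isLinear.Build k (E n) (F n) *:%R (h n) (hl n)).
have hG m n (f : lhom A m n) : hopf_gen J f ->
    forall v, h n (cmod_act E f v) = cmod_act F f (h m v).
  move=> Gf v; rewrite /h linearD /= [ext_proj E n _]cmh_nat (tG _ _ _ Gf).
  rewrite -[cmod_act F f (ext_inj F m _)]cmh_nat.
  congr (_ + ext_inj F n _); apply: injE.
  by rewrite rhoE [RHS]cmh_nat rhoE linearB /= [ext_proj E n _]cmh_nat (sG _ _ _ Gf).
have hN m n (f : lhom A m n) v : h n (cmod_act E f v) = cmod_act F f (h m v).
  pose Q m n (f : lhom A m n) := forall v, h n (cmod_act E f v) = cmod_act F f (h m v).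
  rewrite (jacobi_jeval f); move: v; apply: (@closed_jeval _ _ Q) => {m n f}.
  - by move=> n v; rewrite !cmod_act_id.
  - by move=> m n p g f Qg Qf v; rewrite !cmod_act_comp Qg Qf.
  - by move=> a b; apply: hG; exact: hopf_gen_sym.
  - by move=> m n v; rewrite !cmod_act0 (linear_fun0 (hl n)).
  - by move=> m n a f g Qf Qg v; rewrite !cmod_act_linear hl Qf Qg.
  - by move=> b; apply: hG; exact: hopf_gen_mu.
  - by move=> b; apply: hG; exact: hopf_gen_eta.
  - by move=> b; apply: hG; exact: hopf_gen_Delta.
  - by move=> b; apply: hG; exact: hopf_gen_eps.
  - by move=> b v; exact: (antipode_natural hG).
  move=> b v; rewrite /h cmh_nat (sm_casimir SM) (linear_fun0 (tl _)) add0r.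
  rewrite linearD /= -[cmod_act F _ (ext_inj F b _)]cmh_nat (sm_casimir SN) linear0 addr0.
  have [z1 z1E] := casimir_ext SM (s b (ext_proj E b v)).
  have [z2 z2E] := casimir_ext SM (t b (ext_proj E b v)).
  have -> : rho _ (cmod_act E (c ⊗ I b) v) = z1.
    apply: injE; rewrite rhoE cmh_nat (sm_casimir SM) (linear_fun0 (sl _)) subr0 -z1E.
    rewrite -[v in LHS](subrK (s b (ext_proj E b v))) linearD /= -rhoE -cmh_nat.
    by rewrite (sm_casimir SN) linear0 add0r.
  rewrite z2E; congr (ext_inj F _ _); apply/eqP; rewrite -subr_eq0; apply/eqP.
  apply: (sm_evaln_inj (S := SN)) => r; rewrite linearB /=.
  by rewrite (sc _ _ _ r z1E) (tc _ _ _ r z2E) subrr.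
exists (@CModHom _ _ _ E F H hN); split=> [n u|n y] /=.
  have rho_i : rho n (ext_inj E n u) = u.
    by apply: injE; rewrite rhoE ext_proj_inj (linear_fun0 (sl _)) subr0.
  by rewrite /h rho_i ext_proj_inj (linear_fun0 (tl _)) add0r.
by rewrite /h linearD /= tp ext_proj_inj addr0.
Qed.

(** Two lifts of [M] differ by vectors of [N], which the Casimir tensor kills. *)
Lemma ext_invariant_uniq E lam lam' : inv E lam -> inv E lam' -> lam = lam'.
Proof.
move=> [s [_ sp _ sc]] [t [_ tp _ tc]].
have evX : sm_evaln SM (fun=> 1%N) (sm_unit SM) = 1.
  have <- : cmod_act M (psi J 1 (fun=> 1%N)) (sm_unit SM) = sm_unit SM.
    by rewrite psi1 pw1 cmod_act_id.
  by rewrite sm_evaln_psi /dotn big_ord1 muln1 expr1n.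
have [z zE] := casimir_ext SM (s 1%N (sm_unit SM)).
have tE : cmod_act E (c ⊗ I 1) (t 1%N (sm_unit SM)) = ext_inj E 3%N z.
  have st0 : ext_proj E 1%N (t 1%N (sm_unit SM) - s 1%N (sm_unit SM)) = 0.
    by rewrite linearB /= tp sp subrr.
  have [u uE] := ext_lift st0.
  rewrite -[t 1%N (sm_unit SM)](subrK (s 1%N (sm_unit SM))) uE linearD /= -cmh_nat.
  by rewrite (sm_casimir SN) linear0 add0r.
have := sc _ _ _ (fun=> 1%N) zE; rewrite (tc _ _ _ (fun=> 1%N) tE).
by rewrite evX muln1 !mulr1.
Qed.

Lemma ext_invariant_transport E F lam : ext_equiv E F -> inv E lam -> inv F lam.
Proof.
move=> [h [hi hp]] [s [sl sp sG sc]]; exists (fun n w => h n (s n w)).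
split=> [n a u v|n w|m n f Gf w|n w z r].
- by rewrite sl linearP.
- by rewrite hp sp.
- by rewrite (sG _ _ _ Gf) cmh_nat.
- have [z1 z1E] := casimir_ext SM (s n w).
  rewrite -cmh_nat z1E hi => /(@ext_injP _ _ _ _ _ F) z1z; rewrite -z1z.
  exact: sc z1E.
Qed.

Lemma ext_invariant_baer E F lam lam' :
  inv E lam -> inv F lam' -> inv (baer_sum E F) (lam + lam').
Proof.
move=> [s [sl sp sG sc]] [t [tl tp tG tc]].
have st n w : subspace_pred (baer_pullback E F n) (s n w, t n w).
  by apply/asboolP; rewrite /= sp tp.
pose u n w : baer_sum E F n := qspace_pi (baer_antidiag E F n) (exist _ (s n w, t n w) (st n w)).
exists u; split=> [n a w w'|n w|m n f Gf w|n w z r].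
- rewrite /u -linearP; congr (qspace_pi _ _); apply: val_inj => /=.
  by rewrite sl tl.
- by rewrite /u /= baer_proj_funE /= sp.
- rewrite /u /= quotient_mapE; congr (qspace_pi _ _); apply: val_inj => /=.
  by rewrite /csum_act /= (sG _ _ _ Gf) (tG _ _ _ Gf).
have [z1 z1E] := casimir_ext SM (s n w); have [z2 z2E] := casimir_ext SM (t n w).
rewrite /u /= quotient_mapE => /qspace_piP [v /=].
rewrite /csum_act /= z1E z2E => -[]; rewrite -linearB => /(@ext_injP _ _ _ _ _ E) zv.
rewrite subr0 -linearN => /(@ext_injP _ _ _ _ _ F) z2v.
have -> : z = z1 + z2 by rewrite z2v -zv opprB addrC subrK.
by rewrite linearD /= (sc _ _ _ r z1E) (tc _ _ _ r z2E) !mulrDl.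
Qed.

Lemma ext_invariant_scale E a lam : inv E lam -> inv (ext_scale a E) (a * lam).
Proof.
move=> [s [sl sp sG sc]].
pose u n w : ext_scale a E n := qspace_pi (ext_scale_sub a E n) (0, s n w).
exists u; split=> [n b w w'|n w|m n f Gf w|n w z r].
- rewrite /u -linearP; congr (qspace_pi _ _).
  by rewrite sl; congr pair; rewrite /= scaler0 addr0.
- by rewrite /u /= ext_scale_proj_funE /= sp.
- rewrite /u /= quotient_mapE; congr (qspace_pi _ _).
  by rewrite (sG _ _ _ Gf); congr pair; rewrite /= linear0.
have [z1 z1E] := casimir_ext SM (s n w).
rewrite /u /= quotient_mapE => /qspace_piP [v /=].
rewrite /csum_act /= linear0 z1E => -[zv]; rewrite subr0 -linearN => /(@ext_injP _ _ _ _ _ E) z1v.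
have -> : z = a *: z1 by rewrite z1v scalerN -zv sub0r opprK.
by rewrite linearZ /= (sc _ _ _ r z1E) /GRing.scale /= !mulrA.
Qed.

Definition ext_scalar E : k := sval (cid2 (ext_invariant_exists char0 SM SN E)).

Lemma ext_scalarP E : inv E (ext_scalar E).
Proof. by rewrite /ext_scalar; case: cid2. Qed.

Lemma ext_scalarE E lam : inv E lam -> ext_scalar E = lam.
Proof. by apply: ext_invariant_uniq; exact: ext_scalarP. Qed.

Lemma ext_scalar_degree E : d' != (d + 2)%N -> ext_scalar E = 0.
Proof.
have [lam invE [-> /eqP //|lam0] _] := ext_invariant_exists char0 SM SN E.
by rewrite (ext_scalarE invE).
Qed.

Lemma ext_equivE E F : ext_equiv E F <-> ext_scalar E = ext_scalar F.
Proof.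
split=> [EF|EF].
  by apply/esym/ext_scalarE/(ext_invariant_transport EF)/ext_scalarP.
by apply: (ext_invariant_equiv (ext_scalarP E)); rewrite EF; exact: ext_scalarP.
Qed.

Lemma ext_classE E F : ext_class E = ext_class F <-> ext_scalar E = ext_scalar F.
Proof.
split=> [/(congr1 sval) /= EF|EF]; first by apply/ext_equivE; rewrite EF; exact/ext_equivE.
apply: eq_exist; apply/funext => G; apply/propext.
by split=> /ext_equivE G0; apply/ext_equivE; rewrite -G0 EF.
Qed.

Lemma ext_class_surj (x : Ext1 M N) : exists E, x = ext_class E.
Proof. by case: x => x [E xE]; exists E; exact: eq_exist. Qed.

Definition class_scalar (x : Ext1 M N) : k := ext_scalar (sval (cid (ext_class_surj x))).

Lemma class_scalarE E : class_scalar (ext_class E) = ext_scalar E.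
Proof. by rewrite /class_scalar; case: cid => F /= /ext_classE. Qed.

Lemma ext_scalar_baer E F : ext_scalar (baer_sum E F) = ext_scalar E + ext_scalar F.
Proof. by apply/ext_scalarE/ext_invariant_baer; exact: ext_scalarP. Qed.

Lemma ext_scalar_scale a E : ext_scalar (ext_scale a E) = a * ext_scalar E.
Proof. by apply/ext_scalarE/ext_invariant_scale/ext_scalarP. Qed.

Lemma Ext1_iso_field E : inv E 1 -> Ext1_iso M N (k^o : lmodType k).
Proof.
move=> /ext_scalarE E1; exists class_scalar; split=> [|F G|a F].
- exists (fun a => ext_class (ext_scale a E)) => [x|a]; last first.
    by rewrite class_scalarE ext_scalar_scale E1 mulr1.
  have [F ->] := ext_class_surj x; rewrite class_scalarE.
  by apply/ext_classE; rewrite ext_scalar_scale E1 mulr1.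
- by rewrite !class_scalarE ext_scalar_baer.
- by rewrite !class_scalarE ext_scalar_scale.
Qed.

Lemma Ext1_iso_zero E : d' != (d + 2)%N -> Ext1_iso M N ('rV[k]_0 : lmodType k).
Proof.
move=> dd; exists (fun=> 0); split=> [|F G|a F]; rewrite ?addr0 ?scaler0 //.
exists (fun=> ext_class E) => [x|v]; last by apply/rowP => -[].
by have [F ->] := ext_class_surj x; apply/ext_classE; rewrite !ext_scalar_degree.
Qed.

End Classification.

(** A triangular action on [N + M] is functorial exactly when its off-diagonal
    entry [D] is a derivation. *)
Section TwistedExtension.
Variables (k : fieldType) (O : Type) (C : lincat k O) (M N : cmodule C).
Variable D : forall x y, lhom C x y -> M x -> N y.
Hypothesis D_linr : forall x y (f : lhom C x y), linear (D f).
Hypothesis D_linl : forall x y a (f g : lhom C x y) w, D (a *: f + g) w = a *: D f w + D g w.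
Hypothesis D_id : forall x (w : M x), D (lid x) w = 0.
Hypothesis D_comp : forall x y z (g : lhom C y z) (f : lhom C x y) w,
  D (lcomp g f) w = D g (cmod_act M f w) + cmod_act N g (D f w).

Definition twist_act x y (f : lhom C x y) (v : (N x * M x)%type) : (N y * M y)%type :=
  (cmod_act N f v.1 + D f v.2, cmod_act M f v.2).

Fact twist_act_linear x y (f : lhom C x y) : linear (twist_act f).
Proof.
move=> a u v; rewrite /twist_act linearP /= D_linr; congr pair; last by rewrite /= linearP.
by rewrite /= scalerDr addrACA.
Qed.

Definition twist_map x y (f : lhom C x y) : {linear (N x * M x)%type -> (N y * M y)%type} :=
  HB.pack (twist_act f) (GRing.isLinear.Build k _ _ *:%R (twist_act f) (twist_act_linear f)).

Definition twist_cmod : cmodule C.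
refine (@CModule k O C (fun x => (N x * M x)%type) (fun x y f => twist_map f) _ _ _).
- move=> x y a f g [u v]; rewrite /= /twist_act /= !cmod_act_linear D_linl.
  by congr pair; rewrite /= scalerDr addrACA.
- by move=> x [u v]; rewrite /= /twist_act /= !cmod_act_id D_id addr0.
- move=> x y z g f [u v]; rewrite /= /twist_act /= !cmod_act_comp D_comp linearD.
  by rewrite /= -addrA [D g _ + _]addrC.
Defined.

Fact twist_inj_linear x : linear (fun n : N x => (n, 0) : twist_cmod x).
Proof. by move=> a u v; congr pair; rewrite /= scaler0 addr0. Qed.
Definition twist_inj_fun x : {linear N x -> twist_cmod x} :=
  HB.pack (fun n : N x => (n, 0) : twist_cmod x)
    (GRing.isLinear.Build k _ _ *:%R _ (@twist_inj_linear x)).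

Fact twist_proj_linear x : linear (fun v : twist_cmod x => v.2).
Proof. by []. Qed.
Definition twist_proj_fun x : {linear twist_cmod x -> M x} :=
  HB.pack (fun v : twist_cmod x => v.2)
    (GRing.isLinear.Build k _ _ *:%R _ (@twist_proj_linear x)).

Definition twist_inj : cmod_hom N twist_cmod.
exists twist_inj_fun => x y f v.
by rewrite /= /twist_act /= linear0 (linear_fun0 (D_linr f)) addr0.
Defined.

Definition twist_proj : cmod_hom twist_cmod M.
by exists twist_proj_fun.
Defined.

Definition twist_ext : extension M N.
refine (@Extension k O C M N twist_cmod twist_inj twist_proj _ _ _).
- by move=> x u v [].
- by move=> x m; exists (0, m).
- move=> x [u v] /=; split=> [->|[n [_ ->]]] //.
  by exists u.
Defined.

End TwistedExtension.

(** * The PROP of kernels between affine spaces *)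

(** Kernels from [k ^ n] to [k ^ m], that is, the operators from functions on
    [k ^ m] to functions on [k ^ n] of the form
    [phi |-> (y |-> sum of the c_i * phi (x_i))] with the finite combination of
    points depending arbitrarily on [y]. They form a PROP in which the functions
    on the additive group [k] are a Hopf algebra. *)
Section Kernels.
Variable k : fieldType.
Implicit Types m n p q : nat.

Definition kern m n : lmodType k := 'rV[k]_n -> {malg k['rV[k]_m]}.

Definition kcomp m n p (g : kern n p) (f : kern m n) : kern m p :=
  fun z => lin_ext f (g z).

Definition kid n : kern n n := fun y => << y >>.

Definition kern_cat : lincat k nat.
refine (@LinCat k nat kern kid kcomp _ _ _ _ _).
- by move=> m n p f a g g'; apply/funext => z; rewrite /kcomp lin_ext_linear.
- move=> m n p g a f f'; apply/funext => z; rewrite /kcomp.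
  rewrite -[RHS]/(a *: lin_ext f (g z) + lin_ext f' (g z)).
  rewrite /lin_ext scaler_sumr -big_split; apply: eq_bigr => t _ /=.
  by rewrite scalerDr !scalerA mulrC.
- move=> m n p q h g f; apply/funext => z; rewrite /kcomp.
  move: (h z); apply: linear_malg_eq => [a u v|a u v|x].
  + exact: lin_ext_linear.
  + by rewrite !lin_ext_linear.
  + by rewrite !lin_extU.
- move=> m n f; apply/funext => z; by rewrite /kcomp lin_extU.
- move=> m n f; apply/funext => z; rewrite /kcomp /kid.
  move: (f z); apply: linear_malg_eq => [a u v|a u v|x] //.
  + exact: lin_ext_linear.
  + by rewrite lin_extU.
Defined.

Definition pt_tens m m' : {malg k['rV[k]_m]} -> {malg k['rV[k]_m']} ->
    {malg k['rV[k]_(m + m')]} :=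
  bilin_ext (fun x x' => << row_mx x x' >>).

Definition ktens m n m' n' (f : kern m n) (g : kern m' n') : kern (m + m') (n + n') :=
  fun y => pt_tens (f (lsubmx y)) (g (rsubmx y)).

Lemma pt_tensl m m' (v : {malg k['rV[k]_m']}) : linear (fun u : {malg k['rV[k]_m]} => pt_tens u v).
Proof. exact: bilin_ext_linearl. Qed.
Lemma pt_tensr m m' (u : {malg k['rV[k]_m]}) : linear (@pt_tens m m' u).
Proof. exact: bilin_ext_linearr. Qed.
Lemma pt_tensU m m' (x : 'rV[k]_m) (x' : 'rV[k]_m') :
  pt_tens << x >> << x' >> = << row_mx x x' >>.
Proof. exact: bilin_extU. Qed.

(** The kernel of the pullback of functions along a map. *)
Definition kmap m n (A : 'rV[k]_n -> 'rV[k]_m) : kern m n := fun y => << A y >>.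

Lemma kmap_comp m n p (B : 'rV[k]_p -> 'rV[k]_n) (A : 'rV[k]_n -> 'rV[k]_m) :
  (kmap B : lhom kern_cat n p) ∘ (kmap A : lhom kern_cat m n) = kmap (A \o B).
Proof. by apply/funext => y; rewrite /= /kcomp lin_extU. Qed.

Lemma kmap_tens m n m' n' (A : 'rV[k]_n -> 'rV[k]_m) (B : 'rV[k]_n' -> 'rV[k]_m') :
  ktens (kmap A) (kmap B) = kmap (fun y => row_mx (A (lsubmx y)) (B (rsubmx y))).
Proof. by apply/funext => y; rewrite /ktens pt_tensU. Qed.

Definition kern_sym m n : lhom kern_cat (m + n) (n + m) :=
  kmap (fun y => row_mx (rsubmx y) (lsubmx y)).

Lemma lcast_kern m m' n n' (em : m = m') (en : n = n') (f : kern m n) y :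
  lcast (C := kern_cat) em en f y =
  lin_ext (fun x => << castmx (erefl, em) x >>) (f (castmx (erefl, esym en) y)).
Proof.
move: y; case: _ / em; case: _ / en => y; rewrite /lcast /cast_hom /=.
rewrite [castmx _ y]castmx_id; move: (f y).
apply: linear_malg_eq => [a u v|a u v|x] //; first exact: lin_ext_linear.
by rewrite lin_extU castmx_id.
Qed.

Lemma lcast_kmap m m' n n' (em : m = m') (en : n = n') (A : 'rV[k]_n -> 'rV[k]_m) :
  lcast (C := kern_cat) em en (kmap A) =
  kmap (fun y => castmx (erefl, em) (A (castmx (erefl, esym en) y))).
Proof. by apply/funext => y; rewrite lcast_kern lin_extU. Qed.

Lemma castmx_row3 n1 n2 n3 (e : (n1 + (n2 + n3) = n1 + n2 + n3)%N)
    (a : 'rV[k]_n1) (b : 'rV_n2) (c : 'rV_n3) :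
  castmx (erefl, e) (row_mx a (row_mx b c)) = row_mx (row_mx a b) c.
Proof. by rewrite row_mxA castmx_comp castmx_id. Qed.

Lemma castmx_row3' n1 n2 n3 (e : (n1 + n2 + n3 = n1 + (n2 + n3))%N)
    (a : 'rV[k]_n1) (b : 'rV_n2) (c : 'rV_n3) :
  castmx (erefl, e) (row_mx (row_mx a b) c) = row_mx a (row_mx b c).
Proof. by rewrite -(castmx_row3 (esym e)) castmx_comp castmx_id. Qed.

Lemma castmx_row0 n (e : (n + 0 = n)%N) (a : 'rV[k]_n) (b : 'rV_0) :
  castmx (erefl, e) (row_mx a b) = a.
Proof.
apply/rowP => j; rewrite castmxE (_ : cast_ord _ j = lshift 0 j); last exact: val_inj.
by rewrite row_mxEl; congr (a _ _); apply: val_inj.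
Qed.

Lemma castmx_row0' n (e : (n = n + 0)%N) (a : 'rV[k]_n) :
  lsubmx (castmx (erefl, e) a) = a.
Proof.
have := castmx_row0 (esym e) (lsubmx (castmx (erefl, e) a)) (rsubmx (castmx (erefl, e) a)).
by rewrite hsubmxK castmx_comp castmx_id.
Qed.

Lemma rsubmx0 n (y : 'rV[k]_(0 + n)) : rsubmx y = y.
Proof. by rewrite -[RHS]hsubmxK row_thin_mx. Qed.

Lemma rowP3 n1 n2 n3 (y : 'rV[k]_(n1 + n2 + n3)) :
  exists a b c, y = row_mx (row_mx a b) c.
Proof.
by exists (lsubmx (lsubmx y)), (rsubmx (lsubmx y)), (rsubmx y); rewrite !hsubmxK.
Qed.

Definition kern_prop : linprop k.
refine (@LinProp k kern_cat ktens kern_sym _ _ _ _ _ _ _ _ _ _ _).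
- by move=> m n m' n' g a f f'; apply/funext => y; exact: pt_tensl.
- by move=> m n m' n' f a g g'; apply/funext => y; exact: pt_tensr.
- by move=> m n; rewrite [LHS]kmap_tens; apply/funext => y; rewrite /kmap hsubmxK.
- move=> m n p m' n' p' g f g' f'; apply/funext => y; rewrite /= /kcomp /ktens.
  move: (g _); apply: linear_malg_eq => [a u v|a u v|x].
  + by rewrite lin_ext_linear pt_tensl.
  + by rewrite pt_tensl lin_ext_linear.
  move: (g' _); apply: linear_malg_eq => [a u v|a u v|x'].
  + by rewrite lin_ext_linear pt_tensr.
  + by rewrite pt_tensr lin_ext_linear.
  by rewrite !lin_extU pt_tensU lin_extU row_mxKl row_mxKr.
- move=> m n m' n' m'' n'' f g h; apply/funext => y; rewrite lcast_kern /= /ktens.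
  have [y1 [y2 [y3 ->]]] := rowP3 y; rewrite castmx_row3' !(row_mxKl, row_mxKr).
  move: (f _); apply: linear_malg_eq => [a u v|a u v|x].
  + by rewrite pt_tensl lin_ext_linear.
  + by rewrite !pt_tensl.
  move: (g _); apply: linear_malg_eq => [a u v|a u v|x'].
  + by rewrite pt_tensl pt_tensr lin_ext_linear.
  + by rewrite pt_tensr !pt_tensl.
  move: (h _); apply: linear_malg_eq => [a u v|a u v|x''].
  + by rewrite !pt_tensr lin_ext_linear.
  + by rewrite !pt_tensr.
  rewrite !pt_tensU lin_extU; congr << _ >>.
  exact: castmx_row3.
- move=> m n f; apply/funext => y; rewrite /= /ktens /kid rsubmx0.
  move: (f y); apply: linear_malg_eq => [a u v|a u v|x] //; first exact: pt_tensr.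
  by rewrite pt_tensU row_thin_mx.
- move=> m n f; apply/funext => y; rewrite lcast_kern /= /ktens castmx_row0' /kid.
  move: (f y); apply: linear_malg_eq => [a u v|a u v|x] //.
  + by rewrite pt_tensl lin_ext_linear.
  + by rewrite pt_tensU lin_extU castmx_row0.
- move=> m n m' n' f g; apply/funext => y; rewrite /= /kcomp lin_extU /ktens.
  rewrite row_mxKl row_mxKr.
  move: (f _); apply: linear_malg_eq => [a u v|a u v|x].
  + exact: pt_tensl.
  + by rewrite pt_tensr lin_ext_linear.
  move: (g _); apply: linear_malg_eq => [a u v|a u v|x'].
  + exact: pt_tensr.
  + by rewrite pt_tensl lin_ext_linear.
  by rewrite !pt_tensU lin_extU /kern_sym /kmap row_mxKl row_mxKr.
- move=> m n; rewrite kmap_comp; apply/funext => y.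
  by rewrite /kmap /= row_mxKl row_mxKr hsubmxK.
- move=> m; rewrite lcast_kmap; apply/funext => y; rewrite /kmap; congr << _ >>.
  by rewrite castmx_row0 rsubmx0 castmx_id.
- move=> m n p; rewrite !kmap_tens !lcast_kmap kmap_comp; apply/funext => y.
  rewrite /kmap; congr << _ >>; rewrite castmx_id /=.
  have [a [b [c ->]]] := rowP3 y.
  by rewrite castmx_row3' !(row_mxKl, row_mxKr) !castmx_row3 !(row_mxKl, row_mxKr).
Defined.

End Kernels.

(** * Functions on the additive group as a Casimir Hopf algebra *)

Section KernelHopf.
Variable k : fieldType.
Local Notation K := (kern_prop k).

Definition kmap_hom m n (A : 'rV[k]_n -> 'rV[k]_m) : lhom K m n := kmap A.

Lemma kmap_hom_comp m n p (B : 'rV[k]_p -> 'rV[k]_n) (A : 'rV[k]_n -> 'rV[k]_m) :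
  kmap_hom B ∘ kmap_hom A = kmap_hom (A \o B).
Proof. exact: kmap_comp. Qed.

Lemma kmap_hom_compl m n p (B : 'rV[k]_p -> 'rV[k]_n) (f : lhom K m n) y :
  (kmap_hom B ∘ f) y = f (B y).
Proof. exact: lin_extU. Qed.

Lemma kmap_hom_tens m n m' n' (A : 'rV[k]_n -> 'rV[k]_m) (B : 'rV[k]_n' -> 'rV[k]_m') :
  kmap_hom A ⊗ kmap_hom B = kmap_hom (fun y => row_mx (A (lsubmx y)) (B (rsubmx y))).
Proof. exact: kmap_tens. Qed.

Lemma kmap_hom_sym m n : psym K m n = kmap_hom (fun y => row_mx (rsubmx y) (lsubmx y)).
Proof. by []. Qed.

Lemma kmap_hom_id n : (lid n : lhom K n n) = kmap_hom id.
Proof. by []. Qed.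

Lemma kmap_hom_eq m n (A B : 'rV[k]_n -> 'rV[k]_m) : A =1 B -> kmap_hom A = kmap_hom B.
Proof. by move=> /funext ->. Qed.

Definition kern_casimir_fun (y : 'rV[k]_(1 + 1)) : k := lsubmx y 0 0 * rsubmx y 0 0.

Local Notation k_mu := (kmap_hom (fun y : 'rV[k]_1 => row_mx y y) : lhom K 2 1).
Local Notation k_eta := (kmap_hom (fun _ : 'rV[k]_1 => 0) : lhom K 0 1).
Local Notation k_Delta := (kmap_hom (fun y : 'rV[k]_(1 + 1) => lsubmx y + rsubmx y) : lhom K 1 2).
Local Notation k_eps := (kmap_hom (fun _ : 'rV[k]_0 => 0) : lhom K 1 0).
Local Notation k_anti := (kmap_hom (fun y : 'rV[k]_1 => - y) : lhom K 1 1).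
Definition k_cas : lhom K 0 2 := (fun y : 'rV[k]_(1 + 1) => kern_casimir_fun y *: << 0 >>) : kern k 0 2.

Lemma rowA111 (a b c : 'rV[k]_1) :
  row_mx a (row_mx b c) = row_mx (row_mx a b) c :> 'rV[k]_3.
Proof. by have := @castmx_row3 k 1 1 1 erefl a b c; rewrite castmx_id. Qed.

Lemma rowA1111 (a b c d : 'rV[k]_1) :
  row_mx (row_mx a b) (row_mx c d) = row_mx (row_mx a (row_mx b c)) d :> 'rV[k]_4.
Proof.
by rewrite rowA111; have := @castmx_row3 k (1 + 1) 1 1 erefl (row_mx a b) c d; rewrite castmx_id.
Qed.

Lemma row10 (a : 'rV[k]_1) (b : 'rV[k]_0) : row_mx a b = a :> 'rV[k]_1.
Proof. by rewrite -[RHS](castmx_row0 (erefl : (1 + 0 = 1)%N) a b) castmx_id. Qed.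

Lemma lsub10 (y : 'rV[k]_(1 + 0)) : lsubmx y = y.
Proof. by have := @castmx_row0' k 1 erefl y; rewrite castmx_id. Qed.

Lemma rowP2 (y : 'rV[k]_(1 + 1)) : exists a b, y = row_mx a b.
Proof. by exists (lsubmx y), (rsubmx y); rewrite hsubmxK. Qed.

Lemma rV0 (a : 'rV[k]_0) : a = 0.
Proof. by apply/rowP => -[]. Qed.

Lemma kmap_hom_tens_cas m n (A : 'rV[k]_n -> 'rV[k]_m) y :
  (kmap_hom A ⊗ k_cas) y = kern_casimir_fun (rsubmx y) *: << row_mx (A (lsubmx y)) 0 >>.
Proof.
rewrite -[LHS]/(pt_tens _ _) /k_cas (linear_funZ (@pt_tensr k _ _ _)).
by rewrite pt_tensU.
Qed.

Local Ltac kh := rewrite ?kmap_hom_id ?kmap_hom_sym; repeat (rewrite ?kmap_hom_tens ?kmap_hom_comp).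
Local Ltac kh_start := apply: kmap_hom_eq => y /=.

(** The algebra of functions on the additive group [k]: the operations are
    pullbacks along the diagonal, the projection to a point, the addition, the
    zero and the opposite. The Casimir tensor is the bilinear function [x y], for
    which additivity in [x] is the first axiom; the adjoint action is trivial as
    the group is commutative. *)
Definition kern_casimir : casimir_hopf K.
refine (@CasimirHopf k K k_mu k_eta k_Delta k_eps k_anti k_cas
  _ _ _ _ _ _ _ _ _ _ _ _ _ _ _ _).
- by kh; kh_start; rewrite !(row_mxKl, row_mxKr) rowA111.
- by kh; kh_start; rewrite !(row_mxKl, row_mxKr) row_thin_mx.
- by kh; kh_start; rewrite !(row_mxKl, row_mxKr) row10.
- kh; kh_start; have [a [b [c ->]]] := rowP3 (y : 'rV_(1 + 1 + 1)).
  transitivity (a + b + c); first by rewrite !(row_mxKl, row_mxKr).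
  by rewrite -rowA111 !(row_mxKl, row_mxKr) addrA.
- by kh; kh_start; rewrite !(row_mxKl, row_mxKr) add0r rsubmx0.
- by kh; kh_start; rewrite !(row_mxKl, row_mxKr) addr0 lsub10.
- kh; kh_start; have [a [b ->]] := rowP2 y; rewrite !(row_mxKl, row_mxKr).
  by rewrite rowA1111 !(row_mxKl, row_mxKr) -rowA1111 !(row_mxKl, row_mxKr).
- by kh; kh_start; rewrite [LHS]rV0 [RHS]rV0.
- by kh; kh_start.
- by kh; kh_start; rewrite [LHS]rV0 [RHS]rV0.
- by kh; kh_start; rewrite !(row_mxKl, row_mxKr) addNr.
- by kh; kh_start; rewrite !(row_mxKl, row_mxKr) subrr.
- by kh; kh_start; rewrite !(row_mxKl, row_mxKr) addrC.
- kh; apply/funext => y; have [a [b [c ->]]] := rowP3 (y : 'rV_(1 + 1 + 1)).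
  rewrite kmap_hom_compl -[LHS]/(kern_casimir_fun _ *: _) /kern_casimir_fun.
  rewrite !(row_mxKl, row_mxKr) mxE mulrDl scalerDl; congr (_ + _).
    by rewrite kmap_hom_compl !(row_mxKl, row_mxKr) row10 /k_cas /kern_casimir_fun row_mxKl row_mxKr.
  rewrite -rowA111 kmap_hom_tens_cas /kern_casimir_fun !(row_mxKl, row_mxKr).
  by rewrite [row_mx 0 0]rV0.
- kh; apply/funext => y; rewrite kmap_hom_compl /k_cas /kern_casimir_fun.
  by rewrite row_mxKl row_mxKr mulrC.
move=> ad; have -> : ad = kmap_hom (fun y => row_mx 0 y).
  rewrite /ad; kh; kh_start; rewrite !(row_mxKl, row_mxKr) -rowA111 !(row_mxKl, row_mxKr).
  by rewrite rowA111 !(row_mxKl, row_mxKr) subrr.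
kh; apply/funext => y; have [a [b ->]] := rowP2 y; rewrite kmap_hom_compl kmap_hom_tens_cas /=.
rewrite !(row_mxKl, row_mxKr) rowA1111 !(row_mxKl, row_mxKr) -rowA1111 !(row_mxKl, row_mxKr).
rewrite /kcomp /k_cas linearZ /= lin_extU addr0.
by rewrite row10.
Defined.

Lemma kern_muE : mu kern_casimir = kmap_hom (fun y : 'rV[k]_1 => row_mx y y).
Proof. by []. Qed.
Lemma kern_etaE : eta kern_casimir = kmap_hom (fun _ : 'rV[k]_1 => 0).
Proof. by []. Qed.
Lemma kern_DeltaE :
  Delta kern_casimir = kmap_hom (fun y : 'rV[k]_(1 + 1) => lsubmx y + rsubmx y).
Proof. by []. Qed.
Lemma kern_epsE : epsilon kern_casimir = kmap_hom (fun _ : 'rV[k]_0 => 0).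
Proof. by []. Qed.
Lemma kern_antiE : antipode kern_casimir = kmap_hom (fun y : 'rV[k]_1 => - y).
Proof. by []. Qed.

End KernelHopf.

(** * Homogeneous functions *)

Local Opaque kern_casimir.

Section FunctionModule.
Variable k : fieldType.
Local Notation A := (jacobi_prop k).
Local Notation J := (jacobi_casimir k).
Local Notation H := (kern_casimir k).

Definition fun_act m n (f : kern k m n) (phi : 'rV[k]_m -> k^o) : 'rV[k]_n -> k^o :=
  fun y => lin_ext phi (f y).

Fact fun_act_linear m n (f : kern k m n) : linear (fun_act f).
Proof.
move=> a u v; apply/funext => y.
rewrite -[RHS]/(a *: lin_ext u (f y) + lin_ext v (f y)).
rewrite /fun_act /lin_ext scaler_sumr -big_split; apply: eq_bigr => t _ /=.
by rewrite scalerDr !scalerA mulrC.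
Qed.

Definition fun_map m n (f : kern k m n) : {linear ('rV[k]_m -> k^o) -> ('rV[k]_n -> k^o)} :=
  HB.pack (fun_act f) (GRing.isLinear.Build k ('rV[k]_m -> k^o) ('rV[k]_n -> k^o) *:%R
    (fun_act f) (fun_act_linear f)).

(** Functions on the affine spaces [k ^ n], with the Casimir tensor acting as
    multiplication by the product of the first two coordinates. *)
Definition kern_module : cmodule (kern_prop k).
refine (@CModule k nat (kern_prop k) (fun n => 'rV[k]_n -> k^o) (fun m n f => fun_map f) _ _ _).
- by move=> m n a f g v; apply/funext => y; exact: lin_ext_linear.
- by move=> n v; apply/funext => y; rewrite /= /fun_act lin_extU.
- move=> m n p g f v; apply/funext => z; rewrite /= /fun_act /kcomp.
  move: (g z); apply: linear_malg_eq => [a s t|a s t|x].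
  + by rewrite !lin_ext_linear.
  + exact: lin_ext_linear.
  + by rewrite !lin_extU.
Defined.

Definition fun_module : cmodule A := pullback_module (jacobi_rec H) kern_module.

Lemma fun_moduleE m n (f : lhom A m n) phi y :
  cmod_act fun_module f phi y = lin_ext phi ((jhom_eval H f : kern k m n) y).
Proof. by []. Qed.

Lemma fun_module_kmap m n (f : lhom A m n) (B : 'rV[k]_n -> 'rV[k]_m) phi y :
  jhom_eval H f = kmap_hom B -> cmod_act fun_module f phi y = phi (B y).
Proof. by move=> fB; rewrite fun_moduleE fB lin_extU. Qed.

Definition dot_map n (a : nat -> nat) (y : 'rV[k]_n) : 'rV[k]_1 :=
  const_mx (\sum_(i < n) (a i)%:R * y 0 i).

Lemma kern_star m n (B : 'rV[k]_m -> 'rV[k]_1) (B' : 'rV[k]_n -> 'rV[k]_1) :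
  star H (kmap_hom B) (kmap_hom B') = kmap_hom (fun y => B (lsubmx y) + B' (rsubmx y)).
Proof.
rewrite /star kern_DeltaE (kmap_hom_tens B B') kmap_hom_comp; apply: kmap_hom_eq => y /=.
by rewrite row_mxKl row_mxKr.
Qed.

Lemma kern_pw b : pw H b = kmap_hom (fun y : 'rV[k]_1 => b%:R *: y).
Proof.
elim: b => [|b IHb].
  by rewrite -[LHS]/(eta H ∘ epsilon H) kern_etaE kern_epsE kmap_hom_comp; apply: kmap_hom_eq => y /=; rewrite scale0r.
rewrite -[LHS]/(mu H ∘ star H (lid 1%N) (pw H b)) IHb kern_muE kmap_hom_id (kern_star id) kmap_hom_comp; apply: kmap_hom_eq => y /=.
by rewrite row_mxKl row_mxKr mulrS scalerDl scale1r.
Qed.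

Lemma kern_psi n a : psi H n a = kmap_hom (@dot_map n a).
Proof.
elim: n a => [|n IHn] a.
  by apply: kmap_hom_eq => y; apply/rowP => j; rewrite !mxE big_ord0.
rewrite -[LHS]/(star H (pw H (a 0%N)) (psi H n (fun j => a j.+1))) IHn kern_pw kern_star; apply: kmap_hom_eq => y.
apply/rowP => j; rewrite !mxE (ord1 j) big_ord_recl; congr (_ * _ + _).
  by congr (y _ _); apply: val_inj.
apply: eq_bigr => i _; rewrite mxE; congr (_ * y _ _); exact: val_inj.
Qed.

Lemma fun_module_casimir n phi (y : 'rV[k]_(2 + n)) :
  cmod_act fun_module (casimir J ⊗ (lid n : lhom A n n)) phi y =
  kern_casimir_fun (lsubmx y) * phi (rsubmx y).
Proof.
rewrite fun_moduleE jacobi_eval_tens jacobi_eval_cas jacobi_eval_id.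
rewrite -[X in lin_ext _ X]/(pt_tens (kern_casimir_fun (lsubmx y) *: << 0 >>) << rsubmx y >>).
rewrite (linear_funZ (pt_tensl _)) pt_tensU linearZ /= lin_extU row_thin_mx.
by [].
Qed.

(** Order of vanishing at the origin, tested on lines. *)
Definition vanishing n e (phi : 'rV[k]_n -> k^o) : Prop :=
  forall y, exists p : {poly k}, forall t, phi (t *: y) = t ^+ e * p.[t].

Lemma vanishing_lin n e a (phi psi : 'rV[k]_n -> k^o) :
  vanishing e phi -> vanishing e psi -> vanishing e (a *: phi + psi).
Proof.
move=> v1 v2 y; have [p pE] := v1 y; have [q qE] := v2 y.
exists (a *: p + q) => t; rewrite hornerD hornerZ mulrDr mulrCA -pE -qE.
by [].
Qed.

Lemma vanishing0 n e : vanishing e (0 : 'rV[k]_n -> k^o).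
Proof. by move=> y; exists 0 => t; rewrite horner0 mulr0. Qed.

Lemma vanishingD n e (phi psi : 'rV[k]_n -> k^o) :
  vanishing e phi -> vanishing e psi -> vanishing e (phi + psi).
Proof. by move=> v1 v2; rewrite -[phi]scale1r; exact: vanishing_lin. Qed.

Lemma vanishing_weaken n e e' (phi : 'rV[k]_n -> k^o) :
  (e <= e')%N -> vanishing e' phi -> vanishing e phi.
Proof.
move=> ee v y; have [p pE] := v y; exists ('X^(e' - e) * p) => t.
by rewrite hornerM hornerXn mulrA -exprD subnKC.
Qed.

(** The Hopf operations preserve the order of vanishing, being pullbacks along
    homogeneous maps. *)
Lemma vanishing_kmap m n e (f : lhom A m n) (B : 'rV[k]_n -> 'rV[k]_m) phi :
  jhom_eval H f = kmap_hom B -> (forall t y, B (t *: y) = t *: B y) ->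
  vanishing e phi -> vanishing e (cmod_act fun_module f phi).
Proof.
move=> fB hB v y; have [p pE] := v (B y).
by exists p => t; rewrite (fun_module_kmap _ _ fB) hB pE.
Qed.

Lemma vanishing_tens b m n e (g : lhom A m n) (B : 'rV[k]_n -> 'rV[k]_m) phi :
  jhom_eval H g = kmap_hom B -> (forall t y, B (t *: y) = t *: B y) ->
  vanishing e phi -> vanishing e (cmod_act fun_module (g ⊗ (lid b : lhom A b b)) phi).
Proof.
move=> gB hB; apply: (@vanishing_kmap _ _ _ _
  (fun y => row_mx (B (lsubmx y)) (rsubmx y))).
  by rewrite jacobi_eval_tens gB jacobi_eval_id kmap_hom_id kmap_hom_tens.
by move=> t y; rewrite scale_row_mx -hB -!linearZ.
Qed.

Lemma vanishing_casimir b e (phi : 'rV[k]_b -> k^o) : vanishing e phi ->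
  vanishing (2 + e) (cmod_act fun_module (casimir J ⊗ (lid b : lhom A b b)) phi).
Proof.
move=> v y; have [p pE] := v (rsubmx y).
exists (kern_casimir_fun (lsubmx y) *: p) => t.
have lE : lsubmx (t *: y) = t *: lsubmx y by rewrite linearZ.
have rE : rsubmx (t *: y) = t *: rsubmx y by rewrite linearZ.
rewrite fun_module_casimir lE rE pE hornerZ /kern_casimir_fun !linearZ /= !mxE.
by rewrite exprD expr2 [t * _ * (t * _)]mulrACA [LHS]mulrACA.
Qed.

End FunctionModule.

Section CasimirExtension.
Variables (k : fieldType) (d : nat).
Hypothesis char0 : [pchar k] =i pred0.
Local Notation A := (jacobi_prop k).
Local Notation J := (jacobi_casimir k).
Local Notation H := (kern_casimir k).
Local Notation Fun := (fun_module k).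
Local Notation I n := (lid n : lhom A n n).

Definition row_seq n (y : 'rV[k]_n) (j : nat) : k :=
  if insub j is Some i then y 0 i else 0.

Lemma row_seqE n (y : 'rV[k]_n) (i : 'I_n) : row_seq y i = y 0 i.
Proof. by rewrite /row_seq valK. Qed.

Lemma row_seq_lt n (y : 'rV[k]_n) j (jn : (j < n)%N) : row_seq y j = y 0 (Ordinal jn).
Proof. exact: (row_seqE y (Ordinal jn)). Qed.

Section Embedding.
Variables (e : nat) (M : cmodule A) (S : sym_module e M).

(** The embedding of a symmetric power in a module on which the Casimir tensor
    acts nontrivially. *)
Definition sm_fun n (w : M n) : Fun n := fun y => sm_eval S (row_seq y) w.

Lemma sm_fun_linear n : linear (@sm_fun n).
Proof. by move=> a u v; apply/funext => y; exact: sm_eval_linear. Qed.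
HB.instance Definition _ n := GRing.isLinear.Build k (M n) (Fun n) *:%R
  (@sm_fun n) (@sm_fun_linear n).

Definition coord_pow : Fun 1%N := fun y => y 0 0 ^+ e.

Lemma sm_fun_psi n a :
  sm_fun (cmod_act M (psi J n a) (sm_unit S)) = cmod_act Fun (psi J n a) coord_pow.
Proof.
apply/funext => y; rewrite (fun_module_kmap (B := dot_map (n := n) a)); last first.
  by rewrite jacobi_eval_psi kern_psi.
rewrite /sm_fun sm_eval_psi /coord_pow mxE; congr (_ ^+ _).
by apply: eq_bigr => i _; rewrite row_seqE.
Qed.

(** Both sides agree on the columns of the generator, as [coord_pow] is its image
    and the bialgebra operations send columns to columns. *)
Lemma sm_fun_act m n (f : lhom A m n) (w : M m) : hopf_gen J f ->
  sm_fun (cmod_act M f w) = cmod_act Fun f (sm_fun w).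
Proof.
move=> Gf; move: w; apply: (@sm_ind _ _ _ S) => [a u v uE vE||a].
- by rewrite !linearP /= uE vE.
- by rewrite !linear0.
- have [b fb] := hopf_gen_psi a Gf.
  by rewrite -cmod_act_comp fb !sm_fun_psi -cmod_act_comp fb.
Qed.

Lemma sm_fun_antipode b (w : M (1 + b)%N) :
  sm_fun (cmod_act M (antipode J ⊗ I b) w) = cmod_act Fun (antipode J ⊗ I b) (sm_fun w).
Proof. exact: (antipode_natural (h := @sm_fun) (fun m n f Gf w => sm_fun_act w Gf)). Qed.

Lemma sm_fun_homog n (w : M n) t y : sm_fun w (t *: y) = t ^+ e * sm_fun w y.
Proof.
move: w; apply: (@sm_ind _ _ _ S) => [a u v uE vE||a].
- rewrite linearP -[LHS]/(a * sm_fun u (t *: y) + sm_fun v (t *: y)) uE vE.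
  by rewrite -[X in _ = _ * X]/(a * sm_fun u y + sm_fun v y) mulrDr mulrCA.
- by rewrite linear0 mulr0.
rewrite sm_fun_psi !(fun_module_kmap (B := dot_map (n := n) a)); last 2 first.
- by rewrite jacobi_eval_psi kern_psi.
- by rewrite jacobi_eval_psi kern_psi.
rewrite /coord_pow !mxE -exprMn mulr_sumr; congr (_ ^+ _).
by apply: eq_bigr => i _; rewrite mxE mulrCA.
Qed.

Lemma sm_fun_vanishing n (w : M n) : vanishing e (sm_fun w).
Proof. by move=> y; exists (sm_fun w y)%:P => t; rewrite hornerC sm_fun_homog. Qed.

Lemma sm_eval_ext n (y y' : nat -> k) (w : M n) :
  (forall j, (j < n)%N -> y j = y' j) -> sm_eval S y w = sm_eval S y' w.
Proof.
move=> yy; move: w; apply: (@sm_ind _ _ _ S) => [a u v uE vE||a].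
- by rewrite !linearP /= uE vE.
- by rewrite !linear0.
- rewrite !sm_eval_psi; congr (_ ^+ _); apply: eq_bigr => i _.
  by rewrite yy.
Qed.

(** On a line through the origin a form of degree [e] is a multiple of [t ^ e],
    which is divisible by [t ^ (e + 1)] only if it is zero. *)
Lemma sm_fun_vanishing0 n (w : M n) : vanishing e.+1 (sm_fun w) -> w = 0.
Proof.
move=> vw; suff w0 y : sm_fun w y = 0.
  apply: (sm_eval_inj (s := S)) => r; rewrite -[RHS](w0 (\row_(j < n) (r j)%:R)).
  apply: sm_eval_ext => j jn; rewrite -[j]/(val (Ordinal jn)) row_seqE mxE //.
have [p pE] := vw y; pose q := (sm_fun w y)%:P * 'X^e - 'X^(e.+1) * p.
have q0 (a : nat) : q.[a%:R] = 0.
  rewrite /q hornerD hornerN !hornerM hornerC !hornerXn -pE sm_fun_homog.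
  by rewrite mulrC subrr.
have qi i : q`_i = 0.
  case: (ltnP i (size q)) => [iq|/(nth_default 0) //].
  apply: (vector_poly_eq0 char0 (W := k^o) (w := fun i => q`_i) _ iq) => a.
  rewrite -[RHS](q0 a) horner_coef; apply: eq_bigr => j _.
  by rewrite mulrC.
have := qi e; rewrite coefB coefCM coefXn eqxx mulr1 coefXnM ltnSn subr0.
exact.
Qed.

End Embedding.

End CasimirExtension.

(** * The extension given by the Casimir tensor *)

Local Opaque jacobi_prop jacobi_casimir kern_casimir.

Section CasimirDerivation.
Variables (k : fieldType) (d : nat).
Hypothesis char0 : [pchar k] =i pred0.
Local Notation A := (jacobi_prop k).
Local Notation J := (jacobi_casimir k).
Local Notation H := (kern_casimir k).
Local Notation Fun := (fun_module k).
Local Notation I n := (lid n : lhom A n n).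
Variables (M N : cmodule A) (SM : sym_module d M) (SN : sym_module (d + 2)%N N).
Local Notation iM := (sm_fun SM).
Local Notation iN := (sm_fun SN).
Hypothesis casimir_mul : forall n (w : M n), exists z : N (2 + n)%N, forall y : nat -> k,
  sm_eval SN y z = y 0%N * y 1%N * sm_eval SM (fun j => y j.+2) w.

Local Notation van := (vanishing (d + 2).+1).

(** The image of a form [w] of degree [d] under [f] is the form [f w], plus the form
    [z] of degree [d + 2], up to terms of higher order. *)
Definition second_order m n (f : lhom A m n) (w : M m) (z : N n) : Prop :=
  van (cmod_act Fun f (iM w) - iM (cmod_act M f w) - iN z).

(** The part of the filtration by degree that makes [second_order] compatible
    with composition. *)
Definition well_filtered m n (f : lhom A m n) : Prop :=
  [/\ forall w, exists z, second_order f w z,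
      forall z, van (cmod_act Fun f (iN z) - iN (cmod_act N f z)) &
      forall phi, van phi -> van (cmod_act Fun f phi)].

Let sub_lin (V : lmodType k) a (x x' y y' z z' : V) :
  (a *: x + x') + (a *: - y - y') + (a *: - z - z') = a *: (x - y - z) + (x' - y' - z').
Proof. by rewrite !scalerDr [a *: x + x' + _]addrACA [LHS]addrACA. Qed.

Let sub_lin2 (V : lmodType k) a (x x' y y' : V) :
  (a *: x + x') + (a *: - y - y') = a *: (x - y) + (x' - y').
Proof. by rewrite scalerDr addrACA. Qed.

Let sub_comp (V : zmodType) (x a b c e f : V) :
  (x - a - b) + (b - c) + (a - e - f) = x - e - (f + c).
Proof.
rewrite [x - a - b + _]addrA subrK [x - a - c]addrAC -[a - e - f]addrA [LHS]addrA subrK.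
by rewrite opprD !addrA [x - c - e]addrAC [LHS]addrAC.
Qed.

Lemma second_order_linr m n (f : lhom A m n) a u v z z' :
  second_order f u z -> second_order f v z' -> second_order f (a *: u + v) (a *: z + z').
Proof.
move=> h h'; rewrite /second_order !linearP /= sub_lin; exact: vanishing_lin.
Qed.

Lemma second_order_linl m n (f g : lhom A m n) a w z z' :
  second_order f w z -> second_order g w z' -> second_order (a *: f + g) w (a *: z + z').
Proof.
move=> h h'; rewrite /second_order !cmod_act_linear !linearP /= sub_lin.
exact: vanishing_lin.
Qed.

Lemma second_order_comp m n p (g : lhom A n p) (f : lhom A m n) w z z' :
  well_filtered g -> second_order f w z -> second_order g (cmod_act M f w) z' ->
  second_order (g ∘ f) w (z' + cmod_act N g z).
Proof.
move=> [_ gN gF] fz gz; rewrite /second_order !cmod_act_comp linearD.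
have := vanishingD (vanishingD (gF _ fz) (gN z)) gz.
congr (vanishing _ _); rewrite !linearB; exact: sub_comp.
Qed.

(** A form of degree [d + 2] and of higher order is zero. *)
Lemma second_order_uniq m n (f : lhom A m n) w z z' :
  second_order f w z -> second_order f w z' -> z = z'.
Proof.
move=> h h'; apply/eqP; rewrite -subr_eq0; apply/eqP.
apply: (sm_fun_vanishing0 char0 (S := SN)).
have := vanishing_lin (-1) h h'; congr (vanishing _ _).
by rewrite scaleN1r opprB addrA subrK -linearB.
Qed.

Lemma second_order0 m n (f : lhom A m n) w :
  cmod_act Fun f (iM w) = iM (cmod_act M f w) -> second_order f w 0.
Proof. by move=> fE; rewrite /second_order fE subrr linear0 subr0; exact: vanishing0. Qed.

Lemma well_filtered_natural m n (f : lhom A m n) :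
  (forall w, cmod_act Fun f (iM w) = iM (cmod_act M f w)) ->
  (forall z, cmod_act Fun f (iN z) = iN (cmod_act N f z)) ->
  (forall phi, van phi -> van (cmod_act Fun f phi)) -> well_filtered f.
Proof.
move=> fM fN fv; split=> // [w|z]; first by exists 0; exact: second_order0.
by rewrite fN subrr; exact: vanishing0.
Qed.

Lemma well_filtered_hopf m n (f : lhom A m n) : hopf_gen J f ->
  (forall phi, van phi -> van (cmod_act Fun f phi)) -> well_filtered f.
Proof. by move=> Gf; apply: well_filtered_natural => w; rewrite sm_fun_act. Qed.

Lemma second_order_casimir n (w : M n) : exists2 z, second_order (casimir J ⊗ I n) w z &
  forall y : nat -> k, sm_eval SN y z = y 0%N * y 1%N * sm_eval SM (fun j => y j.+2) w.
Proof.
have [z zE] := casimir_mul w; exists z => //.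
rewrite /second_order (sm_casimir SM) linear0 subr0 (_ : _ - _ = 0); first exact: vanishing0.
apply/eqP; rewrite subr_eq0; apply/eqP/funext => y; rewrite fun_module_casimir.
rewrite /sm_fun zE /kern_casimir_fun; congr (_ * _ * _).
- by rewrite (row_seq_lt (j := 0) y isT) !mxE; congr (y _ _); apply: val_inj.
- by rewrite (row_seq_lt (j := 1) y isT) !mxE; congr (y _ _); apply: val_inj.
apply: sm_eval_ext => j jn; have jn2 : (j.+2 < 2 + n)%N by [].
by rewrite (row_seq_lt y jn2) (row_seq_lt _ jn) mxE; congr (y _ _); apply: val_inj.
Qed.

Lemma well_filtered_all m n (f : lhom A m n) : well_filtered f.
Proof.
rewrite (jacobi_jeval f); apply: (@closed_jeval _ _ well_filtered) => {m n f}.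
- by move=> n; apply: well_filtered_natural => *; rewrite !cmod_act_id.
- move=> m n p g f gW fW; case: (gW) => [gM gN gF]; case: (fW) => [fM fN fF].
  split=> [w|z|phi vp].
  + have [z fz] := fM w; have [z' gz] := gM (cmod_act M f w).
    by exists (z' + cmod_act N g z); exact: second_order_comp.
  + rewrite !cmod_act_comp; have := vanishingD (gF _ (fN z)) (gN (cmod_act N f z)).
    by rewrite linearB /= addrA subrK.
  + by rewrite cmod_act_comp; exact/gF/fF.
- move=> a b; apply: well_filtered_hopf; first exact: hopf_gen_sym.
  move=> phi; apply: (@vanishing_kmap _ _ _ _ _ (fun y => row_mx (lsubmx y)
    (row_mx (row_mx (rsubmx (lsubmx (rsubmx y))) (lsubmx (lsubmx (rsubmx y))))
       (rsubmx (rsubmx y))))).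
    by rewrite !jacobi_eval_tens !jacobi_eval_id jacobi_eval_sym !kmap_hom_id kmap_hom_sym !kmap_hom_tens.
  by move=> t y /=; rewrite !scale_row_mx !linearZ.
- by move=> m n; apply: well_filtered_natural => *; rewrite ?cmod_act0 ?linear0 //; exact: vanishing0.
- move=> m n a f g [fM fN fF] [gM gN gF]; split=> [w|z|phi vp].
  + have [z fz] := fM w; have [z' gz] := gM w.
    by exists (a *: z + z'); exact: second_order_linl.
  + rewrite !cmod_act_linear !linearP sub_lin2; exact: vanishing_lin.
  + by rewrite cmod_act_linear; apply: vanishing_lin; [exact: fF|exact: gF].
- move=> b; apply: well_filtered_hopf; first exact: hopf_gen_mu.
  move=> phi; apply: vanishing_tens (etrans (jacobi_eval_mu H) (kern_muE k)) _.
  by move=> t y; apply/esym; exact: (@scale_row_mx _ _ _ _ t y y).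
- move=> b; apply: well_filtered_hopf; first exact: hopf_gen_eta.
  move=> phi; apply: vanishing_tens (etrans (jacobi_eval_eta H) (kern_etaE k)) _.
  by move=> t y; rewrite scaler0.
- move=> b; apply: well_filtered_hopf; first exact: hopf_gen_Delta.
  move=> phi; apply: vanishing_tens (etrans (jacobi_eval_Delta H) (kern_DeltaE k)) _.
  by move=> t y; rewrite !linearZ /= scalerDr.
- move=> b; apply: well_filtered_hopf; first exact: hopf_gen_eps.
  move=> phi; apply: vanishing_tens (etrans (jacobi_eval_eps H) (kern_epsE k)) _.
  by move=> t y; rewrite scaler0.
- move=> b; apply: well_filtered_natural => [w|z|phi]; rewrite ?sm_fun_antipode //.
  apply: vanishing_tens (etrans (jacobi_eval_anti H) (kern_antiE k)) _.
  by move=> t y; rewrite scalerN.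
- move=> b; split=> [w|z|phi vp].
  + by have [z fz _] := second_order_casimir w; exists z.
  + rewrite (sm_casimir SN) linear0 subr0.
    apply: (@vanishing_weaken _ _ _ (2 + (d + 2))); first exact: leqnSn.
    exact/vanishing_casimir/sm_fun_vanishing.
  + apply: (@vanishing_weaken _ _ _ (2 + (d + 2).+1)); first exact: leq_addl.
    exact: vanishing_casimir.
Qed.

Lemma second_order_total m n (f : lhom A m n) w : {z | second_order f w z}.
Proof. by apply: cid; case: (well_filtered_all f). Qed.

(** The action of the part of [f] with exactly one Casimir tensor. *)
Definition casimir_part m n (f : lhom A m n) w : N n := sval (second_order_total f w).

Lemma casimir_partP m n (f : lhom A m n) w : second_order f w (casimir_part f w).
Proof. exact: svalP. Qed.

Lemma casimir_partE m n (f : lhom A m n) w z : second_order f w z -> casimir_part f w = z.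
Proof. exact: second_order_uniq (casimir_partP f w). Qed.

Lemma casimir_part_linr m n (f : lhom A m n) : linear (casimir_part f).
Proof. by move=> a u v; apply: casimir_partE; apply: second_order_linr; exact: casimir_partP. Qed.

Lemma casimir_part_linl m n a (f g : lhom A m n) w :
  casimir_part (a *: f + g) w = a *: casimir_part f w + casimir_part g w.
Proof. by apply: casimir_partE; apply: second_order_linl; exact: casimir_partP. Qed.

Lemma casimir_part_id n (w : M n) : casimir_part (lid n) w = 0.
Proof. by apply: casimir_partE; apply: second_order0; rewrite !cmod_act_id. Qed.

Lemma casimir_part_comp m n p (g : lhom A n p) (f : lhom A m n) w :
  casimir_part (g ∘ f) w = casimir_part g (cmod_act M f w) + cmod_act N g (casimir_part f w).
Proof.
apply: casimir_partE; apply: second_order_comp; first exact: well_filtered_all.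
  exact: casimir_partP.
exact: casimir_partP.
Qed.

Definition casimir_ext_unit : extension M N :=
  twist_ext casimir_part_linr casimir_part_linl casimir_part_id casimir_part_comp.

Lemma casimir_ext_unit_invariant : ext_invariant SM SN casimir_ext_unit 1.
Proof.
exists (fun n w => (0, w) : casimir_ext_unit n); split=> [n a u v|n w|m n f Gf w|n w z r].
- by congr pair; rewrite /= scaler0 addr0.
- by [].
- rewrite /= /twist_act /= linear0 add0r; congr pair.
  by apply/esym/casimir_partE/second_order0; rewrite sm_fun_act.
rewrite /= /twist_act /= linear0 add0r => -[<- _].
have [z' cz zE] := second_order_casimir w.
by rewrite (casimir_partE cz) /sm_evaln zE mul1r natrM.
Qed.

End CasimirDerivation.

Section ProductWithCoordinates.
Variables (k : fieldType) (d n : nat).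

Definition two_coords (v : adual k (2 + n)) : {ffun 'I_(d + 2) -> adual k (2 + n)} :=
  [ffun l => match fintype.split l with
    | inl _ => v
    | inr j => adual_coord k (lshift n j)
    end].

(** For a power of a linear form the product is the product of [d + 2] linear
    forms, and powers span. *)
Lemma sym_mul_coords (w : sym_power d (adual k n)) (char0 : [pchar k] =i pred0) :
  exists z : sym_power (d + 2) (adual k (2 + n)), forall y : nat -> k,
    sym_eval y z = y 0%N * y 1%N * sym_eval (fun j => y j.+2) w.
Proof.
move: w; apply: (form_pow_ind char0) => [a u v [z zE] [z' zE']||a].
- by exists (a *: z + z') => y; rewrite !linearP /= zE zE' mulrDr /GRing.scale /= mulrCA.
- by exists 0 => y; rewrite !linear0 mulr0.
pose a' j := if j is j'.+2 then a j' else 0%N.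
exists (sym_prod (two_coords (adual_form k (2 + n) a'))) => y.
have coordE i : point_eval y (adual_coord k i) = y i :> k.
  rewrite /point_eval (bigD1 i) //= adual_coordE eqxx mul1r big1 ?addr0 // => j ji.
  by rewrite adual_coordE (negPf ji) mul0r.
rewrite sym_evalE form_pow_eval big_split_ord /= mulrC; congr (_ * _).
  by rewrite !big_ord_recl big_ord0 mulr1 !ffunE !(unsplitK (inr _)) !coordE.
rewrite (eq_bigr (fun=> \sum_(i < n) (a i)%:R * y i.+2)) ?prodr_const ?card_ord // => l _.
rewrite ffunE (unsplitK (inl l)) /point_eval.
under eq_bigr => i _ do rewrite adual_formE.
by rewrite !big_ord_recl /= !mul0r !add0r.
Qed.

End ProductWithCoordinates.

Theorem theorem3p7 (k : fieldType) (char0 : [pchar k] =i pred0) (d d' : nat) :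
  Ext1_iso (T_module (sym_adual k d)) (T_module (sym_adual k d'))
    (if d' == (d + 2)%N then (k^o : lmodType k) else 'rV[k]_0).
Proof.
have [->|dd] := eqVneq d' (d + 2)%N.
  apply: (Ext1_iso_field char0 (casimir_ext_unit_invariant char0
    (SM := T_sym_module d char0) (SN := T_sym_module (d + 2) char0) _)).
  move=> n w; exact: sym_mul_coords.
have lin0 m n (f : lhom (jacobi_prop k) m n) :
    linear (fun _ : T_module (sym_adual k d) m => 0 : T_module (sym_adual k d') n).
  by move=> a u v; rewrite scaler0 addr0.
apply: (Ext1_iso_zero char0 (T_sym_module d char0) (T_sym_module d' char0)
  (twist_ext lin0 _ _ _) dd).
- by move=> m n a f g w; rewrite scaler0 addr0.
- by [].
- by move=> m n p g f w; rewrite linear0 addr0.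
Qed.
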